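(* Let $r\ge2$ and let $AD$, $BD$, $A^\vee D^\vee$ be the symmetric $r\times r$ matrices defined in the context. All sums are over $\boldsymbol n=(n_1,\ldots,n_r)^T\in\mathbb{N}^r$. (1) With $\boldsymbol b_0=(0,\ldots,0)^T$, $$\sum_{\boldsymbol n}\frac{q^{\frac12\boldsymbol n^TAD\boldsymbol n+\boldsymbol n^T\boldsymbol b_0}}{(q^2;q^2)_{n_1}\cdots(q^2;q^2)_{n_{r-1}}(q;q)_{n_r}}=\frac{(q^{8r-4},q^{8r},q^{16r-4};q^{16r-4})_\infty}{(q,q^3,q^4;q^4)_\infty}+q^{\frac{r-1}2}\frac{(-q,q^{4r-2},-q^{4r-1};-q^{4r-1})_\infty}{(q^2,q^2,q^4;q^4)_\infty}.$$ (2) For $1\le j\le r$, with $\boldsymbol b_j=(1,0,\ldots,0,2,4,\ldots,2(r-1-j),r-j)^T$ (first entry $1$; $i$-th entry $2\max(i-j,0)$ for $2\le i\le r-1$; last entry $r-j$), $$\sum_{\boldsymbol n}\frac{q^{\frac12\boldsymbol n^TAD\boldsymbol n+\boldsymbol n^T\boldsymbol b_j}}{(q^2;q^2)_{n_1}\cdots(q^2;q^2)_{n_{r-1}}(q;q)_{n_r}}=\frac{(q^{2j},-q^{4r-2j-1},-q^{4r-1};-q^{4r-1})_\infty}{(q^2,q^2,q^4;q^4)_\infty}+q^{\frac{3r-2j-1}2}\frac{(q^{4j},q^{16r-4j-4},q^{16r-4};q^{16r-4})_\infty}{(q,q^3,q^4;q^4)_\infty}.$$ (3) With $\boldsymbol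 b_0=(0,\ldots,0,-\frac12)^T$, $$\sum_{\boldsymbol n}\frac{q^{\frac12\boldsymbol n^TBD\boldsymbol n+\boldsymbol n^T\boldsymbol b_0}}{(q^2;q^2)_{n_1}\cdots(q^2;q^2)_{n_{r-1}}(q;q)_{n_r}}=\frac{(q^{8r-8},q^{8r-4},q^{16r-12};q^{16r-12})_\infty}{(q,q^3,q^4;q^4)_\infty}+q^{\frac{2r-3}4}\frac{(-q,q^{4r-4},-q^{4r-3};-q^{4r-3})_\infty}{(q^2,q^2,q^4;q^4)_\infty}.$$ (4) For $1\le j\le r$, with $\boldsymbol b_j=(1,0,\ldots,0,2,4,\ldots,2(r-j-1),r-j-1)^T$ (first entry $1$; $i$-th entry $2\max(i-j,0)$ for $2\le i\le r-1$; last entry $r-j-1$), $$\sum_{\boldsymbol n}\frac{q^{\frac12\boldsymbol n^TBD\boldsymbol n+\boldsymbol n^T\boldsymbol b_j}}{(q^2;q^2)_{n_1}\cdots(q^2;q^2)_{n_{r-1}}(q;q)_{n_r}}=\frac{(q^{2j},-q^{4r-3-2j},-q^{4r-3};-q^{4r-3})_\infty}{(q^2,q^2,q^4;q^4)_\infty}+q^{\frac{6r-4j-5}4}\frac{(q^{4j},q^{16r-4j-12},q^{16r-12};q^{16r-12})_\infty}{(q,q^3,q^4;q^4)_\infty}.$$ (5) With $\boldsymbol b_0=(1,1,2,3,\ldots,r-1)^T$ (first entry $1$; $i$-th entry $i-1$ for $2\le i\le r$), $$\sum_{\boldsymbol n}\frac{q^{\frac12\boldsymbol n^TA^\vee D^\vee\boldsymbol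 n+\boldsymbol n^T\boldsymbol b_0}}{(q;q)_{n_1}\cdots(q;q)_{n_{r-1}}(q^2;q^2)_{n_r}}=\frac{(q^{\frac12},q^{2r-1},q^{2r-\frac12};q^{2r-\frac12})_\infty}{(q^{\frac12},q^{\frac32},q^2;q^2)_\infty}.$$ (6) For $1\le j\le r$, with $\boldsymbol b_j=(0,\ldots,0,1,2,\ldots,r-j)^T$ ($i$-th entry $\max(i-j,0)$), $$\sum_{\boldsymbol n}\frac{q^{\frac12\boldsymbol n^TA^\vee D^\vee\boldsymbol n+\boldsymbol n^T\boldsymbol b_j}}{(q;q)_{n_1}\cdots(q;q)_{n_{r-1}}(q^2;q^2)_{n_r}}=\frac{(q^j,q^{2r-j-\frac12},q^{2r-\frac12};q^{2r-\frac12})_\infty}{(q^{\frac12},q^{\frac32},q^2;q^2)_\infty}.$$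
   Context: Here $q=e^{2\pi i\tau}$ with $\mathrm{Im}\,\tau>0$ and $q^x=e^{2\pi ix\tau}$ for rational $x$; $\mathbb{N}=\{0,1,2,\ldots\}$. For $|p|<1$: $(a;p)_\infty=\prod_{n\ge0}(1-ap^n)$, $(a;p)_n=\prod_{k=0}^{n-1}(1-ap^k)$, $(a_1,\ldots,a_k;p)_\infty=\prod_i(a_i;p)_\infty$ (the base $p$ may be e.g. $-q^{4r-1}$). The symmetric $r\times r$ matrices are as follows. - $AD$: $(AD)_{11}=2$, $(AD)_{1r}=(AD)_{r1}=1$, $(AD)_{1j}=(AD)_{j1}=0$ for $2\le j\le r-1$; $(AD)_{ij}=4(\min(i,j)-1)$ for $2\le i,j\le r-1$; $(AD)_{ir}=(AD)_{ri}=2(i-1)$ for $2\le i\le r-1$; $(AD)_{rr}=r-1$. - $BD$: the same as $AD$ except $(BD)_{rr}=r-\frac12$. - $A^\vee D^\vee$: entry $(1,1)$ is $1$, entries $(1,r)$ and $(r,1)$ are $1$, entries $(1,j)$ and $(j,1)$ are $0$ for $2\le j\le r-1$; entry $(i,j)$ is $2(\min(i,j)-1)$ for $2\le i,j\le r$. *)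

(* Defs.v *)
From HB Require Import structures.
From mathcomp Require Import all_boot all_order all_algebra.
From mathcomp Require Import finmap complex.
From mathcomp Require Import all_classical all_reals all_analysis.

Set Implicit Arguments.
Unset Strict Implicit.
Unset Printing Implicit Defensive.

Import Order.TTheory GRing.Theory Num.Theory.
Import numFieldNormedType.Exports.

Local Open Scope classical_set_scope.
Local Open Scope ring_scope.

Section Analysis.
Variable K : numFieldType.

(* Unconditional convergence: the finite partial sums converge to [l] along
   the directed set of finite subsets of [I]. *)
Definition has_sum (I : choiceType) (f : I -> K) (l : K) : Prop :=
  forall e : K, 0 < e ->
  exists A : {fset I}, forall B : {fset I}, (A `<=` B)%fset ->
    `|\sum_(i <- B) f i - l| < e.

Definition qpoch (a p : K) (n : nat) : K := \prod_(0 <= k < n) (1 - a * p ^+ k).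

Definition qpoch_inf (a p : K) : K := lim (qpoch a p n @[n --> \oo]).

(* (a_1, ..., a_k; p)_oo, with s = [:: a_1; ...; a_k] *)
Definition qpochs_inf (s : seq K) (p : K) : K := \prod_(a <- s) qpoch_inf a p.

End Analysis.

Section Nahm.
Variable R : realType.

Definition cexp (z : R[i]) : R[i] :=
  (expR (complex.Re z))%:C%C *
  Complex (cos (complex.Im z)) (sin (complex.Im z)).

(* q^x for q = e^(2 pi i tau) *)
Definition qpow (tau : R[i]) (x : rat) : R[i] :=
  cexp (2 * (@pi R)%:C%C * 'i%C * ratr x * tau).

(* Entry [i] of [d] is the power of q that is the base of the factor
   (q^(d_i); q^(d_i))_(n_i) of the denominator. *)
Definition nahm_term (tau : R[i]) (r : nat) (A : 'M[rat]_r) (b d : 'cV[rat]_r)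
    (n : 'cV[nat]_r) : R[i] :=
  let n' : 'cV[rat]_r := map_mx (fun k => k%:R) n in
  qpow tau (2^-1 * (n'^T *m A *m n') 0 0 + (n'^T *m b) 0 0)
  / \prod_(i < r) qpoch (qpow tau (d i 0)) (qpow tau (d i 0)) (n i 0).

End Nahm.

(* Below, entries are given by functions of indices starting from 1, whereas
   ordinals start from 0. *)
Definition mx_of_entries (r : nat) (f : nat -> nat -> rat) : 'M[rat]_r :=
  \matrix_(i < r, j < r) f i.+1 j.+1.

Definition col_of_entries (r : nat) (f : nat -> rat) : 'cV[rat]_r :=
  \col_(i < r) f i.+1.

Definition AD_entry (r i j : nat) : rat :=
  if (i == 1%N) && (j == 1%N) then 2
  else if i == 1%N then (if j == r then 1 else 0)
  else if j == 1%N then (if i == r then 1 else 0)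
  else if (i == r) && (j == r) then r%:R - 1
  else if j == r then 2 * (i%:R - 1)
  else if i == r then 2 * (j%:R - 1)
  else 4 * ((minn i j)%:R - 1).

Definition AD (r : nat) : 'M[rat]_r := mx_of_entries r (AD_entry r).

Definition BD (r : nat) : 'M[rat]_r :=
  mx_of_entries r (fun i j =>
    if (i == r) && (j == r) then r%:R - 2^-1 else AD_entry r i j).

Definition AvDv (r : nat) : 'M[rat]_r :=
  mx_of_entries r (fun i j =>
    if (i == 1%N) && (j == 1%N) then 1
    else if i == 1%N then (if j == r then 1 else 0)
    else if j == 1%N then (if i == r then 1 else 0)
    else 2 * ((minn i j)%:R - 1)).

Definition d_AD (r : nat) : 'cV[rat]_r :=
  col_of_entries r (fun i => if i == r then 1 else 2).

Definition d_AvDv (r : nat) : 'cV[rat]_r :=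
  col_of_entries r (fun i => if i == r then 2 else 1).

(* In the vectors [b_*] the truncated subtraction (i - j)%N is max(i - j, 0). *)
Definition b_AD (r j : nat) : 'cV[rat]_r :=
  col_of_entries r (fun i =>
    if i == 1%N then 1
    else if i == r then r%:R - j%:R
    else 2 * (i - j)%N%:R).

Definition b0_BD (r : nat) : 'cV[rat]_r :=
  col_of_entries r (fun i => if i == r then - 2^-1 else 0).

Definition b_BD (r j : nat) : 'cV[rat]_r :=
  col_of_entries r (fun i =>
    if i == 1%N then 1
    else if i == r then r%:R - j%:R - 1
    else 2 * (i - j)%N%:R).

Definition b0_AvDv (r : nat) : 'cV[rat]_r :=
  col_of_entries r (fun i => if i == 1%N then 1 else i%:R - 1).

Definition b_AvDv (r j : nat) : 'cV[rat]_r :=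
  col_of_entries r (fun i => (i - j)%N%:R).

(* Main.v *)
(* In the tail sums S_s = n_(s+2) + ... + n_(r-1) + e, with e = n_r / 2 for AD and BD
   and e = n_r for AvDv, each exponent is a sum of terms S_s^2 and S_s plus a part in
   n_1 and n_r only. For AD and BD the sum is split by the parity of n_r, so that the
   shifted tail sums become integers. The sum over n_1 is then Euler's, and the sums
   over n_2, ..., n_(r-1) are an iteration of the Bailey lemma.

   The Bailey pairs involved are bilateral: sum_n (-z)^n p^(n(n-1)/2) / ((q)_(L - rho n)
   (q)_(L + rho n + s)) = beta_L with rho = 1 or 2. Eight of them, proved by WZ
   certificates, are the starting points; one step of the chain multiplies z and p by
   powers of q, and s may drop from rho to rho - 1 along the way. Letting L go to
   infinity (Tannery's theorem), Jacobi's triple product evaluates the left-hand side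
   as (z, p/z, p; p)_oo / (q; q)_oo^2. *)
Require Import Defs.
From mathcomp Require Import all_boot all_order all_algebra.
From mathcomp Require Import finmap complex.
From mathcomp Require Import all_classical all_reals all_analysis.
From mathcomp Require Import ring lra zify.

Set Implicit Arguments.
Unset Strict Implicit.
Unset Printing Implicit Defensive.

Import Order.TTheory GRing.Theory Num.Theory.
Import numFieldNormedType.Exports.

Local Open Scope ring_scope.

(** * Bilateral Bailey pairs *)

Section Bilateral.
Variable K : numFieldType.
Implicit Types (f g G : int -> K) (B : nat).

(** Summing out n_1 leaves (y q^m)_oo = (y)_oo / (y)_m, so a chain has to start from beta_m = b0 m /
    (y)_m, where b0 depends on n_r alone. The eight seeds are the pairs with exactly these betas:
    one for each parity of n_r in each of (1)-(4), at T = -q when rho = 1. Two of them return at T =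
    q^(1/2) for (5) and (6). Moving the tail sums by 1/2 raises the parameter s of every step by 1,
    so even n_r needs s in {0, 1} and odd n_r needs s in {1, 2}. The linear terms of b_j set in at
    one level only, which is why s drops once. The obstacle is that a Nahm sum truncated to a box
    has no closed form. The truncation is therefore done by a weight under which the identity is
    exact at every level N. The weights are bounded and tend to 1, so the limit gives unconditional
    convergence and the value together. On the theta side, the kernel in base q is compared with a
    multiple of the kernel in base p. The two have proportional limits, and the sum against the
    latter is a finite form of the triple product. *)

Definition bsum B f : K := \sum_(i < B.+1) (f (Posz i) + f (Negz i)).

Lemma bsumS B f : bsum B.+1 f = bsum B f + (f (Posz B.+1) + f (Negz B.+1)).
Proof. exact: big_ord_recr. Qed.

Lemma eq_bsum B f g : f =1 g -> bsum B f = bsum B g.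
Proof. by move=> fg; apply: eq_bigr => i _; rewrite !fg. Qed.

Lemma bsumD B f g : bsum B (fun n => f n + g n) = bsum B f + bsum B g.
Proof. by rewrite /bsum -big_split; apply: eq_bigr => i _ /=; rewrite addrACA. Qed.

Lemma bsumZ B c f : bsum B (fun n => c * f n) = c * bsum B f.
Proof. by rewrite /bsum big_distrr; apply: eq_bigr => i _ /=; rewrite mulrDr. Qed.

Lemma bsumB B f g : bsum B (fun n => f n - g n) = bsum B f - bsum B g.
Proof.
rewrite -mulN1r -bsumZ -bsumD; apply: eq_bsum => n.
by rewrite mulN1r.
Qed.

Lemma bsum_sum B (I : Type) (r : seq I) (F : I -> int -> K) :
  bsum B (fun n => \sum_(i <- r) F i n) = \sum_(i <- r) bsum B (F i).
Proof.
rewrite /bsum exchange_big /=; apply: eq_bigr => i _.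
by rewrite big_split.
Qed.

(** The range -B-1 <= n <= B is stable under n -> -1 - n, which swaps the two terms paired in
    [bsum]; the pairing is chosen for this symmetry. *)
Lemma bsum_reflect B f : bsum B (fun n => f (-1 - n)) = bsum B f.
Proof.
apply: eq_bigr => i _; rewrite addrC.
by congr (f _ + f _); lia.
Qed.

Lemma bsum_telescope B G :
  bsum B (fun n => G (n + 1) - G n) = G (Posz B.+1) - G (Negz B).
Proof.
elim: B => [|B IH].
  rewrite /bsum big_ord1.
  have -> : Negz 0 + 1 = Posz 0 by [].
  have -> : Posz 0 + 1 = Posz 1 by [].
  by ring.
rewrite bsumS IH.
have -> : Posz B.+1 + 1 = Posz B.+2 by lia.
have -> : Negz B.+1 + 1 = Negz B by lia.
by ring.
Qed.

(** The range is not stable under n -> -n. After a reflection, the difference f (-n) - f (-1 - n)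
    telescopes to the two extreme values, hence the boundary hypotheses. *)
Lemma bsum_opp B f : f (Posz B.+1) = 0 -> f (Negz B) = 0 ->
  bsum B (fun n => f (- n)) = bsum B f.
Proof.
move=> fP fN; rewrite -[RHS]bsum_reflect; apply/eqP; rewrite -subr_eq0 -bsumB.
pose G n := - f (- n).
have fG n : f (- n) - f (-1 - n) = G (n + 1) - G n.
  by rewrite /G opprK addrC opprD [-1 - n]addrC.
rewrite (eq_bsum _ fG) bsum_telescope /G.
have -> : - Posz B.+1 = Negz B by lia.
have -> : - Negz B = Posz B.+1 by lia.
by rewrite fP fN oppr0 subr0.
Qed.

(** The WZ method: a recurrence in L that holds termwise up to a telescoping difference passes to
    the sums, because the certificate G vanishes at both ends of the range. Only the sum at L = 0
    remains to be computed. *)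
Lemma bsum_wz (f G : nat -> int -> K) (u v b : nat -> K) :
    (forall L, u L != 0) ->
    (forall L n, u L * f L.+1 n - v L * f L n = G L (n + 1) - G L n) ->
    (forall L B, (L.+2 <= B)%N -> G L (Posz B.+1) = 0 /\ G L (Negz B) = 0) ->
    (forall B, (2 <= B)%N -> bsum B (f 0) = b 0) ->
    (forall L, u L * b L.+1 = v L * b L) ->
  forall L B, (L.+2 <= B)%N -> bsum B (f L) = b L.
Proof.
move=> u0 fG G0 f0 bS; elim=> [|L IH] B LB; first exact: f0.
apply: (mulfI (u0 L)); rewrite bS -(IH B); last by lia.
apply/eqP; rewrite -subr_eq0 -!bsumZ -bsumB (eq_bsum _ (fG L)) bsum_telescope.
by have [-> ->] := G0 L B (ltnW LB); rewrite subr0.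
Qed.

End Bilateral.

(** * Reciprocal q-factorials, theta coefficients and the basic summations *)

Section Pochhammer.
Variable K : numFieldType.
Implicit Types (a p q z T : K).

Lemma qpoch0 a p : qpoch a p 0 = 1.
Proof. by rewrite /qpoch big_nil. Qed.

Lemma qpochS a p n : qpoch a p n.+1 = qpoch a p n * (1 - a * p ^+ n).
Proof. by rewrite /qpoch big_nat_recr. Qed.

(** With 1/(q; q)_n = 0 for n < 0, the recurrence [iqpochS] holds on all of Z (at n = -1 its factor
    is 1 - q^0), so supports are handled by the values themselves. *)
Definition iqpoch q (n : int) : K :=
  if n is Posz m then (qpoch q q m)^-1 else 0.

Definition nonroot q := q != 0 /\ forall n, 1 - q ^+ n.+1 != 0.

Lemma nonroot_X q n : nonroot q -> nonroot (q ^+ n.+1).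
Proof.
case=> q0 q1; split=> [|m]; first by rewrite expf_neq0.
by rewrite -exprM mulSn addSn q1.
Qed.

Lemma qpoch_neq0 q n : nonroot q -> qpoch q q n != 0.
Proof.
move=> [_ q1]; elim: n => [|n IH]; first by rewrite qpoch0 oner_neq0.
by rewrite qpochS mulf_neq0 // -exprS.
Qed.

Lemma iqpoch_eq0 q (n : int) : n < 0 -> iqpoch q n = 0.
Proof. by case: n. Qed.

Lemma iqpochS q (n : int) : nonroot q -> iqpoch q n = (1 - q ^ (n + 1)) * iqpoch q (n + 1).
Proof.
move=> nq; have [q0 q1] := nq.
case: n => [] m; last case: m => [|m].
- have -> : Posz m + 1 = Posz m.+1 by lia.
  rewrite /= -exprnP qpochS -exprS invfM mulrC -mulrA.
  by rewrite mulVf ?mulr1.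
- have -> : Negz 0 + 1 = 0 by [].
  by rewrite expr0z subrr mul0r iqpoch_eq0.
- have -> : Negz m.+1 + 1 = Negz m by lia.
  by rewrite !iqpoch_eq0 ?mulr0.
Qed.

Lemma iqpoch0 q : iqpoch q 0 = 1.
Proof. by rewrite /= qpoch0 invr1. Qed.

(* n (n - 1) / 2 *)
Definition tri (n : int) : nat :=
  match n with Posz m => 'C(m, 2) | Negz m => 'C(m.+2, 2) end.

Definition theta z p (n : int) : K := (- z) ^ n * p ^+ tri n.

Lemma triS (n : int) : Posz (tri (n + 1)) = Posz (tri n) + n.
Proof.
case: n => [] m; last case: m => [|m] //.
- have -> : Posz m + 1 = Posz m.+1 by lia.
  by rewrite /= binS bin1; lia.
- have -> : Negz m.+1 + 1 = Negz m by lia.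
  by rewrite /= [in RHS]binS bin1; lia.
Qed.

Lemma thetaS z p n : z != 0 -> p != 0 ->
  theta z p (n + 1) = - z * p ^ n * theta z p n.
Proof.
move=> z0 p0; rewrite /theta expfzDr ?oppr_eq0 // expr1z.
by rewrite !exprnP triS expfzDr //; ring.
Qed.

Lemma theta0 z p : theta z p 0 = 1.
Proof. by rewrite /theta /= expr0z expr0 mulr1. Qed.

Lemma thetaN1 z p : z != 0 -> theta z p (-1) = - (p / z).
Proof.
move=> z0; rewrite /theta /= expr1 exprN1.
by field.
Qed.

Lemma thetaM z p x y n : theta z p n * (x ^ n * y ^+ tri n) =
  theta (z * x) (p * y) n.
Proof. by rewrite /theta -mulNr exprMn expfzMl; ring. Qed.

Lemma iqpoch_pred q (m n : int) : nonroot q -> m + 1 = n ->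
  iqpoch q m = (1 - q ^ n) * iqpoch q n.
Proof. by move=> nq <-; exact: iqpochS. Qed.

Lemma bsum1 B (f : int -> K) : (forall i, f (Posz i.+1) = 0) ->
  (forall i, f (Negz i.+1) = 0) -> bsum B f = f 0 + f (-1).
Proof.
move=> fP fN; rewrite /bsum big_ord_recl big1 ?addr0 // => i _.
by rewrite fP fN addr0.
Qed.

(** The finite q-binomial theorem divided by (q; q)_M, written bilaterally so that [bsum_wz]
    applies. *)
Lemma qbinomial_bsum q z M B : nonroot q -> z != 0 -> (M.+2 <= B)%N ->
  bsum B (fun n => theta z q n * (iqpoch q n * iqpoch q (Posz M - n))) =
  qpoch z q M / qpoch q q M.
Proof.
move=> nq z0; have [q0 q1] := nq; move: M B.
(* From the q-Pascal rule 1 - q^(M+1) = (1 - q^(M+1-n)) + q^(M+1-n) (1 - q^n): the second part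
   contributes [- G M n], and the term with z q^M is [G M (n + 1)]. *)
pose G M n := - (theta z q n * (q ^ (Posz M + 1 - n) *
                   (iqpoch q (n - 1) * iqpoch q (Posz M + 1 - n)))).
apply: (@bsum_wz _ _ G (fun M => 1 - q ^+ M.+1) (fun M => 1 - z * q ^+ M)
  (fun M => qpoch z q M / qpoch q q M)) => [//|M n|M B MB|B _|M].
- have Y0 : q ^ n != 0 by rewrite expfz_neq0.
  rewrite /G thetaS //.
  rewrite (@iqpoch_pred q (Posz M - n) (Posz M + 1 - n)) //; last by ring.
  rewrite (@iqpoch_pred q (n - 1) n) //; last by ring.
  rewrite (_ : Posz M.+1 - n = Posz M + 1 - n); last by lia.
  rewrite (_ : Posz M + 1 - (n + 1) = Posz M - n); last by ring.
  rewrite (_ : n + 1 - 1 = n); last by ring.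
  rewrite (@iqpoch_pred q (Posz M - n) (Posz M + 1 - n)) //; last by ring.
  rewrite !expfzDr // -!invr_expz !expr1z -!exprnP exprS.
  by field.
- split; rewrite /G.
    by rewrite [iqpoch q (Posz M + 1 - _)]iqpoch_eq0 ?mulr0 ?oppr0 //; lia.
  by rewrite [iqpoch q (_ - 1)]iqpoch_eq0 ?mul0r ?mulr0 ?oppr0 //; lia.
- rewrite bsum1 => [|i|i].
  + by rewrite theta0 [iqpoch q (-1)]iqpoch_eq0 // subr0 iqpoch0 !qpoch0; field.
  + by rewrite [iqpoch q (_ - _)]iqpoch_eq0 ?mulr0 //; lia.
  + by rewrite [iqpoch q (Negz _)]iqpoch_eq0 ?mul0r ?mulr0.
- rewrite !qpochS -exprS; move: (q1 M) (qpoch_neq0 M nq).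
  move: (1 - q ^+ M.+1) (qpoch q q M) => u d u0 d0.
  by field; rewrite u0 d0.
Qed.

Lemma theta_reflect z p n : z != 0 -> p != 0 ->
  theta z p (-1 - n) = - (p / z) * ((p / z) ^ n * (p / z) ^ n) * theta z p n.
Proof.
move=> z0 p0.
have triR : Posz (tri (-1 - n)) = Posz (tri n) + (n + n + 1).
  case: n => m.
    have -> : -1 - Posz m = Negz m by lia.
    by rewrite /= !binS !bin1 bin0; lia.
  have -> : -1 - Negz m = Posz m by lia.
  by rewrite /= !binS !bin1 bin0; lia.
have -> : (p / z) ^ n * (p / z) ^ n = p ^ n * p ^ n / ((- z) ^ n * (- z) ^ n).
  rewrite -!expfzMl invr_expz -exprz_inv -expfzMl; congr (_ ^ _).
  by field.
rewrite /theta !exprnP triR !expfzDr ?oppr_eq0 // -!invr_expz !expr1z.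
have := expfz_neq0 n p0.
have : (- z) ^ n != 0 by rewrite expfz_neq0 ?oppr_eq0.
move: ((- z) ^ n) (p ^ n) (p ^ Posz _) => x y t x0 y0.
by field; rewrite z0 x0.
Qed.

Lemma theta_opp z p n : z != 0 -> p != 0 ->
  theta z p (- n) = (p / z ^+ 2) ^ n * theta z p n.
Proof.
move=> z0 p0.
have triN : Posz (tri (- n)) = Posz (tri n) + n.
  case: n => [] [|m] //.
  - have -> : - Posz m.+1 = Negz m by lia.
    by rewrite /= binS bin1; lia.
  - have -> : - Negz m.+1 = Posz m.+2 by lia.
    by rewrite /= [in RHS]binS bin1; lia.
have -> : (p / z ^+ 2) ^ n = p ^ n / ((- z) ^ n * (- z) ^ n).
  rewrite -!expfzMl invr_expz -exprz_inv -expfzMl; congr (_ ^ _).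
  by field.
rewrite /theta !exprnP triN !expfzDr ?oppr_eq0 // -!invr_expz.
have : (- z) ^ n != 0 by rewrite expfz_neq0 ?oppr_eq0.
move: ((- z) ^ n) (p ^ n) (p ^ Posz _) => x y t x0.
by field; rewrite x0.
Qed.

(** Bailey's kernel 1/((q)_(L-r) (aq)_(L+r)) at a = q^s, up to the constant (q)_s, with r running
    over all integers. *)
Definition kern q s (L : nat) (r : int) : K :=
  iqpoch q (Posz L - r) * iqpoch q (Posz L + r + Posz s).

Lemma kern_eq0 q s L r : (Posz L < r) || (Posz L + r + Posz s < 0) ->
  kern q s L r = 0.
Proof.
case/orP=> h; rewrite /kern.
  by rewrite iqpoch_eq0 ?mul0r // subr_lt0.
by rewrite [X in _ * X]iqpoch_eq0 ?mulr0.
Qed.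

(** At L = 0 the kernel lives on -s <= r <= 0, so for s < 2 rho only n = 0 and n = -1 survive. This
    is the initial value of the WZ inductions with this kernel. *)
Lemma bsum_kern0 q rho s B (f : int -> K) : (0 < rho)%N -> (s < rho + rho)%N ->
  bsum B (fun n => f n * kern q s 0 (Posz rho * n)) =
  f 0 * iqpoch q s + f (-1) * (iqpoch q rho * iqpoch q (Posz s - Posz rho)).
Proof.
move=> rho0 srho; rewrite bsum1 => [|i|i].
- rewrite /kern; congr (_ * _ + _ * (iqpoch q _ * iqpoch q _)); try lia.
  by rewrite mulr0 (_ : Posz 0 + 0 + Posz s = s) ?iqpoch0 ?mul1r //; lia.
- by rewrite kern_eq0 ?mulr0 //; apply/orP; left; nia.
- by rewrite kern_eq0 ?mulr0 //; apply/orP; right; nia.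
Qed.

(** The finite form of Jacobi's triple product; the kernel is a central q-binomial coefficient
    divided by (p; p)_(2N). Its limit supplies the product side for every chain. *)
Lemma finite_jacobi z p N B : nonroot p -> z != 0 -> (N.+2 <= B)%N ->
  bsum B (fun n => theta z p n * kern p 0 N n) =
  qpoch z p N * qpoch (p / z) p N / qpoch p p N.*2.
Proof.
move=> np z0; have [p0 p1] := np; move: N B.
pose g N n : K := - (p ^+ N * p / z) * (1 - z * p ^+ N)
                  - p ^+ N * p * (1 - p * p ^+ N / z) / p ^ n.
pose G N n := theta z p n *
  (iqpoch p (Posz N + 1 - n) * iqpoch p (Posz N + n)) * g N n.
apply: (@bsum_wz _ _ G (fun N => (1 - p ^+ N.*2.+1) * (1 - p ^+ N.*2.+2))
  (fun N => (1 - z * p ^+ N) * (1 - p / z * p ^+ N))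
  (fun N => qpoch z p N * qpoch (p / z) p N / qpoch p p N.*2))
  => [N|N n|N B NB|B _|N].
- by rewrite mulf_neq0.
- have Y0 : p ^ n != 0 by rewrite expfz_neq0.
  rewrite /G /kern /g thetaS //.
  rewrite (_ : Posz N.+1 - n = Posz N + 1 - n); last by lia.
  rewrite (_ : Posz N.+1 + n + Posz 0 = Posz N + n + 1); last by lia.
  rewrite (_ : Posz N + n + Posz 0 = Posz N + n); last by lia.
  rewrite (_ : Posz N + 1 - (n + 1) = Posz N - n); last by ring.
  rewrite (_ : Posz N + (n + 1) = Posz N + n + 1); last by ring.
  rewrite (@iqpoch_pred p (Posz N - n) (Posz N + 1 - n)) //; last by ring.
  rewrite (@iqpoch_pred p (Posz N + n) (Posz N + n + 1)) //.
  rewrite -addnn !exprS exprD !expfzDr // -!invr_expz !expr1z -!exprnP.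
  by field; rewrite z0 Y0.
- split; rewrite /G.
    by rewrite [iqpoch p (Posz N + 1 - _)]iqpoch_eq0 ?mul0r ?mulr0 ?mul0r //; lia.
  by rewrite [iqpoch p (_ + Negz B)]iqpoch_eq0 ?mulr0 ?mul0r //; lia.
- rewrite (eq_bsum _ (g := fun n => theta z p n * kern p 0 0 (Posz 1 * n))).
    rewrite bsum_kern0 // [iqpoch p (Posz 0 - _)]iqpoch_eq0 //.
    by rewrite theta0 iqpoch0 !qpoch0; field.
  by move=> n; rewrite mul1r.
- rewrite doubleS !qpochS -!exprS; move: (p1 N.*2) (p1 N.*2.+1) (qpoch_neq0 N.*2 np).
  move: (1 - p ^+ N.*2.+1) (1 - p ^+ N.*2.+2) (qpoch p p N.*2) => u v d u0 v0 d0.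
  by field; rewrite u0 v0 d0 z0.
Qed.

(** A limiting case of the q-Chu-Vandermonde sum, and the identity behind the Bailey lemma. The
    weight q^(i^2 + c i) is written as a theta coefficient so that [thetaS] gives its shift. *)
Lemma vandermonde_bsum q c M B : nonroot q -> (M.+2 <= B)%N ->
  bsum B (fun i => theta (- q ^+ c.+1) (q ^+ 2) i *
    (iqpoch q (Posz M - i) * (iqpoch q i * iqpoch q (i + Posz c)))) =
  iqpoch q M * iqpoch q (Posz M + Posz c).
Proof.
move=> nq; have [q0 q1] := nq; move: M B.
pose G (M : nat) i := theta (- q ^+ c.+1) (q ^+ 2) i *
  (iqpoch q (Posz M + 1 - i) * (iqpoch q (i - 1) * iqpoch q (i - 1 + Posz c))) *
  - (q ^+ M * q / q ^ i).
apply: (@bsum_wz _ _ G (fun M => (1 - q ^+ M.+1) * (1 - q ^+ (M + c).+1))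
  (fun M => 1) (fun M => iqpoch q M * iqpoch q (Posz M + Posz c)))
  => [M|M n|M B MB|B _|M].
- by rewrite mulf_neq0.
- have Y0 : q ^ n != 0 by rewrite expfz_neq0.
  rewrite /G thetaS ?oppr_eq0 ?expf_neq0 // opprK.
  rewrite (_ : Posz M.+1 - n = Posz M + 1 - n); last by lia.
  rewrite (_ : Posz M + 1 - (n + 1) = Posz M - n); last by ring.
  rewrite (_ : n + 1 - 1 = n); last by ring.
  rewrite (@iqpoch_pred q (Posz M - n) (Posz M + 1 - n)) //; last by ring.
  rewrite (@iqpoch_pred q (n - 1) n) //; last by ring.
  rewrite (@iqpoch_pred q (n - 1 + Posz c) (n + Posz c)) //; last by ring.
  rewrite !exprS exprD expr0 mulr1 expfzMl !expfzDr // -!invr_expz !expr1z -!exprnP.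
  by field; rewrite q0 Y0.
- split; rewrite /G.
    by rewrite [iqpoch q (Posz M + 1 - _)]iqpoch_eq0 ?mul0r ?mulr0 ?mul0r //; lia.
  by rewrite [iqpoch q (Negz B - 1)]iqpoch_eq0 ?mul0r ?mulr0 ?mul0r //; lia.
- rewrite bsum1 => [|i|i].
  + rewrite theta0 [iqpoch q (-1)]iqpoch_eq0 // mul0r !mulr0 addr0 subr0 add0r.
    by rewrite iqpoch0 !mul1r.
  + by rewrite [iqpoch q (_ - _)]iqpoch_eq0 ?mul0r ?mulr0 //; lia.
  + by rewrite [iqpoch q (Negz _)]iqpoch_eq0 ?mul0r ?mulr0.
- rewrite mul1r (@iqpoch_pred q M M.+1) //; last by lia.
  rewrite (@iqpoch_pred q (Posz M + Posz c) (Posz M.+1 + Posz c)) //; last by lia.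
  have -> : q ^ (Posz M.+1 + Posz c) = q ^+ (M + c).+1 by rewrite exprnP; congr (_ ^ _); lia.
  by rewrite -exprnP; ring.
Qed.


Lemma bsum_fold B (f h : int -> K) : (forall n, f (-1 - n) = h n * f n) ->
  bsum B (fun n => (1 + h n) * f n) = 2 * bsum B f.
Proof.
move=> fh; rewrite (eq_bsum _ (g := fun n => f n + f (-1 - n))) => [|n].
  by rewrite bsumD bsum_reflect; ring.
by rewrite fh; ring.
Qed.

Lemma bsum_fold_opp B (f h : int -> K) : f (Posz B.+1) = 0 -> f (Negz B) = 0 ->
  (forall n, f (- n) = h n * f n) -> bsum B (fun n => (1 + h n) * f n) = 2 * bsum B f.
Proof.
move=> fP fN fh; rewrite (eq_bsum _ (g := fun n => f n + f (- n))) => [|n].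
  by rewrite bsumD bsum_opp //; ring.
by rewrite fh; ring.
Qed.

(* The WZ method applies to the seeds only after symmetrisation under n -> -1 - n
   or n -> -n, whence the factor 1 + h n. *)
Lemma bsum_wz_fold (f G : nat -> int -> K) (h : int -> K) (u v b : nat -> K) :
    (forall L, u L != 0) ->
    (forall L n, (1 + h n) * (u L * f L.+1 n - v L * f L n) = G L (n + 1) - G L n) ->
    (forall L B, (L.+2 <= B)%N -> G L (Posz B.+1) = 0 /\ G L (Negz B) = 0) ->
    (forall L B, (L.+2 <= B)%N ->
       bsum B (fun n => (1 + h n) * f L n) = 2 * bsum B (f L)) ->
    (forall B, (2 <= B)%N -> bsum B (f 0) = b 0) ->
    (forall L, u L * b L.+1 = v L * b L) ->
  forall L B, (L.+2 <= B)%N -> bsum B (f L) = b L.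
Proof.
move=> u0 fG G0 f2 f0 bS L B LB.
have two0 : 2 != 0 :> K by rewrite pnatr_eq0.
apply: (mulfI two0); rewrite -f2 //.
apply: (@bsum_wz _ (fun L n => (1 + h n) * f L n) G u v (fun L => 2 * b L)) => //.
- by move=> M n; rewrite -fG; ring.
- by move=> C C2; rewrite f2 // f0.
- by move=> M; rewrite mulrCA bS; ring.
Qed.

(* The classical alpha_r is here a theta coefficient supported on the multiples
   of rho; the kernel vanishes for |n| > L + 1, so the bound B is immaterial. *)
Definition bailey_pair q rho s z p (b : nat -> K) :=
  forall L B, (L.+2 <= B)%N ->
    bsum B (fun n => theta z p n * kern q s L (Posz rho * n)) = b L.

Lemma kern_reflect q rho L n :
  kern q rho L (Posz rho * (-1 - n)) = kern q rho L (Posz rho * n).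
Proof.
rewrite /kern mulrC; congr (iqpoch q _ * iqpoch q _); lia.
Qed.

(* g is the WZ certificate, relative to the shifted theta term, of the recurrence
   u L * b L.+1 = v L * b L; the concrete polynomials used as g below were found by
   solving a linear system. *)
Lemma seed1 T z p (g : nat -> int -> K) (u v b : nat -> K) :
    nonroot T -> z != 0 -> p != 0 -> (forall L, u L != 0) ->
    (forall L n,
       (1 - p / z * ((p / z) ^ n * (p / z) ^ n)) *
       (u L - v L * ((1 - T ^+ L * T ^+ L * T ^+ 2 / (T ^ n * T ^ n)) *
                     (1 - T ^+ L * T ^+ L * T ^+ 4 * (T ^ n * T ^ n)))) =
       - z * p ^ n * (1 - T ^+ L * T ^+ L * T ^+ 2 / (T ^ n * T ^ n)) * g L (n + 1)
       - (1 - T ^+ L * T ^+ L * T ^+ 4 * (T ^ n * T ^ n)) * g L n) ->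
    b 0 = (1 - p / z) / (1 - T ^+ 2) -> (forall L, u L * b L.+1 = v L * b L) ->
  bailey_pair (T ^+ 2) 1 1 z p b.
Proof.
move=> nT z0 p0 u0 cert b0 bS.
have nq := nonroot_X 1 nT; have [q0 q1] := nq; have [T0 _] := nT.
pose G (L : nat) n := theta z p n * (iqpoch (T ^+ 2) (Posz L + 1 - n) *
  iqpoch (T ^+ 2) (Posz L + n + 1)) * g L n.
pose h n := - (p / z) * ((p / z) ^ n * (p / z) ^ n).
apply: (@bsum_wz_fold _ G h u v b) => // [L n|L B LB|L B LB|B _].
- have Y0 : T ^ n != 0 by rewrite expfz_neq0.
  rewrite /G /kern /h thetaS // !mul1r.
  rewrite (_ : Posz L.+1 - n = Posz L + 1 - n); last by lia.
  rewrite (_ : Posz L.+1 + n + Posz 1 = Posz L + n + 2); last by lia.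
  rewrite (_ : Posz L + n + Posz 1 = Posz L + n + 1); last by lia.
  rewrite (_ : Posz L + 1 - (n + 1) = Posz L - n); last by ring.
  rewrite (_ : Posz L + (n + 1) + 1 = Posz L + n + 2); last by ring.
  rewrite (@iqpoch_pred _ (Posz L - n) (Posz L + 1 - n)) //; last by ring.
  rewrite (@iqpoch_pred _ (Posz L + n + 1) (Posz L + n + 2)) //; last by ring.
  (* These are the two factors by which the kernels at L and L + 1 differ. They are expressed in T,
     the square root of the base, because the theta parameters of the seeds include odd powers of
     T. *)
  have -> : (T ^+ 2) ^ (Posz L + 1 - n) = T ^+ L * T ^+ L * T ^+ 2 / (T ^ n * T ^ n).
    rewrite !expfzDr // -!invr_expz !expr1z -!exprnP expr2 expfzMl exprMn.
    by field.
  have -> : (T ^+ 2) ^ (Posz L + n + 2) = T ^+ L * T ^+ L * T ^+ 4 * (T ^ n * T ^ n).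
    rewrite !expfzDr // -!exprnP expr2 expfzMl exprMn.
    by ring.
  have /(congr1 (fun x => x * (theta z p n * (iqpoch (T ^+ 2) (Posz L + 1 - n) *
    iqpoch (T ^+ 2) (Posz L + n + 2))))) := cert L n.
  move: (_ / (T ^ n * _)) (_ * (T ^ n * T ^ n)) => A C.
  by move=> e; apply: (etrans _ (etrans e _)); ring.
- split; rewrite /G.
    by rewrite [iqpoch _ (_ - _)]iqpoch_eq0 ?mul0r ?mulr0 ?mul0r //; lia.
  by rewrite [iqpoch _ (_ + Negz B + _)]iqpoch_eq0 ?mul0r ?mulr0 ?mul0r //; lia.
- by apply: bsum_fold => n; rewrite kern_reflect theta_reflect // mulrA.
- rewrite bsum_kern0 // theta0 thetaN1 // b0 iqpoch0 /= !qpochS qpoch0.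
  by rewrite expr0 !mulr1 !mul1r mulrBl mul1r mulNr.
Qed.

(** The counterpart of [seed1] for rho = 2, where n -> n + 1 moves the kernel argument by 2, so that
    each side of the certificate collects two factors. The fold h is a parameter because the kernel
    is symmetric under n -> -n when s = 0 and under n -> -1 - n when s = 2. *)
Lemma seed2 q s z p (g : nat -> int -> K) (h : int -> K) (u v b : nat -> K) :
    nonroot q -> (s <= 2)%N -> z != 0 -> p != 0 -> (forall L, u L != 0) ->
    (forall L n,
       (1 + h n) * (u L - v L * ((1 - q ^+ L * q / (q ^ n * q ^ n)) *
                                 (1 - q ^+ L * q ^+ s.+1 * (q ^ n * q ^ n)))) =
       - z * p ^ n * ((1 - q ^+ L * q / (q ^ n * q ^ n)) *
                      (1 - q ^+ L / (q ^ n * q ^ n))) * g L (n + 1)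
       - (1 - q ^+ L * q ^+ s.+1 * (q ^ n * q ^ n)) *
         (1 - q ^+ L * q ^+ s * (q ^ n * q ^ n)) * g L n) ->
    (forall L B, (L.+2 <= B)%N ->
       bsum B (fun n => (1 + h n) * (theta z p n * kern q s L (Posz 2 * n))) =
       2 * bsum B (fun n => theta z p n * kern q s L (Posz 2 * n))) ->
    b 0 = iqpoch q s - p / z * (iqpoch q 2 * iqpoch q (Posz s - 2)) ->
    (forall L, u L * b L.+1 = v L * b L) ->
  bailey_pair q 2 s z p b.
Proof.
move=> nq s2 z0 p0 u0 cert hf b0 bS.
have [q0 q1] := nq.
pose G (L : nat) n := theta z p n * (iqpoch q (Posz L + 1 - (n + n)) *
  iqpoch q (Posz L + n + n + Posz s - 1)) * g L n.
apply: (@bsum_wz_fold _ G h u v b) => // [L n|L B LB|B _].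
- have Y0 : q ^ n != 0 by rewrite expfz_neq0.
  rewrite /G /kern thetaS //.
  rewrite (_ : Posz 2 * n = n + n); last by lia.
  rewrite (_ : Posz L.+1 - (n + n) = Posz L + 1 - (n + n)); last by lia.
  rewrite (_ : Posz L.+1 + (n + n) + Posz s = Posz L + n + n + Posz s + 1); last by lia.
  rewrite (_ : Posz L + (n + n) + Posz s = Posz L + n + n + Posz s); last by lia.
  rewrite (_ : Posz L + 1 - (n + 1 + (n + 1)) = Posz L - 1 - (n + n)); last by ring.
  rewrite (_ : Posz L + (n + 1) + (n + 1) + Posz s - 1 = Posz L + n + n + Posz s + 1);
    last by ring.
  rewrite (@iqpoch_pred _ (Posz L - 1 - (n + n)) (Posz L - (n + n))) //; last by ring.
  rewrite (@iqpoch_pred _ (Posz L - (n + n)) (Posz L + 1 - (n + n))) //; last by ring.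
  rewrite (@iqpoch_pred _ (Posz L + n + n + Posz s - 1) (Posz L + n + n + Posz s)) //;
    last by ring.
  rewrite (@iqpoch_pred _ (Posz L + n + n + Posz s) (Posz L + n + n + Posz s + 1)) //.
  have -> : q ^ (Posz L + 1 - (n + n)) = q ^+ L * q / (q ^ n * q ^ n).
    by rewrite !expfzDr // -!invr_expz !expr1z -!exprnP !expfzDr //.
  have -> : q ^ (Posz L - (n + n)) = q ^+ L / (q ^ n * q ^ n).
    by rewrite !expfzDr // -!invr_expz -!exprnP !expfzDr //.
  have -> : q ^ (Posz L + n + n + Posz s + 1) = q ^+ L * q ^+ s.+1 * (q ^ n * q ^ n).
    by rewrite !expfzDr // expr1z -!exprnP exprS; ring.
  have -> : q ^ (Posz L + n + n + Posz s) = q ^+ L * q ^+ s * (q ^ n * q ^ n).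
    by rewrite !expfzDr // -!exprnP; ring.
  have /(congr1 (fun x => x * (theta z p n * (iqpoch q (Posz L + 1 - (n + n)) *
    iqpoch q (Posz L + n + n + Posz s + 1))))) := cert L n.
  move: (_ / (q ^ n * _)) (_ / (q ^ n * _)) (_ * (q ^ n * _)) (_ * (q ^ n * _)) => A C D E.
  by move=> e; apply: (etrans _ (etrans e _)); ring.
- split; rewrite /G.
    by rewrite [iqpoch _ (_ - (_ + _))]iqpoch_eq0 ?mul0r ?mulr0 ?mul0r //; lia.
  by rewrite [iqpoch _ (_ + _ + _ - 1)]iqpoch_eq0 ?mul0r ?mulr0 ?mul0r //; lia.
- rewrite bsum_kern0 //; last by lia.
  by rewrite theta0 thetaN1 // b0 mul1r mulNr.
Qed.

(** * The seeds with rho = 1 *)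

Lemma nonroot_addX (T : K) n : nonroot T -> 1 + T ^+ n.+1 != 0.
Proof.
move=> [_ T1]; have := T1 (n.+1 + n)%N.
rewrite -addnS exprD; apply: contra => /eqP e.
have -> : T ^+ n.+1 = - 1 by apply/eqP; rewrite -subr_eq0 opprK addrC e.
by rewrite mulrNN mulr1 subrr.
Qed.

(** The betas of the rho = 1 seeds are reciprocals of this with m = L or m = L + 1, up to a power of
    T. Both square roots T of the base matter: T = -q over base q^2 for AD and BD, and T = q^(1/2)
    over base q for AvDv. *)
Definition den1 (T : K) m L := qpoch (- T) (T ^+ 2) m * qpoch (T ^+ 4) (T ^+ 4) L.

Lemma qpoch_opp_neq0 T n : nonroot T -> qpoch (- T) (T ^+ 2) n != 0.
Proof.
move=> nT; elim: n => [|n IH]; first by rewrite qpoch0 oner_neq0.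
rewrite qpochS mulf_neq0 // mulNr opprK -exprM -exprS.
exact: nonroot_addX.
Qed.

Lemma den1_neq0 T m L : nonroot T -> den1 T m L != 0.
Proof.
move=> nT; rewrite mulf_neq0 ?qpoch_opp_neq0 // qpoch_neq0 //.
exact: nonroot_X.
Qed.

Lemma den1S T m L : den1 T m.+1 L.+1 =
  (1 + T ^+ m * T ^+ m * T) * (1 - T ^+ L * T ^+ L * T ^+ L * T ^+ L * T ^+ 4) *
  den1 T m L.
Proof.
rewrite /den1 !qpochS -!exprM [(2 * m)%N]mulnC [(4 * L)%N]mulnC !exprM !mulNr opprK.
by move: (qpoch _ _ _) (qpoch _ _ _) => x y; ring.
Qed.

Definition u1 (T : K) m L := (1 + T ^+ m * T ^+ m * T) *
  (1 - T ^+ L * T ^+ L * T ^+ L * T ^+ L * T ^+ 4).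

Lemma u1_neq0 T m L : nonroot T -> u1 T m L != 0.
Proof.
move=> nT; rewrite /u1 -!exprD -exprSr mulf_neq0 ?nonroot_addX //.
by rewrite addn4; case: nT.
Qed.

(** Seeds a, b, c, d serve AD, and a, b also AvDv. The betas of e, f, g, h carry an extra power,
    which comes from the additional n_r^2/4 in the form of BD. In a, d, g, h one has s = rho and p =
    z q^rho, as [bailey_shift] requires; the chains from b, c, e, f keep s fixed. *)
Lemma seed_a T : nonroot T ->
  bailey_pair (T ^+ 2) 1 1 T (T ^+ 3) (fun L => (den1 T L L)^-1).
Proof.
move=> nT; have [T0 T1] := nT.
apply: (@seed1 T T (T ^+ 3) (fun L n =>
   let X := T ^+ L in let Y := T ^ n in
   - X^+2 * T + X^+2 * T * Y - X^+2 * T^+2 / Y^+2 + X^+2 * T^+2 * Y^+3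
   - X^+4 * T^+3 / Y + X^+4 * T^+3 * Y^+2 + X^+4 * T^+4 - X^+4 * T^+4 * Y)
  (fun L => u1 T L L) (fun=> 1)) => //.
- by rewrite expf_neq0.
- by move=> L; apply: u1_neq0.
- move=> L n /=; rewrite /u1 (_ : T ^+ 3 / T = T * T); last by field.
  have : T ^ n != 0 by rewrite expfz_neq0.
  rewrite expfzDr // expr1z !exprS expr0 !mulr1 !expfzMl.
  move: (T ^+ L) (T ^ n) => X Y Y0.
  by field; rewrite T0 Y0.
- rewrite /den1 !qpoch0 mul1r invr1 (_ : T ^+ 3 / T = T ^+ 2); last by field.
  by rewrite divff //; have := T1 1.
- move=> L; rewrite den1S -/(u1 T L L); have := u1_neq0 L L nT; have := den1_neq0 L L nT.
  by move: (u1 _ _ _) (den1 _ _ _) => u d d0 u0; field; rewrite u0 d0.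
Qed.

Lemma seed_b T : nonroot T ->
  bailey_pair (T ^+ 2) 1 1 (T ^+ 2) (T ^+ 3) (fun L => (den1 T L.+1 L)^-1).
Proof.
move=> nT; have [T0 T1] := nT.
apply: (@seed1 T (T ^+ 2) (T ^+ 3) (fun L n =>
   let X := T ^+ L in let Y := T ^ n in
   - X^+2 * T^+2 / Y^+2 + X^+2 * T^+2 * Y - X^+4 * T^+4 / Y + X^+4 * T^+4)
  (fun L => u1 T L.+1 L) (fun=> 1)) => //; try by rewrite expf_neq0.
- by move=> L; apply: u1_neq0.
- move=> L n /=; rewrite /u1 (_ : T ^+ 3 / T ^+ 2 = T); last by field.
  have : T ^ n != 0 by rewrite expfz_neq0.
  rewrite expfzDr // expr1z [T ^+ L.+1]exprS !exprS expr0 !mulr1 !expfzMl.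
  move: (T ^+ L) (T ^ n) => X Y Y0.
  by field; rewrite T0 Y0.
- rewrite /den1 qpochS !qpoch0 mul1r mulr1 expr0 mulr1 opprK.
  rewrite (_ : T ^+ 3 / T ^+ 2 = T); last by field.
  have := T1 0; have := T1 1; have := nonroot_addX 0 nT; rewrite !expr1 => *.
  rewrite (_ : 1 - T ^+ 2 = (1 - T) * (1 + T)); last by ring.
  by field; apply/andP.
- move=> L; rewrite den1S -/(u1 T L.+1 L).
  have := u1_neq0 L.+1 L nT; have := den1_neq0 L.+1 L nT.
  by move: (u1 _ _ _) (den1 _ _ _) => u d d0 u0; field; rewrite u0 d0.
Qed.

Lemma exprN_sqrS T L :
  (- T) ^+ (L.+1 * L.+1) = - (T ^+ L * T ^+ L * T) * (- T) ^+ (L * L).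
Proof.
rewrite (_ : (L.+1 * L.+1 = L + L + 1 + L * L)%N); last by lia.
have s1 : (-1) ^+ (L + L + 1) = -1 :> K.
  by rewrite -signr_odd addn1 /= addnn odd_double.
by rewrite exprD [X in X * _]exprNn s1 mulN1r !exprD expr1.
Qed.

Lemma seed_f T : nonroot T ->
  bailey_pair (T ^+ 2) 1 1 1 T (fun L => (- T) ^+ (L * L) / den1 T L.+1 L).
Proof.
move=> nT; have [T0 T1] := nT.
apply: (@seed1 T 1 T (fun L n =>
   let X := T ^+ L in let Y := T ^ n in
   - 1 + Y - X^+2 * T^+2 / Y + X^+2 * T^+2 * Y^+2)
  (fun L => u1 T L.+1 L) (fun L => - (T ^+ L * T ^+ L * T))) => //.
- by move=> L; apply: u1_neq0.
- move=> L n /=; rewrite /u1 divr1.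
  have : T ^ n != 0 by rewrite expfz_neq0.
  rewrite expfzDr // expr1z [T ^+ L.+1]exprS !exprS expr0 !mulr1.
  move: (T ^+ L) (T ^ n) => X Y Y0.
  by field; rewrite T0 Y0.
- rewrite /den1 qpochS !qpoch0 mul1r mulr1 expr0 mulr1 opprK divr1 mul1r.
  have := T1 0; have := T1 1; have := nonroot_addX 0 nT; rewrite !expr1 => *.
  rewrite (_ : 1 - T ^+ 2 = (1 - T) * (1 + T)); last by ring.
  by field; apply/andP.
- move=> L; rewrite den1S -/(u1 T L.+1 L).
  have := u1_neq0 L.+1 L nT; have := den1_neq0 L.+1 L nT.
  rewrite exprN_sqrS; move: (u1 _ _ _) (den1 _ _ _) => u d d0 u0.
  by field; rewrite u0 d0.
Qed.

(** For |T| < 1 this z lies outside the unit disc, and the seeds e, f, h have z = 1. The limit is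
    thus available only after at least one step of the chain, which r >= 2 provides. *)
Lemma seed_g T : nonroot T ->
  bailey_pair (T ^+ 2) 1 1 T^-1 T
    (fun L => (- T) ^+ (L * L) / (T ^+ L * T ^+ L) / den1 T L L).
Proof.
move=> nT; have [T0 T1] := nT.
apply: (@seed1 T T^-1 T (fun L n =>
   let X := T ^+ L in let Y := T ^ n in
   Y / T - Y^+2 / T - 1 + Y^+3 - X^+2 * T / Y + X^+2 * T * Y^+4
   - X^+2 * T^+2 * Y + X^+2 * T^+2 * Y^+2)
  (fun L => u1 T L L) (fun L => - (T ^+ L * T ^+ L / T))) => //.
- by rewrite invr_eq0.
- by move=> L; apply: u1_neq0.
- move=> L n /=; rewrite /u1 invrK.
  have : T ^ n != 0 by rewrite expfz_neq0.
  rewrite expfzDr // expr1z !exprS expr0 !mulr1 expfzMl.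
  move: (T ^+ L) (T ^ n) => X Y Y0.
  by field; rewrite T0 Y0.
- rewrite /den1 !qpoch0 invrK !mulr1 !invr1 !mulr1 -expr2.
  by rewrite divff //; have := T1 1.
- move=> L; rewrite den1S -/(u1 T L L).
  have := u1_neq0 L L nT; have := den1_neq0 L L nT.
  have : T ^+ L != 0 by rewrite expf_neq0.
  rewrite exprN_sqrS [T ^+ L.+1]exprS; move: (u1 _ _ _) (den1 _ _ _) (T ^+ L).
  by move=> u d x x0 d0 u0; field; rewrite u0 d0 x0 T0.
Qed.

(** * The seeds with rho = 2 *)

Definition den2 q m L : K := qpoch q (q ^+ 2) m * qpoch q q L.

Definition u2 q m L : K := (1 - q ^+ m * q ^+ m * q) * (1 - q ^+ L * q).

Lemma u2_neq0 q m L : nonroot q -> u2 q m L != 0.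
Proof.
by move=> [_ q1]; rewrite /u2 -exprD -!exprSr mulf_neq0 // exprD.
Qed.

Lemma den2S q m L : den2 q m.+1 L.+1 = u2 q m L * den2 q m L.
Proof.
rewrite /den2 /u2 !qpochS -!exprM mul2n -addnn exprD.
by move: (qpoch _ _ _) (qpoch _ _ _) => x y; ring.
Qed.

Lemma den2_neq0 q m L : nonroot q -> den2 q m L != 0.
Proof.
move=> nq; rewrite mulf_neq0 ?qpoch_neq0 //.
elim: m => [|m IH]; first by rewrite qpoch0 oner_neq0.
by rewrite qpochS mulf_neq0 // -exprM -exprS; case: nq.
Qed.

Lemma kern0_opp q rho L n :
  kern q 0 L (Posz rho * - n) = kern q 0 L (Posz rho * n).
Proof.
rewrite /kern mulrC; congr (iqpoch q _ * iqpoch q _); lia.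
Qed.

(** Folding n with -n gives the unilateral pair relative to a = 1 with alpha_(2n) = (-1)^n q^(3 n^2
    - n) (1 + q^(2n)) for n >= 1 and vanishing odd alphas. *)
Lemma seed_c q : nonroot q ->
  bailey_pair q 2 0 (q ^+ 2) (q ^+ 6) (fun L => (den2 q L L)^-1).
Proof.
move=> nq; have [q0 q1] := nq.
apply: (@seed2 q 0 (q ^+ 2) (q ^+ 6) (fun L n =>
   - q ^+ L * q / (q ^ n * q ^ n)) (fun n => (q ^+ 2) ^ n)
  (fun L => u2 q L L) (fun=> 1)) => //; try by rewrite expf_neq0.
- by move=> L; apply: u2_neq0.
- move=> L n; have : q ^ n != 0 by rewrite expfz_neq0.
  rewrite /u2 expfzDr // expr1z !exprS !expr0 !mulr1 !expfzMl.
  move: (q ^+ L) (q ^ n) => X Y Y0.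
  by field; rewrite q0 Y0.
- move=> L B LB; apply: bsum_fold_opp.
  + by rewrite kern_eq0 ?mulr0 //; lia.
  + by rewrite kern_eq0 ?mulr0 //; lia.
  + move=> n; rewrite kern0_opp theta_opp ?expf_neq0 // mulrA; congr (_ ^ _ * _ * _).
    by field.
- by rewrite [iqpoch q (_ - _)]iqpoch_eq0 // iqpoch0 !mulr0 subr0 /den2 !qpoch0 mulr1 invr1.
- move=> L; rewrite den2S; have := u2_neq0 L L nq; have := den2_neq0 L L nq.
  by move: (u2 _ _ _) (den2 _ _ _) => u d d0 u0; field; rewrite u0 d0.
Qed.

Lemma seed_e q : nonroot q ->
  bailey_pair q 2 0 1 (q ^+ 2) (fun L => q ^+ 'C(L, 2) / den2 q L L).
Proof.
move=> nq; have [q0 q1] := nq.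
apply: (@seed2 q 0 1 (q ^+ 2) (fun L n => - 1) (fun n => (q ^+ 2) ^ n)
  (fun L => u2 q L L) (fun L => q ^+ L)) => //; rewrite ?oner_neq0 ?expf_neq0 //.
- by move=> L; apply: u2_neq0.
- move=> L n; have : q ^ n != 0 by rewrite expfz_neq0.
  rewrite /u2 !exprS !expr0 !mulr1 !expfzMl.
  move: (q ^+ L) (q ^ n) => X Y Y0.
  by field; rewrite ?q0 Y0.
- move=> L B LB; apply: bsum_fold_opp.
  + by rewrite kern_eq0 ?mulr0 //; lia.
  + by rewrite kern_eq0 ?mulr0 //; lia.
  + move=> n; rewrite kern0_opp theta_opp ?oner_neq0 ?expf_neq0 // mulrA.
    by rewrite expr1n divr1.
- rewrite [iqpoch q (_ - _)]iqpoch_eq0 // iqpoch0 !mulr0 subr0 /den2 !qpoch0.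
  by rewrite mulr1 invr1 expr0 mulr1.
- move=> L; rewrite den2S binS bin1 exprD.
  have := u2_neq0 L L nq; have := den2_neq0 L L nq.
  by move: (u2 _ _ _) (den2 _ _ _) => u d d0 u0; field; rewrite u0 d0.
Qed.

Lemma seed_d q : nonroot q ->
  bailey_pair q 2 2 (q ^+ 4) (q ^+ 6) (fun L => (den2 q L.+1 L)^-1).
Proof.
move=> nq; have [q0 q1] := nq.
have pz : q ^+ 6 / q ^+ 4 = q * q by field.
apply: (@seed2 q 2 (q ^+ 4) (q ^+ 6) (fun L n =>
   - q ^+ L * q / (q ^ n * q ^ n) + q ^+ L * q)
  (fun n => - (q ^+ 6 / q ^+ 4) * ((q ^+ 6 / q ^+ 4) ^ n * (q ^+ 6 / q ^+ 4) ^ n))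
  (fun L => u2 q L.+1 L) (fun=> 1)) => //; try by rewrite expf_neq0.
- by move=> L; apply: u2_neq0.
- move=> L n; have : q ^ n != 0 by rewrite expfz_neq0.
  rewrite /u2 pz expfzDr // expr1z [q ^+ L.+1]exprS !exprS !expr0 !mulr1 !expfzMl.
  move: (q ^+ L) (q ^ n) => X Y Y0.
  by field; rewrite q0 Y0.
- move=> L B LB; apply: bsum_fold => n.
  by rewrite kern_reflect theta_reflect ?expf_neq0 // mulrA.
- rewrite pz subrr iqpoch0 /= /den2 !qpochS !qpoch0 !expr0 !expr1 !mulr1 !mul1r.
  by have := q1 0; have := q1 1; rewrite !exprS expr0 mulr1 => ? ?; field; apply/andP.
- move=> L; rewrite den2S; have := u2_neq0 L.+1 L nq; have := den2_neq0 L.+1 L nq.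
  by move: (u2 _ _ _) (den2 _ _ _) => u d d0 u0; field; rewrite u0 d0.
Qed.

Lemma seed_h q : nonroot q ->
  bailey_pair q 2 2 1 (q ^+ 2) (fun L => q ^+ 'C(L, 2) / den2 q L.+1 L).
Proof.
move=> nq; have [q0 q1] := nq.
apply: (@seed2 q 2 1 (q ^+ 2) (fun L n => - 1 + q ^ n * q ^ n)
  (fun n => - (q ^+ 2 / 1) * ((q ^+ 2 / 1) ^ n * (q ^+ 2 / 1) ^ n))
  (fun L => u2 q L.+1 L) (fun L => q ^+ L)) => //; rewrite ?oner_neq0 ?expf_neq0 //.
- by move=> L; apply: u2_neq0.
- move=> L n; have : q ^ n != 0 by rewrite expfz_neq0.
  rewrite /u2 divr1 expfzDr // expr1z [q ^+ L.+1]exprS !exprS !expr0 !mulr1 !expfzMl.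
  move: (q ^+ L) (q ^ n) => X Y Y0.
  by field; rewrite ?q0 Y0.
- move=> L B LB; apply: bsum_fold => n.
  by rewrite kern_reflect theta_reflect ?oner_neq0 ?expf_neq0 // mulrA.
- rewrite divr1 subrr iqpoch0 /= /den2 !qpochS !qpoch0 !expr0 !expr1 !mulr1 !mul1r.
  by have := q1 0; have := q1 1; rewrite !exprS expr0 mulr1 => ? ?; field; apply/andP.
- move=> L; rewrite den2S binS bin1 exprD.
  have := u2_neq0 L.+1 L nq; have := den2_neq0 L.+1 L nq.
  by move: (u2 _ _ _) (den2 _ _ _) => u d d0 u0; field; rewrite u0 d0.
Qed.

(** * The Bailey step and its iteration *)

Lemma bsum_nat B k (f : int -> K) : (k <= B)%N ->
  (forall i, f (Negz i) = 0) -> (forall i, (k < i)%N -> f (Posz i) = 0) ->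
  bsum B f = \sum_(i < k.+1) f (Posz i).
Proof.
move=> kB fN fP; rewrite /bsum -!(big_mkord xpredT (fun i => f (Posz i) + f (Negz i))).
rewrite -(big_mkord xpredT (fun i => f (Posz i))) (@big_cat_nat _ _ _ k.+1) //=.
rewrite [X in _ + X]big_nat_cond [X in _ + X]big1 ?addr0 => [|i /andP[/andP[ki _] _]].
  by apply: eq_bigr => i _; rewrite fN addr0.
by rewrite fN fP // addr0.
Qed.

Lemma qbinomial_sum q z M : nonroot q -> z != 0 ->
  \sum_(i < M.+1) (- z) ^+ i * q ^+ 'C(i, 2) *
    (iqpoch q (Posz i) * iqpoch q (Posz M - Posz i)) = qpoch z q M / qpoch q q M.
Proof.
move=> nq z0; rewrite -(@qbinomial_bsum q z M M.+2) //.
rewrite (@bsum_nat _ M) // => [|i|i Mi].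
- by rewrite leqW.
- by rewrite [iqpoch q (Negz _)]iqpoch_eq0 // mul0r mulr0.
- by rewrite [iqpoch q (_ - _)]iqpoch_eq0 ?mulr0 //; lia.
Qed.

Lemma bin2_sqr m : ('C(m, 2) * 2 + m = m * m)%N.
Proof. by elim: m => // m IH; rewrite binS bin1; lia. Qed.

Lemma vandermonde_sum q c M : nonroot q ->
  \sum_(i < M.+1) q ^+ (i * i + c * i) *
    (iqpoch q (Posz M - Posz i) * (iqpoch q (Posz i) * iqpoch q (Posz i + Posz c))) =
  iqpoch q M * iqpoch q (Posz M + Posz c).
Proof.
move=> nq; rewrite -(@vandermonde_bsum q c M M.+2) //.
rewrite (@bsum_nat _ M) => [||i|i Mi].
- apply: eq_bigr => i _; congr (_ * _).
  rewrite /theta opprK /= -exprnP -!exprM -exprD; congr (_ ^+ _).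
  by have := bin2_sqr i; lia.
- by rewrite leqW.
- by rewrite [iqpoch q (Negz _)]iqpoch_eq0 // mul0r !mulr0.
- by rewrite [iqpoch q (_ - _)]iqpoch_eq0 ?mul0r ?mulr0 //; lia.
Qed.

Lemma kern_reflect_shift q s L r : kern q s L (- Posz s - r) = kern q s L r.
Proof.
rewrite /kern mulrC; congr (iqpoch q _ * iqpoch q _); lia.
Qed.

(** With M = m + i one has M^2 + s M = m^2 + s m + i^2 + (2m + s) i, so the sum is q-Vandermonde
    with c = 2m + s. *)
Lemma kern_step_nat q s L m : nonroot q ->
  \sum_(M < L.+1) q ^+ (M * M + s * M) * iqpoch q (Posz L - Posz M) * kern q s M (Posz m) =
  q ^+ (m * m + s * m) * kern q s L (Posz m).
Proof.
move=> nq; have [Lm|mL] := ltnP L m.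
  rewrite kern_eq0 ?mulr0; last by lia.
  by rewrite big1 // => M _; rewrite kern_eq0 ?mulr0 //; have := ltn_ord M; lia.
rewrite -(subnKC mL); move: (L - m)%N => k {L mL}.
pose F M := q ^+ (M * M + s * M) * iqpoch q (Posz (m + k) - Posz M) * kern q s M (Posz m).
rewrite -(big_mkord xpredT F) (@big_cat_nat _ _ _ m) ?leqW ?leq_addr //=.
rewrite [X in X + _]big_nat_cond [X in X + _]big1 ?add0r => [|i /andP[/andP[_ ki] _]]; last first.
  by rewrite /F kern_eq0 ?mulr0 //; lia.
rewrite -{1}[m]add0n big_addn -addnS addKn big_mkord.
transitivity (q ^+ (m * m + s * m) * \sum_(i < k.+1) q ^+ (i * i + (m + m + s) * i) *
    (iqpoch q (Posz k - Posz i) * (iqpoch q (Posz i) * iqpoch q (Posz i + Posz (m + m + s))))).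
  rewrite big_distrr /=; apply: eq_bigr => i _; rewrite /F /kern.
  rewrite (_ : Posz (m + k) - Posz (i + m) = Posz k - Posz i); last by lia.
  rewrite (_ : Posz (i + m) - Posz m = Posz i); last by lia.
  rewrite (_ : Posz (i + m) + Posz m + Posz s = Posz i + Posz (m + m + s)); last by lia.
  by rewrite !mulrA -exprD; congr (_ ^+ _ * _ * _ * _); lia.
rewrite vandermonde_sum // /kern; congr (_ * (iqpoch q _ * iqpoch q _)); lia.
Qed.

(** The action on beta of Bailey's lemma at a = q^s with both free parameters sent to infinity. *)
Definition step q s (b : nat -> K) (L : nat) : K :=
  \sum_(M < L.+1) q ^+ (M * M + s * M) * iqpoch q (Posz L - Posz M) * b M.

Lemma kern_step q rho s L n : nonroot q -> (s <= rho)%N ->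
  \sum_(M < L.+1) q ^+ (M * M + s * M) * iqpoch q (Posz L - Posz M) *
    kern q s M (Posz rho * n) =
  q ^ ((Posz rho * n) * (Posz rho * n) + Posz s * (Posz rho * n)) *
    kern q s L (Posz rho * n).
Proof.
move=> nq srho; case: n => m.
  rewrite -PoszM kern_step_nat // exprnP; congr (_ ^ _ * _); lia.
(* For negative n the kernel is reflected by r -> -s - r. The image t is a natural number because s
   <= rho, and r^2 + s r = t^2 + s t. *)
pose t := (rho * m.+1 - s)%N.
have rE : Posz rho * Negz m = - Posz s - Posz t by rewrite /t; nia.
rewrite rE kern_reflect_shift -[q ^ _]/(q ^ _).
under eq_bigr do rewrite kern_reflect_shift.
rewrite kern_step_nat // exprnP; congr (_ ^ _ * _); nia.
Qed.

Lemma tri2 n : Posz (tri n) * 2 + n = n * n.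
Proof.
by case: n => m /=; [have := bin2_sqr m | have := bin2_sqr m.+2]; nia.
Qed.

(** At r = rho n the exponent r^2 + s r equals 2 rho^2 n(n-1)/2 + (rho^2 + s rho) n, so the new
    factor is absorbed into p and z, and alpha stays a theta coefficient along the whole chain. *)
Lemma bailey_step q rho s z p b : nonroot q -> (s <= rho)%N ->
  bailey_pair q rho s z p b ->
  bailey_pair q rho s (z * q ^+ (rho * rho + s * rho)) (p * q ^+ (2 * rho * rho))
    (step q s b).
Proof.
move=> nq srho bp L B LB; have [q0 _] := nq.
rewrite /step.
have bpM (M : 'I_L.+1) : q ^+ (M * M + s * M) * iqpoch q (Posz L - Posz M) * b M =
    bsum B (fun n => theta z p n * (q ^+ (M * M + s * M) *
      iqpoch q (Posz L - Posz M) * kern q s M (Posz rho * n))).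
  rewrite -(bp M B); last by apply: leq_trans LB; rewrite !ltnS leq_ord.
  by rewrite -bsumZ; apply: eq_bsum => n; rewrite mulrCA.
rewrite (eq_bigr _ (fun M _ => bpM M)) -bsum_sum; apply: eq_bsum => n.
rewrite -big_distrr /= kern_step // [RHS]mulrA; congr (_ * _).
rewrite -thetaM; congr (_ * _).
rewrite !exprnP !exprz_exp -expfzDr //; congr (_ ^ _).
by have := tri2 n; nia.
Qed.

(* When p = z q^(rho + 1), the theta term times q^((rho + 1) n) is antisymmetric
   under n -> -1 - n, so it may be added to the kernel for free. *)
Lemma bailey_shift q rho z p b : nonroot q -> z != 0 -> p = z * q ^+ rho.+1 ->
  bailey_pair q rho.+1 rho.+1 z p b -> bailey_pair q rho.+1 rho z p b.
Proof.
move=> nq z0 pE bp L B LB; have [q0 _] := nq; rewrite -(bp L B LB).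
have p0 : p != 0 by rewrite pE mulf_neq0 ?expf_neq0.
pose f n := theta z p n * q ^ (Posz rho.+1 * n) * kern q rho.+1 L (Posz rho.+1 * n).
have f0 : bsum B f = 0.
  have two0 : 2 != 0 :> K by rewrite pnatr_eq0.
  apply: (mulfI two0); rewrite mulr0 -(@bsum_fold B f (fun=> -1)) => [|n].
    by rewrite /bsum big1 // => i _; rewrite subrr !mul0r addr0.
  rewrite /f kern_reflect theta_reflect // pE.
  rewrite (_ : z * q ^+ rho.+1 / z = q ^+ rho.+1); last by field.
  have -> : q ^ (Posz rho.+1 * (-1 - n)) = (q ^+ rho.+1 * q ^ (Posz rho.+1 * n))^-1.
    rewrite exprnP -expfzDr // invr_expz; congr (_ ^ _); lia.
  have -> : (q ^+ rho.+1) ^ n = q ^ (Posz rho.+1 * n) by rewrite exprnP exprz_exp.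
  have := expfz_neq0 (Posz rho.+1 * n) q0; have : q ^+ rho.+1 != 0 by rewrite expf_neq0.
  move: (q ^ (_ * n)) (q ^+ _) (theta _ _ _) (kern _ _ _ _) => x y th k y0 x0.
  by field; rewrite x0 y0.
(* Lowering s by one multiplies the kernel by 1 - q^(L + r + rho + 1) with r = (rho + 1) n; the
   second term is q^(L + rho + 1) times the summand of the vanishing sum. *)
rewrite -[RHS]subr0 -(mulr0 (q ^+ (L + rho.+1))) -f0 -bsumZ -bsumB.
apply: eq_bsum => n; rewrite /f /kern.
rewrite (@iqpoch_pred q (_ + Posz rho) (Posz L + Posz rho.+1 * n + Posz rho.+1)) //; last by lia.
rewrite !expfzDr // -!exprnP exprD.
by move: (q ^ _) (iqpoch _ _) (iqpoch _ _) => *; ring.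
Qed.

Lemma bailey_chain q rho s z p b l : nonroot q -> (s <= rho)%N ->
  bailey_pair q rho s z p b ->
  bailey_pair q rho s (z * q ^+ ((rho * rho + s * rho) * l)) (p * q ^+ (2 * rho * rho * l))
    (foldr (step q) b (nseq l s)).
Proof.
move=> nq srho bp; elim: l => [|l IH]; first by rewrite !muln0 !mulr1.
have exprMS w c : w * q ^+ (c * l.+1) = w * q ^+ (c * l) * q ^+ c.
  by rewrite mulnSr exprD [LHS]mulrA.
by rewrite !exprMS; apply: bailey_step.
Qed.

(** The first l steps, with s = rho + 1, multiply z and p by the same power of q. The relation p = z
    q^(rho + 1) survives them, and s may still drop afterwards. In the list the innermost steps
    stand last. *)
Lemma bailey_chain_shift q rho z p b l m : nonroot q -> z != 0 ->
  p = z * q ^+ rho.+1 -> bailey_pair q rho.+1 rho.+1 z p b ->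
  bailey_pair q rho.+1 rho
    (z * q ^+ (2 * rho.+1 * rho.+1 * l + (rho.+1 * rho.+1 + rho * rho.+1) * m))
    (p * q ^+ (2 * rho.+1 * rho.+1 * (l + m)))
    (foldr (step q) b (nseq m rho ++ nseq l rho.+1)).
Proof.
move=> nq z0 pE bp; have [q0 _] := nq.
set c := (2 * rho.+1 * rho.+1)%N; set d := (rho.+1 * rho.+1 + rho * rho.+1)%N.
have h1 : bailey_pair q rho.+1 rho.+1 (z * q ^+ (c * l)) (p * q ^+ (c * l))
    (foldr (step q) b (nseq l rho.+1)).
  rewrite (_ : z * _ = z * q ^+ ((rho.+1 * rho.+1 + rho.+1 * rho.+1) * l)).
    exact: bailey_chain.
  by congr (_ * _ ^+ (_ * _)); rewrite /c; lia.
have h2 : bailey_pair q rho.+1 rho (z * q ^+ (c * l)) (p * q ^+ (c * l))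
    (foldr (step q) b (nseq l rho.+1)).
  apply: bailey_shift h1 => //; first by rewrite mulf_neq0 ?expf_neq0.
  by rewrite pE [LHS]mulrAC.
rewrite foldr_cat (_ : z * _ = z * q ^+ (c * l) * q ^+ (d * m)); last first.
  by rewrite exprD [LHS]mulrA.
rewrite (_ : p * _ = p * q ^+ (c * l) * q ^+ (c * m)); last first.
  by rewrite mulnDr exprD [LHS]mulrA.
exact: bailey_chain.
Qed.

(** * Iterated steps as multiple sums *)

Arguments iqpoch : simpl never.

Fixpoint box k N : seq (seq nat) :=
  if k is k'.+1 then [seq x :: l | x <- iota 0 N.+1, l <- box k' N] else [:: [::]].

Definition wexp (ws l : seq nat) (m : nat) : nat :=
  \sum_(i < size ws) ((sumn (drop i l) + m) * (sumn (drop i l) + m) +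
                      nth 0%N ws i * (sumn (drop i l) + m)).

Lemma wexp_cons s ws l m : wexp (s :: ws) l m =
  ((sumn l + m) * (sumn l + m) + s * (sumn l + m) + wexp ws (behead l) m)%N.
Proof.
rewrite /wexp /= big_ord_recl /= drop0; congr (_ + _)%N.
by apply: eq_bigr => i _; case: l.
Qed.

Lemma wexp_nil l m : wexp [::] l m = 0%N.
Proof. by rewrite /wexp big_ord0. Qed.

Lemma big_box_cons k N (F : seq nat -> K) :
  \sum_(l <- box k.+1 N) F l = \sum_(x < N.+1) \sum_(l <- box k N) F (val x :: l).
Proof.
rewrite -[box k.+1 N]/[seq x :: l | x <- iota 0 N.+1, l <- box k N] big_allpairs_dep.
by rewrite -(big_mkord xpredT (fun x => \sum_(l <- box k N) F (x :: l))) /index_iota subn0.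
Qed.

Lemma big_ord_trunc k n (F : nat -> K) : (k <= n)%N ->
  (forall i, (k <= i)%N -> F i = 0) -> \sum_(i < n) F i = \sum_(i < k) F i.
Proof.
move=> kn F0; rewrite -!(big_mkord xpredT F) (@big_cat_nat _ _ _ k) //=.
rewrite [X in _ + X]big_nat_cond [X in _ + X]big1 ?addr0 // => i /andP[/andP[ki _] _].
exact: F0.
Qed.

(** The substitution M = x + S. Terms with M < S vanish by the convention for [iqpoch] and those
    with M > N because g does, so the two ranges need not correspond. *)
Lemma sum_iqpoch_shift q (g : nat -> K) S N N0 : (N <= N0)%N ->
  (forall M, (N < M)%N -> g M = 0) ->
  \sum_(x < N0.+1) g (x + S)%N * iqpoch q (Posz x) =
  \sum_(M < N.+1) g M * iqpoch q (Posz M - Posz S).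
Proof.
move=> N0N g0; have [NS|SN] := ltnP N S.
  rewrite !big1 // => [i _|i _].
    by rewrite iqpoch_eq0 ?mulr0 //; have := ltn_ord i; lia.
  by rewrite g0 ?mul0r // ltn_addl.
rewrite (@big_ord_trunc (N.+1 - S) _ (fun x => g (x + S)%N * iqpoch q (Posz x))); first last.
- by move=> i Ni; rewrite g0 ?mul0r //; lia.
- by lia.
rewrite -[RHS](big_mkord xpredT (fun M => g M * iqpoch q (Posz M - Posz S))).
rewrite (@big_cat_nat _ _ _ S) //=; last by rewrite leqW.
rewrite [X in X + _]big_nat_cond [X in X + _]big1 ?add0r => [|i /andP[/andP[_ ki] _]]; last first.
  by rewrite iqpoch_eq0 ?mulr0 //; lia.
rewrite -[in RHS](add0n S) big_addn big_mkord; apply: eq_bigr => i _.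
by congr (_ * iqpoch q _); lia.
Qed.

(** The nested indices M_1 >= M_2 >= ... of the iterated steps are the tail sums of l increased by
    m, and their successive differences are the entries of l. All ranges may be enlarged to one box
    because [iqpoch] vanishes at negative arguments. *)
Lemma chain_sum q (b : nat -> K) s ws N N0 : (N <= N0)%N ->
  \sum_(m < N0.+1) \sum_(l <- box (size ws) N0)
    q ^+ wexp (s :: ws) l m * (\prod_(x <- l) iqpoch q (Posz x)) *
    iqpoch q (Posz N - Posz (sumn l + m)) * b m =
  foldr (step q) b (s :: ws) N.
Proof.
elim: ws s N => [|t ws IH] s N N0N.
  rewrite /= /step.
  under eq_bigr => m _ do
    rewrite big_seq1 wexp_cons wexp_nil big_nil mulr1 addn0 [sumn _]/= add0n.
  pose F m := q ^+ (m * m + s * m) * iqpoch q (Posz N - Posz m) * b m.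
  rewrite (@big_ord_trunc N.+1 N0.+1 F) // => i Ni.
  by rewrite /F iqpoch_eq0 ?mulr0 ?mul0r //; lia.
rewrite [RHS]/= {1}/step.
under [RHS]eq_bigr => M _.
  rewrite -[step q t _ _]/(foldr (step q) b (t :: ws) M) -IH; last first.
    by apply: leq_trans N0N; rewrite leq_ord.
  rewrite big_distrr /=.
  under eq_bigr => m _ do rewrite big_distrr /=.
  over.
rewrite [RHS]exchange_big /=; apply: eq_bigr => m _.
rewrite big_box_cons [LHS]exchange_big [RHS]exchange_big /=; apply: eq_bigr => l _.
pose g M := q ^+ (M * M + s * M) * iqpoch q (Posz N - Posz M) *
  (q ^+ wexp (t :: ws) l m * (\prod_(x <- l) iqpoch q (Posz x)) * b m).
transitivity (\sum_(x < N0.+1) g (x + (sumn l + m))%N * iqpoch q (Posz x)).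
  apply: eq_bigr => x _; rewrite wexp_cons big_cons /g /= addnA exprD.
  by ring.
rewrite (sum_iqpoch_shift _ _ N0N) => [|M NM]; last first.
  by rewrite /g iqpoch_eq0 ?mulr0 ?mul0r //; lia.
by apply: eq_bigr => M _; rewrite /g; ring.
Qed.

Lemma qpoch_split a p m n :
  qpoch a p (m + n) = qpoch a p m * qpoch (a * p ^+ m) p n.
Proof.
elim: n => [|n IH]; first by rewrite addn0 qpoch0 mulr1.
by rewrite addnS !qpochS IH exprD -!mulrA.
Qed.

(* The cutoff tends to 1, and makes the truncated Nahm sum equal to the iterated
   Bailey lemma at level N up to a product. *)
Definition cutoff q N n1 l m : K :=
  qpoch q q (N - m) * iqpoch q (Posz (N - m) - Posz n1) *
  (qpoch q q N * iqpoch q (Posz N - Posz (sumn l + m))).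

(** The cutoff turns the n_1-sum into the finite q-binomial theorem at z = y q^m with upper index N
    - m. Its value (y q^m)_(N-m) is (y)_N / (y)_m, which explains the division of b0 by (y)_m; the
    rest is [chain_sum]. *)
Lemma nahm_cutoff_sum q y (b0 : nat -> K) s ws N : nonroot q -> y != 0 ->
    (forall m, qpoch y q m != 0) ->
  \sum_(n1 < N.+1) \sum_(l <- box (size ws) N) \sum_(m < N.+1)
    (- y) ^+ n1 * q ^+ ('C(n1, 2) + m * n1) * iqpoch q (Posz n1) *
    (q ^+ wexp (s :: ws) l m * (\prod_(x <- l) iqpoch q (Posz x)) * b0 m) *
    cutoff q N n1 l m =
  qpoch y q N * qpoch q q N *
    foldr (step q) (fun m => b0 m / qpoch y q m) (s :: ws) N.
Proof.
move=> nq y0 yq; have [q0 _] := nq.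
rewrite -(chain_sum _ _ _ _ (leqnn N)) big_distrr /= exchange_big /=.
under eq_bigr do rewrite exchange_big /=.
rewrite exchange_big /=; apply: eq_bigr => m _.
rewrite big_distrr /=; apply: eq_bigr => l _.
have mN : (m <= N)%N by rewrite -ltnS ltn_ord.
have := qbinomial_sum (N - m) nq (_ : y * q ^+ m != 0).
rewrite mulf_neq0 ?expf_neq0 // => /(_ isT) e.
have := qpoch_split y q m (N - m); rewrite subnKC // => ->.
rewrite (_ : qpoch (y * q ^+ m) q (N - m) = qpoch q q (N - m) *
   (qpoch (y * q ^+ m) q (N - m) / qpoch q q (N - m))); last first.
  by rewrite mulrCA divff ?mulr1 // qpoch_neq0.
rewrite -e.
rewrite [RHS](_ : _ = (qpoch q q (N - m) * qpoch q q N *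
   (q ^+ wexp (s :: ws) l m * (\prod_(x <- l) iqpoch q (Posz x)) *
    iqpoch q (Posz N - Posz (sumn l + m)) * b0 m)) *
   \sum_(i < (N - m).+1) (- (y * q ^+ m)) ^+ i * q ^+ 'C(i, 2) *
     (iqpoch q (Posz i) * iqpoch q (Posz (N - m) - Posz i))); last first.
  by have := yq m; move: (qpoch y q m) (\sum_(i < _) _) => w S w0; field.
rewrite big_distrr /=.
pose F i := (qpoch q q (N - m) * qpoch q q N *
   (q ^+ wexp (s :: ws) l m * (\prod_(x <- l) iqpoch q (Posz x)) *
    iqpoch q (Posz N - Posz (sumn l + m)) * b0 m)) *
   ((- (y * q ^+ m)) ^+ i * q ^+ 'C(i, 2) *
     (iqpoch q (Posz i) * iqpoch q (Posz (N - m) - Posz i))).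
(* The n_1-range depends on m in the q-binomial theorem but not in the box; the cutoff kills the
   excess n_1 > N - m. *)
rewrite -(@big_ord_trunc (N - m).+1 N.+1 F) ?ltnS ?leq_subr // => [|i Ni].
  apply: eq_bigr => i _; rewrite /F /cutoff -mulNr exprMn -exprM exprD.
  by ring.
by rewrite /F [iqpoch q (_ - Posz i)]iqpoch_eq0 ?mulr0 //; lia.
Qed.
End Pochhammer.

Arguments iqpoch : simpl never.

(** * Limits *)

Section NumFieldLimits.
Local Open Scope classical_set_scope.
Local Open Scope ring_scope.
Variable K : numFieldType.
Implicit Types (u v : nat -> K) (a b : K).

Lemma cvgn_unique u a b : u @ \oo --> a -> u @ \oo --> b -> a = b.
Proof. exact: (@cvg_unique _ (@norm_hausdorff K K)). Qed.

Lemma cvgn_mul u v a b : u @ \oo --> a -> v @ \oo --> b ->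
  u n * v n @[n --> \oo] --> a * b.
Proof. by move=> ua vb; exact: cvgM. Qed.

Lemma qpoch_double (a p : K) n :
  qpoch a p n.*2 = qpoch a (p ^+ 2) n * qpoch (a * p) (p ^+ 2) n.
Proof.
elim: n => [|n IH]; first by rewrite !qpoch0 mulr1.
rewrite doubleS !qpochS IH -!exprM mul2n [_ ^+ n.*2.+1]exprS.
by ring.
Qed.

Lemma qpoch_sqr (a p : K) n :
  qpoch (a ^+ 2) (p ^+ 2) n = qpoch a p n * qpoch (- a) p n.
Proof.
elim: n => [|n IH]; first by rewrite !qpoch0 mulr1.
rewrite !qpochS IH -!exprM mulnC exprM.
by ring.
Qed.

Fact div_mul_cancel (x y w : K) : w != 0 -> w = x * y -> x / w = y^-1.
Proof. by move=> w0 wE; move: w0; rewrite wE mulf_eq0 negb_or => /andP[x0 y0]; field; rewrite x0 y0. Qed.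

Fact norm_const_diff (a b : K) : a != 0 -> b != 0 ->
  0 = a^-1 * a^-1 - b * b / (a * a) * (b^-1 * b^-1).
Proof. by move=> a0 b0; field; rewrite a0 b0. Qed.

Fact norm_const_mul (x y a b : K) : a != 0 -> b != 0 ->
  x * (y * b) / (a * a) = 0 + b * b / (a * a) * (x * y / b).
Proof. by move=> a0 b0; field; rewrite a0 b0. Qed.

Fact norm_const_div (x y a : K) : a != 0 -> x / a * y = x * a * (y / (a * a)).
Proof. by move=> a0; field. Qed.

Fact mul_sub_add (c t k k' : K) : t * k = t * (k - c * k') + c * (t * k').
Proof. by ring. Qed.

Lemma cvg_double u a : u @ \oo --> a -> u n.*2 @[n --> \oo] --> a.
Proof.
move=> /cvgrPdist_lt ua; apply/cvgrPdist_lt => e /ua [N _ hN].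
by exists N => // n /= Nn; apply: (hN n.*2) => /=; lia.
Qed.

(* Convergence of the products needs completeness, hence is only a hypothesis
   over a general numFieldType. *)
Definition cvg_qpochs := forall a p : K, `|p| < 1 ->
  qpoch a p n @[n --> \oo] --> qpoch_inf a p.

Lemma qpoch_inf_split a p : cvg_qpochs -> `|p| < 1 ->
  qpoch_inf a p = qpoch_inf a (p ^+ 2) * qpoch_inf (a * p) (p ^+ 2).
Proof.
move=> qcvg p1; have p21 : `|p ^+ 2| < 1 by rewrite normrX exprn_ilt1.
apply: (cvgn_unique (cvg_double (qcvg a p p1))).
under eq_fun do rewrite qpoch_double.
by apply: cvgn_mul; exact: qcvg.
Qed.

Lemma qpoch_inf_sqr a p : cvg_qpochs -> `|p| < 1 ->
  qpoch_inf (a ^+ 2) (p ^+ 2) = qpoch_inf a p * qpoch_inf (- a) p.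
Proof.
move=> qcvg p1; have p21 : `|p ^+ 2| < 1 by rewrite normrX exprn_ilt1.
apply: (cvgn_unique (qcvg (a ^+ 2) _ p21)).
under eq_fun do rewrite qpoch_sqr.
by apply: cvgn_mul; exact: qcvg.
Qed.

(** From (t^2; t^4)_oo = (t; t^2)_oo (-t; t^2)_oo, after splitting base t^2 into base t^4. This
    ratio and the next are the Euler factor over (t^2; t^2)_oo, and they produce the two kinds of
    denominators in the theorem. *)
Lemma qpoch_inf_ratio1 (t : K) : cvg_qpochs -> `|t| < 1 ->
    qpoch_inf (t ^+ 2) (t ^+ 2) != 0 ->
  qpoch_inf (- t) (t ^+ 2) / qpoch_inf (t ^+ 2) (t ^+ 2) =
  (qpochs_inf [:: t; t ^+ 3; t ^+ 4] (t ^+ 4))^-1.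
Proof.
move=> qcvg t1 n0; have t21 : `|t ^+ 2| < 1 by rewrite normrX exprn_ilt1.
rewrite /qpochs_inf !big_cons big_nil mulr1.
have e1 := qpoch_inf_split t qcvg t21; have e2 := qpoch_inf_split (t ^+ 2) qcvg t21.
have e3 := qpoch_inf_sqr t qcvg t21; rewrite -!exprM /= in e1 e2 e3.
rewrite -exprS in e1; rewrite -exprD /= in e2.
rewrite (mulrA (qpoch_inf t (t ^+ 4))) -e1.
apply: div_mul_cancel => //.
by rewrite [LHS]e2 e3 mulrA [X in _ = X * _]mulrC.
Qed.

Lemma qpoch_inf_ratio2 (t : K) : cvg_qpochs -> `|t| < 1 ->
    qpoch_inf (t ^+ 2) (t ^+ 2) != 0 ->
  qpoch_inf (- t ^+ 2) (t ^+ 2) / qpoch_inf (t ^+ 2) (t ^+ 2) =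
  (qpochs_inf [:: t ^+ 2; t ^+ 2; t ^+ 4] (t ^+ 4))^-1.
Proof.
move=> qcvg t1 n0; have t21 : `|t ^+ 2| < 1 by rewrite normrX exprn_ilt1.
rewrite /qpochs_inf !big_cons big_nil mulr1.
have e2 := qpoch_inf_split (t ^+ 2) qcvg t21; have e3 := qpoch_inf_sqr (t ^+ 2) qcvg t21.
rewrite -!exprM /= in e2 e3; rewrite -exprD /= in e2.
apply: div_mul_cancel => //.
by rewrite -e2 mulrCA [X in _ = _ * X]mulrC -e3 -e2.
Qed.

(** The kernels in base q and base p tend to 1/Q^2 and 1/P^2. Replacing the former by P^2/Q^2 times
    the latter therefore costs only the null sum in the hypothesis, and [finite_jacobi] evaluates
    what remains. *)
Lemma cvg_bsum_theta_diff (q z p : K) s rho (P := qpoch_inf p p) (Q := qpoch_inf q q) :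
    cvg_qpochs -> nonroot p -> z != 0 -> `|p| < 1 -> P != 0 -> Q != 0 ->
    bsum N.+2 (fun n => theta z p n *
      (kern q s N (Posz rho * n) - P * P / (Q * Q) * kern p 0 N n)) @[N --> \oo] --> (0 : K) ->
  bsum N.+2 (fun n => theta z p n * kern q s N (Posz rho * n)) @[N --> \oo] -->
    qpochs_inf [:: z; p / z; p] p / (Q * Q).
Proof.
move=> qcvg np z0 p1 P0 Q0 h0.
have hJ : P * P / (Q * Q) * (qpoch z p N * qpoch (p / z) p N / qpoch p p N.*2) @[N --> \oo] -->
    P * P / (Q * Q) * (qpoch_inf z p * qpoch_inf (p / z) p / P).
  apply: cvgMl_tmp; apply: cvgn_mul; first by apply: cvgn_mul; exact: qcvg.
  by apply: cvgV => //; exact: cvg_double (qcvg p p p1).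
have -> : qpochs_inf [:: z; p / z; p] p / (Q * Q) =
    0 + P * P / (Q * Q) * (qpoch_inf z p * qpoch_inf (p / z) p / P).
  rewrite /qpochs_inf !big_cons big_nil mulr1 -/P.
  exact: norm_const_mul.
rewrite (_ : (fun N => bsum _ _) = (fun N => bsum N.+2 (fun n => theta z p n *
      (kern q s N (Posz rho * n) - P * P / (Q * Q) * kern p 0 N n)) +
    P * P / (Q * Q) * (qpoch z p N * qpoch (p / z) p N / qpoch p p N.*2))).
  exact: cvgD.
apply/funext => N; rewrite -(finite_jacobi np z0 (leqnn N.+2)) -bsumZ -bsumD.
by apply: eq_bsum => n; exact: mul_sub_add.
Qed.

Lemma cvg_bailey_pair_theta (q y z p : K) s rho (b : nat -> K) (Q := qpoch_inf q q) :
    cvg_qpochs -> `|q| < 1 -> Q != 0 -> bailey_pair q rho s z p b ->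
    bsum N.+2 (fun n => theta z p n * kern q s N (Posz rho * n)) @[N --> \oo] -->
      qpochs_inf [:: z; p / z; p] p / (Q * Q) ->
  qpoch y q N * qpoch q q N * b N @[N --> \oo] -->
    qpoch_inf y q / Q * qpochs_inf [:: z; p / z; p] p.
Proof.
move=> qcvg q1 Q0 bp h.
under eq_fun do rewrite -(bp _ _ (leqnn _)).
rewrite norm_const_div //.
by apply: cvgn_mul => //; apply: cvgn_mul; exact: qcvg.
Qed.

End NumFieldLimits.

(** * Convergence over the complex numbers and Tannery's theorem *)

Section ComplexLimits.
Local Open Scope classical_set_scope.
Local Open Scope ring_scope.
Variable R : realType.
Local Notation C := (R[i] : numFieldType).
Implicit Types (u : nat -> C) (w v : nat -> R) (x y c r : R) (z : C).

Local Notation "x %:C" := (real_complex R x) : ring_scope.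

Lemma gt0_realC z : 0 < z -> z = (complex.Re z)%:C.
Proof. by move=> z0; rewrite RRe_real // gtr0_real. Qed.

Lemma ge0_realC z : 0 <= z -> z = (complex.Re z)%:C.
Proof. by move=> z0; rewrite RRe_real // ger0_real. Qed.

Lemma normRC x : `|x%:C| = `|x|%:C.
Proof. by rewrite normc_def /= expr0n /= addr0 sqrtr_sqr. Qed.

Lemma cvg_sandwich u z v : (forall n, `|z - u n| <= (v n)%:C) ->
  v @ \oo --> (0 : R) -> u @ \oo --> z.
Proof.
move=> uv /cvgrPdist_lt v0; apply/cvgrPdist_lt => e e0.
have e0' : 0 < complex.Re e by rewrite -ltcR -gt0_realC.
near=> n; apply: le_lt_trans (uv n) _.
rewrite (gt0_realC e0) ltcR; apply: le_lt_trans (ler_norm _) _.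
by rewrite -normrN -[- v n]add0r; near: n; exact: v0.
Unshelve. all: by end_near. Qed.

Lemma cvg_geometric_diff w c r : 0 <= r < 1 ->
  (forall n, `|w n.+1 - w n| <= c * r ^+ n) -> cvgn w.
Proof.
move=> /andP[r0 r1] wr.
have -> : w = (fun n => w 0%N + series (telescope w) n).
  by apply/funext => n; exact: eq_sum_telescope.
apply: is_cvgD; first exact: is_cvg_cst.
apply: normed_cvg; apply: (@series_le_cvg _ _ (geometric c r)) => [n|n|n|].
- exact: normr_ge0.
- exact: le_trans (normr_ge0 _) (wr n).
- exact: wr.
- by apply: is_cvg_geometric_series; rewrite ger0_norm.
Qed.

Lemma norm_ReIm_le z : `|z| <= (`|complex.Re z| + `|complex.Im z|)%:C.
Proof.
rewrite [in leLHS](complexE z) rmorphD /=; apply: le_trans (ler_normD _ _) _.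
rewrite normrM !normRC; apply: lerD => //.
by rewrite (_ : `|'i%C| = 1) ?mul1r // normc_def /= expr0n /= add0r expr1n sqrtr1.
Qed.

Lemma norm_Im_le z : `|complex.Im z|%:C <= `|z|.
Proof.
rewrite -normrN -(ReiNIm z); apply: le_trans (normc_ge_Re _) _.
by rewrite normrM (_ : `|'i%C| = 1) ?mulr1 // normc_def /= expr0n /= add0r expr1n sqrtr1.
Qed.

(** Completeness is invoked in R, for the real and imaginary parts separately. *)
Lemma cvgC_geometric_diff u c r : 0 <= r < 1 ->
  (forall n, `|u n.+1 - u n| <= (c * r ^+ n)%:C) -> cvgn u.
Proof.
move=> r01 ur.
have : cvgn (fun n => complex.Re (u n)).
  apply: (cvg_geometric_diff r01) => n; rewrite -lecR.
  apply: le_trans (ur n); apply: le_trans (normc_ge_Re _).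
  by rewrite raddfB.
have : cvgn (fun n => complex.Im (u n)).
  apply: (cvg_geometric_diff r01) => n; rewrite -lecR.
  apply: le_trans (ur n); apply: le_trans (norm_Im_le _).
  by rewrite raddfB.
move=> /cvg_ex[/= b ub] /cvg_ex[/= a ua].
suff h : u @ \oo --> ((a +i* b)%C : C) by exact: cvgP h.
apply: (@cvg_sandwich _ _ (fun n => `|a - complex.Re (u n)| + `|b - complex.Im (u n)|)).
  move=> n; apply: le_trans (norm_ReIm_le _) _.
  by rewrite !raddfB.
rewrite -[0]addr0; apply: cvgD.
  by rewrite -(normr0 R) -(subrr a); apply: cvg_norm; apply: cvgB => //; exact: cvg_cst.
by rewrite -(normr0 R) -(subrr b); apply: cvg_norm; apply: cvgB => //; exact: cvg_cst.
Qed.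

Lemma geometric_sum_le r n : 0 <= r < 1 -> \sum_(0 <= k < n) r ^+ k <= (1 - r)^-1.
Proof.
move=> /andP[r0 r1].
have rN1 : r != 1 by rewrite lt_eqF.
have /(congr1 (fun f => f n)) /= := geometric_seriesE 1 rN1.
rewrite /series /geometric /=; under eq_bigr do rewrite mul1r.
move=> ->; rewrite mul1r ler_piMl ?invr_ge0 ?subr_ge0 ?(ltW r1) //.
by rewrite lerBlDr lerDl exprn_ge0.
Qed.

(** Since 1 + x <= exp x, the product is dominated by the exponential of a geometric series,
    uniformly in n. *)
Lemma prod_expR_le (f : nat -> C) c r n : 0 <= c -> 0 <= r < 1 ->
  (forall k, `|f k| <= (c * r ^+ k)%:C) ->
  `|\prod_(0 <= k < n) (1 + f k)| <= (expR (c / (1 - r)))%:C.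
Proof.
move=> c0 r01 fr.
apply: (@le_trans _ _ (expR (\sum_(0 <= k < n) c * r ^+ k))%:C); last first.
  by rewrite lecR ler_expR -big_distrr /= ler_wpM2l // geometric_sum_le.
elim: n => [|n IH]; first by rewrite !big_nil normr1 expR0.
rewrite !big_nat_recr //= normrM expRD rmorphM /=; apply: ler_pM => //.
apply: le_trans (ler_normD _ _) _; rewrite normr1.
apply: le_trans (lerD (lexx _) (fr n)) _.
by rewrite -(rmorph1 (real_complex R)) -rmorphD lecR expR_ge1Dx.
Qed.

Lemma realCM x y : (x * y)%:C = x%:C * y%:C.
Proof. exact: rmorphM. Qed.

Lemma realCX x n : (x ^+ n)%:C = x%:C ^+ n.
Proof. exact: rmorphXn. Qed.

Lemma realCV x : (x^-1)%:C = x%:C^-1.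
Proof. exact: fmorphV. Qed.

Lemma realCB x y : (x - y)%:C = x%:C - y%:C.
Proof. exact: rmorphB. Qed.

Lemma realCD x y : (x + y)%:C = x%:C + y%:C.
Proof. exact: rmorphD. Qed.

Lemma realC_norm z : (complex.Re `|z|)%:C = `|z|.
Proof. by rewrite -ge0_realC. Qed.

Lemma norm_lt1_Re z : `|z| < 1 -> 0 <= complex.Re `|z| < 1.
Proof.
move=> z1; apply/andP; split.
  by rewrite -lecR realC_norm; exact: normr_ge0.
by rewrite -ltcR realC_norm.
Qed.

Lemma qpoch_bounded a p : `|p| < 1 -> exists b, forall n, `|qpoch (a : C) p n| <= b%:C.
Proof.
move=> p1; exists (expR (complex.Re `|a| / (1 - complex.Re `|p|))) => n.
rewrite /qpoch; apply: prod_expR_le; rewrite ?norm_lt1_Re //.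
  by rewrite -lecR realC_norm; exact: normr_ge0.
move=> k; rewrite normrN normrM normrX rmorphM rmorphXn /=.
by rewrite !realC_norm.
Qed.

Lemma cvg_qpoch (a p : C) : `|p| < 1 -> qpoch a p n @[n --> \oo] --> qpoch_inf a p.
Proof.
move=> p1; have [b qb] := qpoch_bounded a p1.
apply: (@cvgC_geometric_diff _ (b * complex.Re `|a|) (complex.Re `|p|)).
  exact: norm_lt1_Re.
move=> n; rewrite qpochS mulrBr mulr1 addrAC subrr sub0r normrN normrM.
rewrite -mulrA realCM; apply: ler_pM; rewrite ?normr_ge0 ?qb //.
by rewrite normrM normrX realCM realCX !realC_norm.
Qed.

Lemma nonroot_norm_lt1 (q : C) : q != 0 -> `|q| < 1 -> nonroot q.
Proof.
move=> q0 q1; split=> // n; rewrite subr_eq0 eq_sym; apply/eqP => e.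
have : `|q ^+ n.+1| < 1 by rewrite normrX exprn_ilt1.
by rewrite e normr1 ltxx.
Qed.

(** Writing 1/(1 - x) = 1 + x/(1 - x) and using |1 - q^(k+1)| >= 1 - |q| reduces the reciprocal
    product to [prod_expR_le]. *)
Lemma iqpoch_bounded (q : C) : q != 0 -> `|q| < 1 ->
  exists2 b, 0 < b & forall n, `|iqpoch q n| <= b%:C.
Proof.
move=> q0 q1; have nq := nonroot_norm_lt1 q0 q1.
set r := complex.Re `|q|; have r01 := norm_lt1_Re q1.
have [r0 r1] : 0 <= r /\ r < 1 by apply/andP.
exists (expR ((1 - r)^-1 / (1 - r))); first exact: expR_gt0.
case=> n; last by rewrite iqpoch_eq0 // normr0 lecR expR_ge0.
rewrite /iqpoch /qpoch -prodfV.
have -> : \prod_(0 <= k < n) (1 - q * q ^+ k)^-1 =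
    \prod_(0 <= k < n) (1 + q ^+ k.+1 / (1 - q ^+ k.+1)) :> C.
  apply: eq_bigr => k _; rewrite -exprS; have := nq.2 k.
  by move: (q ^+ _) => x x1; field.
apply: prod_expR_le => //; first by rewrite invr_ge0 subr_ge0 ltW.
move=> k; rewrite normrM normfV normrX mulrC realCM realCX realC_norm.
apply: ler_pM; rewrite ?invr_ge0 ?exprn_ge0 //; last first.
  by rewrite exprS ler_piMl ?exprn_ge0 // ltW.
rewrite realCV realCB realC_norm lef_pV2 ?posrE; first last.
- by rewrite subr_gt0.
- by rewrite normr_gt0; case: nq.
apply: le_trans (lerB_dist _ _); rewrite normr1 lerD2l lerN2 normrX exprS.
by rewrite ler_piMr // exprn_ile1 // ltW.
Qed.

(** A zero limit would make the reciprocals of the partial products unbounded, against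
    [iqpoch_bounded]. *)
Lemma qpoch_inf_neq0 (q : C) : q != 0 -> `|q| < 1 -> qpoch_inf q q != 0.
Proof.
move=> q0 q1; have nq := nonroot_norm_lt1 q0 q1.
have [b b0 qb] := iqpoch_bounded q0 q1.
apply/eqP => e; have := @cvg_qpoch q q q1; rewrite e => /cvgrPdist_lt.
have bV : 0 < (b%:C)^-1 by rewrite invr_gt0 ltcR.
move=> /(_ _ bV) [N _ /(_ N (leqnn N))] /=; rewrite sub0r normrN.
apply/negP; rewrite -real_leNgt ?gtr0_real ?realE ?normr_ge0 //.
rewrite -[leRHS]invrK lef_pV2 ?posrE ?ltcR ?invr_gt0 ?normr_gt0 ?qpoch_neq0 //.
  by rewrite -normfV; exact: (qb (Posz N)).
by rewrite normr_gt0 qpoch_neq0.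
Qed.

Lemma cvg_iqpoch (q : C) (c : int) : q != 0 -> `|q| < 1 ->
  iqpoch q (Posz N + c) @[N --> \oo] --> ((qpoch_inf q q)^-1 : C).
Proof.
move=> q0 q1; have h : (fun n => (qpoch q q n)^-1) @ \oo --> ((qpoch_inf q q)^-1 : C).
  exact: cvgV (qpoch_inf_neq0 q0 q1) (@cvg_qpoch q q q1).
move/cvgrPdist_lt: h => h.
apply/cvgrPdist_lt => e /h [N _ hN]; exists (N + `|c|)%N => // M /= NM.
have -> : Posz M + c = Posz (absz (Posz M + c)) by lia.
by apply: (hN (absz (Posz M + c))) => /=; lia.
Qed.

(** A finite set whose sum is within e of the supremum leaves less than e for any finite set
    disjoint from it. *)
Lemma summable_tail (I : choiceType) (M : I -> R) b e : (forall i, 0 <= M i) ->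
  (forall s, uniq s -> \sum_(i <- s) M i <= b) -> 0 < e ->
  exists s0 : seq I, forall s, uniq s -> (forall i, i \in s -> i \notin s0) ->
    \sum_(i <- s) M i < e.
Proof.
move=> M0 Mb e0.
pose E := [set x | exists2 s, uniq s & x = \sum_(i <- s) M i].
have Esup : has_sup E.
  split; first by exists 0, [::]; rewrite ?big_nil.
  by exists b => _ [s us ->]; exact: Mb.
have [_ [s0 us0 ->] s0e] := sup_adherent e0 Esup.
exists s0 => s us ss0.
have : \sum_(i <- s0 ++ s) M i <= sup E.
  apply: ub_le_sup; first by case: Esup.
  exists (s0 ++ s) => //; rewrite cat_uniq us0 us andbT /=.
  by apply/hasPn => i /ss0.
by rewrite big_cat /= => h; move: s0e; rewrite ltrBlDr => /(le_lt_trans h); rewrite ltrD2l.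
Qed.

Lemma near_sum_lt (I : choiceType) (d : nat -> I -> C) (s : seq I) (e : C) :
  (forall i, d N i @[N --> \oo] --> (0 : C)) -> 0 < e ->
  \forall N \near \oo, \sum_(i <- s) `|d N i| < e.
Proof.
move=> d0; elim: s e => [|i s IH] e e0.
  by apply: nearW => N; rewrite big_nil.
have e20 : 0 < e / 2 by rewrite divr_gt0.
have /cvgrPdist_lt /(_ _ e20) hi := d0 i.
have hs := IH _ e20.
near=> N; rewrite big_cons (splitr e); apply: ltrD.
  by rewrite -normrN -[- _]add0r; near: N.
by near: N.
Unshelve. all: by end_near. Qed.

(** The estimate is uniform in the finite set s, which may thus depend on N or be an arbitrary large
    set, as unconditional convergence requires. *)
Lemma tannery_null (I : choiceType) (M : I -> R) b (d : nat -> I -> C) (e : C) :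
    (forall i, 0 <= M i) -> (forall s, uniq s -> \sum_(i <- s) M i <= b) ->
    (forall N i, `|d N i| <= (M i)%:C) ->
    (forall i, d N i @[N --> \oo] --> (0 : C)) -> 0 < e ->
  \forall N \near \oo, forall s, uniq s -> `|\sum_(i <- s) d N i| < e.
Proof.
move=> M0 Mb dM d0 e0.
have e20 : 0 < e / 2 by rewrite divr_gt0.
have e2R : 0 < complex.Re (e / 2) by rewrite -ltcR -gt0_realC.
have [s0 tail] := summable_tail M0 Mb e2R.
have near0 := near_sum_lt (undup s0) d0 e20.
near=> N => s us.
rewrite (bigID (fun i => i \in s0)) /= (splitr e).
apply: le_lt_trans (ler_normD _ _) _; apply: ltr_leD; last first.
  apply: le_trans (ler_norm_sum _ _ _) _.
  apply: (@le_trans _ _ (\sum_(i <- [seq i <- s | i \notin s0]) M i)%:C).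
    rewrite big_filter rmorph_sum /=; exact: ler_sum.
  rewrite (gt0_realC e20) lecR; apply: ltW; apply: tail; first by rewrite filter_uniq.
  by move=> i; rewrite mem_filter => /andP[].
apply: le_lt_trans (ler_norm_sum _ _ _) _.
apply: (@le_lt_trans _ _ (\sum_(i <- undup s0) `|d N i|)); last by near: N.
rewrite -big_filter (perm_big [seq i <- undup s0 | i \in s]) /=; last first.
  apply: uniq_perm; rewrite ?filter_uniq ?undup_uniq // => i.
  by rewrite !mem_filter mem_undup andbC.
by rewrite big_filter [leRHS](bigID (fun i => i \in s)) /= lerDl sumr_ge0.
Unshelve. all: by end_near. Qed.

(** The differences f (W N - 1) are dominated by a multiple of |f| and tend to 0 pointwise, so
    weighted and unweighted sums agree up to a small error on every finite set. The limit of the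
    weighted sums is then the unconditional sum. *)
Lemma has_sum_tannery (I : choiceType) (f : I -> C) (W : nat -> I -> C)
    (A : nat -> seq I) (S : C) b c :
    (forall N, uniq (A N)) -> 0 <= c ->
    (forall s, uniq s -> \sum_(i <- s) complex.Re `|f i| <= b) ->
    (forall N i, `|W N i| <= c%:C) -> (forall i, W N i @[N --> \oo] --> (1 : C)) ->
    (forall N i, i \notin A N -> W N i = 0) ->
    (\sum_(i <- A N) f i * W N i) @[N --> \oo] --> S ->
  has_sum f S.
Proof.
move=> uA c0 fb Wc W1 W0 AS e e0.
have e30 : 0 < e / 3 by rewrite divr_gt0.
have e3R : 0 < complex.Re (e / 3) by rewrite -ltcR -gt0_realC.
have f0 i : 0 <= complex.Re `|f i| by rewrite -lecR realC_norm; exact: normr_ge0.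
have [s0 tail] := summable_tail f0 fb e3R.
pose M i := complex.Re `|f i| * (c + 1).
pose d N i := f i * W N i - f i.
have M0 i : 0 <= M i by rewrite mulr_ge0 // addr_ge0.
have Mb s : uniq s -> \sum_(i <- s) M i <= b * (c + 1).
  by move=> us; rewrite -big_distrl /= ler_wpM2r ?addr_ge0 // fb.
have dM N i : `|d N i| <= (M i)%:C.
  rewrite /d /M -[X in _ - X]mulr1 -mulrBr normrM realCM realC_norm ler_wpM2l //.
  apply: le_trans (ler_normB _ _) _; rewrite normr1 realCD.
  by apply: lerD; rewrite ?Wc.
have d0 i : d N i @[N --> \oo] --> (0 : C).
  rewrite -(subrr (f i)) -{1}[f i]mulr1.
  by apply: cvgB; [apply: cvgMl_tmp; exact: W1 | exact: cvg_cst].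
have near1 := tannery_null M0 Mb dM d0 e30.
have /cvgrPdist_lt /(_ _ e30) near2 := AS.
exists [fset x in s0]%fset => B s0B.
near \oo => N.
(* The comparison takes place on the union of B and A N: passing from B to the union costs a tail of
   f, and on the union the weighted sum is already the one over A N. *)
have uBA : uniq (undup (B ++ A N)) by exact: undup_uniq.
have h1 : `|\sum_(i <- undup (B ++ A N)) f i - \sum_(i <- B) f i| < e / 3.
  rewrite (bigID (fun i => i \in B)) /= -big_filter (perm_big B) /=; last first.
    apply: uniq_perm; rewrite ?filter_uniq ?fset_uniq // => i.
    by rewrite mem_filter mem_undup mem_cat andb_orr andbb; case: (i \in B).
  rewrite addrAC subrr add0r -big_filter.
  apply: le_lt_trans (ler_norm_sum _ _ _) _.
  rewrite (gt0_realC e30).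
  rewrite (eq_bigr (fun i => (complex.Re `|f i|)%:C)) => [|i _]; last by rewrite realC_norm.
  rewrite -(rmorph_sum (real_complex R)) /= ltcR; apply: tail; first by rewrite filter_uniq.
  move=> i; rewrite mem_filter => /andP[iB _]; apply: contra iB => is0.
  by apply: (fsubsetP s0B); rewrite inE.
have h2 : `|\sum_(i <- undup (B ++ A N)) f i * W N i -
            \sum_(i <- undup (B ++ A N)) f i| < e / 3.
  by rewrite -sumrB; move: (undup _) uBA; near: N.
have h3 : \sum_(i <- undup (B ++ A N)) f i * W N i = \sum_(i <- A N) f i * W N i.
  rewrite (bigID (fun i => i \in A N)) /= [X in _ + X]big1 ?addr0 => [|i iA]; last first.
    by rewrite W0 ?mulr0.
  rewrite -big_filter; apply: perm_big; apply: uniq_perm; rewrite ?filter_uniq // => i.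
  by rewrite mem_filter mem_undup mem_cat andb_orr andbb orbC; case: (i \in A N).
have h4 : `|S - \sum_(i <- A N) f i * W N i| < e / 3 by near: N.
rewrite h3 in h2.
move: h1 h2 h4; set a := \sum_(i <- undup _) _; set x := \sum_(i <- A N) _ => h1 h2 h4.
have -> : \sum_(i <- B) f i - S =
  - (a - \sum_(i <- B) f i) - (x - a) - (S - x) by ring.
rewrite (_ : e = e / 3 + e / 3 + e / 3); last by field.
apply: le_lt_trans (ler_normB _ _) _; apply: ltrD => //.
apply: le_lt_trans (ler_normB _ _) _; apply: ltrD => //.
by rewrite normrN.
Unshelve. all: by end_near. Qed.

Lemma ler_sum_subset (I : eqType) (s1 s2 : seq I) (M : I -> R) :
  (forall i, 0 <= M i) -> uniq s1 -> uniq s2 -> {subset s1 <= s2} ->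
  \sum_(i <- s1) M i <= \sum_(i <- s2) M i.
Proof.
move=> M0 u1 u2 s12; rewrite [leRHS](bigID (fun i => i \in s1)) /= -[X in _ <= X + _]big_filter.
rewrite [X in _ <= X + _](perm_big s1) /= ?lerDl ?sumr_ge0 //.
apply: uniq_perm => [||i] //.
  by rewrite filter_uniq.
by rewrite mem_filter; case: (boolP (i \in s1)) => // /s12.
Qed.

Lemma geometric_uniq_sum r (s : seq nat) : 0 <= r < 1 -> uniq s ->
  \sum_(i <- s) r ^+ i <= (1 - r)^-1.
Proof.
move=> r01 us; have [r0 _] : 0 <= r /\ r < 1 by apply/andP.
apply: le_trans (geometric_sum_le (\max_(i <- s) i).+1 r01).
apply: ler_sum_subset => [i|||i si]; rewrite ?exprn_ge0 ?iota_uniq //.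
by rewrite mem_index_iota ltnS /=; apply: (leq_bigmax_seq (F := id)).
Qed.

Lemma theta_Negz (z p : C) i : z != 0 ->
  theta z p (Negz i) = (- (p / z)) ^+ i.+1 * p ^+ 'C(i.+1, 2).
Proof.
move=> z0; rewrite /theta [tri _]/= binS bin1 exprD NegzE -invr_expz -exprnP.
by rewrite -mulrN -invrN exprMn exprVn [LHS]mulrC -mulrA mulrC.
Qed.

(** The halves n >= 0 and n < 0 are dominated by geometric series in |z| and |p/z|, the remaining
    powers of p having modulus at most 1. Pairing n with -1 - n makes this one dominated sum over
    the natural numbers. *)
Lemma theta_cvg0 (z p : C) (k : nat -> int -> C) b : z != 0 -> `|z| < 1 -> `|p / z| < 1 ->
    (forall N n, `|k N n| <= b%:C) -> (forall n, k N n @[N --> \oo] --> (0 : C)) ->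
  bsum N.+2 (fun n => theta z p n * k N n) @[N --> \oo] --> (0 : C).
Proof.
move=> z0 z1 pz1 kb k0.
have p1 : `|p| <= 1.
  by rewrite -[p](divfK z0) normrM mulr_ile1 // ltW.
have b0 : 0 <= b by rewrite -lecR; exact: le_trans (normr_ge0 _) (kb 0%N 0).
have tP i : `|theta z p (Posz i)| <= (complex.Re `|z| ^+ i)%:C.
  rewrite /theta /= -exprnP normrM !normrX normrN realCX realC_norm.
  by rewrite ler_piMr ?exprn_ge0 // exprn_ile1.
have tN i : `|theta z p (Negz i)| <= (complex.Re `|p / z| ^+ i)%:C.
  rewrite theta_Negz // normrM !normrX normrN realCX realC_norm exprS mulrAC.
  by rewrite ler_piMl ?exprn_ge0 // mulr_ile1 ?exprn_ge0 ?exprn_ile1 // ltW.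
pose d N i := theta z p (Posz i) * k N (Posz i) + theta z p (Negz i) * k N (Negz i).
pose M i := b * (complex.Re `|z| ^+ i) + b * (complex.Re `|p / z| ^+ i).
have z01 := norm_lt1_Re z1; have w01 := norm_lt1_Re pz1.
have [rz _] : 0 <= complex.Re `|z| /\ complex.Re `|z| < 1 by apply/andP.
have [rw _] : 0 <= complex.Re `|p / z| /\ complex.Re `|p / z| < 1 by apply/andP.
apply/cvgrPdist_lt => e e0.
have := @tannery_null _ M (b * (1 - complex.Re `|z|)^-1 + b * (1 - complex.Re `|p / z|)^-1)
  d e _ _ _ _ e0.
have h1 i : 0 <= M i by rewrite addr_ge0 // mulr_ge0 // exprn_ge0.
have h2 s : uniq s -> \sum_(i <- s) M i <=
    b * (1 - complex.Re `|z|)^-1 + b * (1 - complex.Re `|p / z|)^-1.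
  move=> us; rewrite big_split -!big_distrr /=.
  by apply: lerD; rewrite ler_wpM2l // geometric_uniq_sum.
have h3 N i : `|d N i| <= (M i)%:C.
  apply: le_trans (ler_normD _ _) _; rewrite realCD.
  apply: lerD; rewrite (normrM (theta _ _ _)) mulrC realCM.
    exact: ler_pM (normr_ge0 _) (normr_ge0 _) (kb _ _) (tP _).
  exact: ler_pM (normr_ge0 _) (normr_ge0 _) (kb _ _) (tN _).
have h4 i : d N i @[N --> \oo] --> (0 : C).
  have -> : (0 : C) = theta z p (Posz i) * 0 + theta z p (Negz i) * 0.
    by rewrite !mulr0 addr0.
  by apply: cvgD; apply: cvgMl_tmp; exact: k0.
move=> /(_ h1 h2 h3 h4); apply: filterS => N hN.
rewrite sub0r normrN /bsum -(big_mkord xpredT (d N)).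
by apply: hN; rewrite iota_uniq.
Qed.

Lemma kern_bounded (q : C) s : q != 0 -> `|q| < 1 ->
  exists b, forall L (m : int), `|kern q s L m| <= b%:C.
Proof.
move=> q0 q1; have [b b0 qb] := iqpoch_bounded q0 q1.
exists (b * b) => L m; rewrite /kern normrM realCM.
exact: ler_pM (normr_ge0 _) (normr_ge0 _) (qb _) (qb _).
Qed.

Lemma cvg_kern (q : C) s (m : int) : q != 0 -> `|q| < 1 ->
  kern q s L m @[L --> \oo] --> ((qpoch_inf q q)^-1 * (qpoch_inf q q)^-1 : C).
Proof.
move=> q0 q1; apply: cvgM; first exact: cvg_iqpoch.
under eq_fun do rewrite -addrA.
exact: cvg_iqpoch.
Qed.

Lemma cvg_bsum_theta (q z p : C) s rho : q != 0 -> `|q| < 1 -> z != 0 -> p != 0 ->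
    `|z| < 1 -> `|p / z| < 1 ->
  bsum N.+2 (fun n => theta z p n * kern q s N (Posz rho * n)) @[N --> \oo] -->
    (qpochs_inf [:: z; p / z; p] p / (qpoch_inf q q * qpoch_inf q q) : C).
Proof.
move=> q0 q1 z0 p0 z1 pz1.
have p1 : `|p| < 1.
  by rewrite -[p](divfK z0) normrM mulr_ilt1.
have qi0 := qpoch_inf_neq0 q0 q1; have pi0 := qpoch_inf_neq0 p0 p1.
set Q := qpoch_inf q q in qi0 *; set P := qpoch_inf p p in pi0 *.
have [b kb] := kern_bounded s q0 q1; have [c kc] := kern_bounded 0 p0 p1.
pose k N n := kern q s N (Posz rho * n) - P * P / (Q * Q) * kern p 0 N n.
have k0 n : k N n @[N --> \oo] --> (0 : C).
  have -> : (0 : C) = Q^-1 * Q^-1 - P * P / (Q * Q) * (P^-1 * P^-1).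
    exact: norm_const_diff.
  by apply: cvgB; [exact: cvg_kern | apply: cvgMl_tmp; exact: cvg_kern].
have kbd N n : `|k N n| <= (b + complex.Re `|P * P / (Q * Q)| * c)%:C.
  apply: le_trans (ler_normB _ _) _.
  rewrite (normrM (P * P / (Q * Q))) realCD realCM realC_norm.
  apply: lerD; first exact: kb.
  by apply: ler_wpM2l => //; exact: kc.
apply: cvg_bsum_theta_diff => //.
- by move=> a x; exact: cvg_qpoch.
- exact: nonroot_norm_lt1.
- exact: theta_cvg0 z0 z1 pz1 kbd k0.
Qed.

Lemma cvg_bailey_pair (q y z p : C) s rho (b : nat -> C) :
    q != 0 -> `|q| < 1 -> z != 0 -> p != 0 -> `|z| < 1 -> `|p / z| < 1 ->
    bailey_pair q rho s z p b ->
  qpoch y q N * qpoch q q N * b N @[N --> \oo] -->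
    (qpoch_inf y q / qpoch_inf q q * qpochs_inf [:: z; p / z; p] p : C).
Proof.
move=> q0 q1 z0 p0 z1 pz1 bp.
apply: (cvg_bailey_pair_theta _ _ _ bp) => //.
- by move=> a x; exact: cvg_qpoch.
- exact: qpoch_inf_neq0.
- exact: cvg_bsum_theta.
Qed.
End ComplexLimits.

(** * Nahm sums as limits of Bailey chains *)

Section Boxes.
Local Open Scope classical_set_scope.
Local Open Scope ring_scope.

Definition vec r (l : seq nat) : 'cV[nat]_r := \col_i nth 0%N l i.

Definition entries r (v : 'cV[nat]_r) : seq nat := [seq v i ord0 | i <- enum 'I_r].

Lemma size_entries r (v : 'cV[nat]_r) : size (entries v) = r.
Proof. by rewrite size_map size_enum_ord. Qed.

Lemma entriesK r (v : 'cV[nat]_r) : vec r (entries v) = v.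
Proof.
apply/colP => i; rewrite mxE (nth_map i) ?size_enum_ord //.
by rewrite nth_ord_enum.
Qed.

Lemma vecK r l : size l = r -> entries (vec r l) = l.
Proof.
move=> lr; apply: (@eq_from_nth _ 0%N) => [|i]; rewrite size_entries // => ir.
have -> : i = val (Ordinal ir) by [].
by rewrite (nth_map (Ordinal ir)) ?size_enum_ord // mxE nth_ord_enum.
Qed.

Lemma boxS k N : box k.+1 N = [seq i :: l | i <- iota 0 N.+1, l <- box k N].
Proof. by []. Qed.

Lemma mem_box k N l : (l \in box k N) = (size l == k) && all (fun i => (i <= N)%N) l.
Proof.
elim: k l => [|k IH] l; first by case: l.
rewrite boxS; apply/allpairsPdep/idP => [[i [l' [iN lb ->]]]|].
  by move: iN lb; rewrite mem_iota IH /= eqSS add0n ltnS => -> /andP[-> ->].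
case: l => // i l; rewrite [size _]/= [all _ _]/= eqSS => /and3P[lk iN lN].
by exists i, l; rewrite mem_iota IH lk lN add0n ltnS.
Qed.

Lemma uniq_box k N : uniq (box k N).
Proof.
elim: k => // k IH; rewrite boxS; apply: allpairs_uniq; rewrite ?iota_uniq //.
by move=> [i l] [j l'] _ _ [-> ->].
Qed.

(** The last coordinate has its own bound: when n_r is split by parity it must run up to 2N + 1, so
    that 2m and 2m + 1 are both present for every m <= N. *)
Definition vec_box k N D : seq 'cV[nat]_k.+2 :=
  [seq vec k.+2 (x.1 :: rcons x.2.1 x.2.2) |
     x <- [seq (i, y) | i <- iota 0 N.+1, y <- [seq (l, m) | l <- box k N, m <- iota 0 D]]].

Lemma uniq_vec_box k N D : uniq (vec_box k N D).
Proof.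
rewrite map_inj_in_uniq.
  apply: allpairs_uniq => [||[i x] [j y] _ _ [-> ->] //]; first exact: iota_uniq.
  apply: allpairs_uniq => [||[i x] [j y] _ _ [-> ->] //]; [exact: uniq_box | exact: iota_uniq].
move=> x x' /allpairsPdep[i [_ [_ /allpairsPdep[l [m [lb _ ->]]] ->]]].
move=> /allpairsPdep[i' [_ [_ /allpairsPdep[l' [m' [lb' _ ->]]] ->]]].
move=> /(congr1 (@entries _)); rewrite !vecK /= ?size_rcons.
- by case=> -> /rcons_inj[-> ->].
- by move: lb'; rewrite mem_box => /andP[/eqP->].
- by move: lb; rewrite mem_box => /andP[/eqP->].
Qed.

Lemma vecP k (v : 'cV[nat]_k.+2) :
  exists n1 l m, size l = k /\ v = vec k.+2 (n1 :: rcons l m).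
Proof.
rewrite -[v]entriesK; have := size_entries v.
case: (entries v) => // n1 l [lk].
case/lastP: l lk => // l m; rewrite size_rcons => -[lk].
by exists n1, l, m.
Qed.

Lemma mem_vec_box k N D n1 l m : size l = k ->
  (vec k.+2 (n1 :: rcons l m) \in vec_box k N D) =
  [&& (n1 <= N)%N, all (fun i => (i <= N)%N) l & (m < D)%N].
Proof.
move=> lk; apply/mapP/and3P => [[x /allpairsPdep[i [y [iN yb ->]]]]|[n1N lN mD]].
  move: yb => /allpairsPdep[l' [m' [lb mD ->]]]; rewrite [(_, _).1]/= [(_, _).2]/=.
  move: lb iN mD; rewrite mem_box !mem_iota => /andP[/eqP lk' lN] iN mD.
  move=> /(congr1 (@entries _)); rewrite !vecK /= ?size_rcons ?lk ?lk' //.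
  by case=> -> /rcons_inj[-> ->].
exists (n1, (l, m)) => //; apply/allpairsPdep; exists n1, (l, m).
rewrite mem_iota ltnS n1N; split => //.
by apply/allpairsPdep; exists l, m; rewrite mem_box lk eqxx lN mem_iota mD.
Qed.

Lemma big_vec_box (K : numFieldType) k N D (F : 'cV[nat]_k.+2 -> K) :
  \sum_(v <- vec_box k N D) F v =
  \sum_(n1 < N.+1) \sum_(l <- box k N) \sum_(m < D) F (vec k.+2 (val n1 :: rcons l (val m))).
Proof.
rewrite big_map big_allpairs_dep -(big_mkord xpredT (fun n1 =>
  \sum_(l <- box k N) \sum_(m < D) F (vec k.+2 (n1 :: rcons l (val m))))).
rewrite /index_iota subn0; apply: eq_bigr => n1 _.
rewrite big_allpairs_dep; apply: eq_bigr => l _.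
by rewrite -(big_mkord xpredT (fun m => F (vec k.+2 (n1 :: rcons l m)))) /index_iota subn0.
Qed.

Lemma sum_box_geometric (K : numFieldType) (r : K) k N :
  \sum_(l <- box k N) r ^+ sumn l = (\sum_(i < N.+1) r ^+ i) ^+ k.
Proof.
elim: k => [|k IH]; first by rewrite big_seq1.
rewrite big_box_cons exprS -IH big_distrl /=; apply: eq_bigr => i _.
by rewrite big_distrr /=; apply: eq_bigr => l _; rewrite exprD.
Qed.

Lemma half_leq_double N m : (m./2 <= N)%N = (m < N.+1.*2)%N.
Proof. by lia. Qed.

Lemma cvgn_congr (K : numFieldType) (u v : nat -> K) (l : K) :
  (forall n, u n = v n) -> v @ \oo --> l -> u @ \oo --> l.
Proof. by move=> uv; rewrite (_ : u = v) //; exact/funext. Qed.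

Lemma cvgn_scale (K : numFieldType) (u : nat -> K) (a l : K) :
  u @ \oo --> l -> (a * u n) @[n --> \oo] --> a * l.
Proof. exact: cvgMl_tmp. Qed.

Lemma cvgn_add_scale (K : numFieldType) (u v : nat -> K) (a l m : K) :
  u @ \oo --> l -> v @ \oo --> m -> u n + a * v n @[n --> \oo] --> l + a * m.
Proof. by move=> ul vm; apply: cvgD => //; exact: cvgMl_tmp. Qed.

(** The normal form of a Nahm term: n_1 occurs as in Euler's sum, the middle variables as in the
    chain, and every other dependence on n_r sits in b0. *)
Definition summand (K : numFieldType) (q y : K) ws (b0 : nat -> K) n1 l m : K :=
  (- y) ^+ n1 * q ^+ ('C(n1, 2) + m * n1) * iqpoch q (Posz n1) *
  (q ^+ wexp ws l m * (\prod_(i <- l) iqpoch q (Posz i)) * b0 m).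

Lemma summand_cutoff_sum (K : numFieldType) (q y : K) (b0 : nat -> K) s ws N :
    nonroot q -> y != 0 -> (forall m, qpoch y q m != 0) ->
  \sum_(n1 < N.+1) \sum_(l <- box (size ws) N) \sum_(m < N.+1)
    summand q y (s :: ws) b0 n1 l m * cutoff q N n1 l m =
  qpoch y q N * qpoch q q N *
    foldr (step q) (fun m => b0 m / qpoch y q m) (s :: ws) N.
Proof. exact: nahm_cutoff_sum. Qed.

Lemma big_ord_double (K : numFieldType) N (F : nat -> K) :
  \sum_(m < N.*2) F m = \sum_(m < N) (F m.*2 + F m.*2.+1).
Proof.
elim: N => [|N IH]; first by rewrite !big_ord0.
by rewrite doubleS !big_ord_recr /= IH addrA.
Qed.

Lemma box_sumZ (K : numFieldType) k N (t u w : nat -> seq nat -> nat -> K) (a : K) :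
    (forall n1 l m, size l = k -> t n1 l m = a * u n1 l m) ->
  \sum_(n1 < N.+1) \sum_(l <- box k N) \sum_(m < N.+1) t n1 l m * w n1 l m =
  a * \sum_(n1 < N.+1) \sum_(l <- box k N) \sum_(m < N.+1) u n1 l m * w n1 l m.
Proof.
move=> tE; rewrite mulr_sumr; apply: eq_bigr => n1 _.
rewrite mulr_sumr big_seq [RHS]big_seq.
apply: eq_bigr => l; rewrite mem_box => /andP[/eqP lk _].
by rewrite mulr_sumr; apply: eq_bigr => m _; rewrite tE // mulrA.
Qed.

(** Since 2m and 2m + 1 have the same half, one cutoff serves both parities, and the weighted sum
    falls apart into two sums in normal form. *)
Lemma parity_cutoff_sum (K : numFieldType) k N (t : nat -> seq nat -> nat -> K)
    (q y0 y1 a : K) ws0 ws1 (b0 b1 : nat -> K) :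
    (forall n1 l m, size l = k -> t n1 l m.*2 = summand q y0 ws0 b0 n1 l m) ->
    (forall n1 l m, size l = k -> t n1 l m.*2.+1 = a * summand q y1 ws1 b1 n1 l m) ->
  \sum_(n1 < N.+1) \sum_(l <- box k N) \sum_(m < N.+1.*2)
    t n1 l m * cutoff q N n1 l m./2 =
  \sum_(n1 < N.+1) \sum_(l <- box k N) \sum_(m < N.+1)
    summand q y0 ws0 b0 n1 l m * cutoff q N n1 l m +
  a * \sum_(n1 < N.+1) \sum_(l <- box k N) \sum_(m < N.+1)
    summand q y1 ws1 b1 n1 l m * cutoff q N n1 l m.
Proof.
move=> t0 t1; rewrite big_distrr -big_split /=; apply: eq_bigr => n1 _.
rewrite big_distrr -big_split /= big_seq [RHS]big_seq; apply: eq_bigr => l.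
rewrite mem_box => /andP[/eqP lk _].
rewrite (@big_ord_double _ N.+1 (fun m => t n1 l m * cutoff q N n1 l m./2)).
rewrite big_distrr -big_split /=; apply: eq_bigr => m _.
by rewrite t0 // t1 // doubleK uphalf_double mulrA.
Qed.

Lemma sum_vec_geometric (R : realType) (x : R) r (s : seq 'cV[nat]_r) : 0 <= x < 1 -> uniq s ->
  \sum_(v <- s) x ^+ sumn (entries v) <= (1 - x)^-1 ^+ r.
Proof.
move=> x01 us; have [x0 x1] : 0 <= x /\ x < 1 by apply/andP.
pose N := \max_(v <- s) sumn (entries v).
apply: (@le_trans _ _ (\sum_(v <- [seq vec r l | l <- box r N]) x ^+ sumn (entries v))).
  apply: ler_sum_subset => // [v||v vs]; first by rewrite exprn_ge0.
    rewrite map_inj_in_uniq ?uniq_box // => l l'; rewrite !mem_box.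
    move=> /andP[/eqP lr _] /andP[/eqP lr' _] /(congr1 (@entries _)).
    by rewrite !vecK.
  apply/mapP; exists (entries v); last by rewrite entriesK.
  rewrite mem_box size_entries eqxx /=.
  have : (sumn (entries v) <= N)%N by apply: (leq_bigmax_seq (F := fun v => sumn (entries v))).
  elim: (entries v) => //= i l IH il.
  by rewrite IH; lia.
rewrite big_map big_seq.
rewrite (eq_bigr (fun l => x ^+ sumn l)) => [|l]; last first.
  by rewrite mem_box => /andP[/eqP lr _]; rewrite vecK.
rewrite -big_seq sum_box_geometric; apply: lerXn2r; rewrite ?nnegrE.
- by apply: sumr_ge0 => i _; rewrite exprn_ge0.
- by rewrite invr_ge0 subr_ge0 ltW.
by rewrite -(big_mkord xpredT (fun i => x ^+ i)) geometric_sum_le.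
Qed.

End Boxes.

Section NahmLimits.
Local Open Scope classical_set_scope.
Local Open Scope ring_scope.
Variable R : realType.
Local Notation C := (R[i] : numFieldType).
Local Notation "x %:C" := (real_complex R x) : ring_scope.

Lemma cvg_subn (u : nat -> C) (l : C) m : u @ \oo --> l -> u (n - m)%N @[n --> \oo] --> l.
Proof.
move=> /cvgrPdist_lt ul; apply/cvgrPdist_lt => e /ul [N _ hN].
by exists (N + m)%N => // n /= Nn; apply: (hN (n - m)%N) => /=; lia.
Qed.

Lemma cvg_iqpoch_subn (q : C) m n1 : q != 0 -> `|q| < 1 ->
  iqpoch q (Posz (N - m) - Posz n1) @[N --> \oo] --> ((qpoch_inf q q)^-1 : C).
Proof.
move=> q0 q1; apply: (@cvg_subn (fun N => iqpoch q (Posz N - Posz n1)) _ m).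
exact: cvg_iqpoch.
Qed.

Lemma cvg_cutoff (q : C) n1 l m : q != 0 -> `|q| < 1 ->
  cutoff q N n1 l m @[N --> \oo] --> (1 : C).
Proof.
move=> q0 q1; have Q0 := qpoch_inf_neq0 q0 q1.
have -> : (1 : C) = qpoch_inf q q * (qpoch_inf q q)^-1 * (qpoch_inf q q * (qpoch_inf q q)^-1).
  by rewrite !mulfV ?mul1r.
apply: cvgn_mul; apply: cvgn_mul.
- exact: cvg_subn (@cvg_qpoch R q q q1).
- exact: cvg_iqpoch_subn.
- exact: cvg_qpoch.
- exact: cvg_iqpoch.
Qed.

Lemma cutoff_bounded (q : C) : q != 0 -> `|q| < 1 ->
  exists2 c, 0 <= c & forall N n1 l m, `|cutoff q N n1 l m| <= c%:C.
Proof.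
move=> q0 q1; have [b b0 qb] := iqpoch_bounded q0 q1.
have [d qd] := qpoch_bounded q q1.
have d0 : 0 <= d by rewrite -lecR; exact: le_trans (normr_ge0 _) (qd 0%N).
exists (d * b * (d * b)) => [|N n1 l m]; first by rewrite !mulr_ge0 // ltW.
rewrite /cutoff !realCM 3!normrM.
by apply: ler_pM; rewrite ?mulr_ge0 ?normr_ge0 //; apply: ler_pM; rewrite ?normr_ge0 ?qd ?qb.
Qed.

Lemma cutoff_eq0 (q : C) N n1 l m :
  ~~ [&& (n1 <= N)%N, all (fun i => (i <= N)%N) l & (m <= N)%N] -> cutoff q N n1 l m = 0.
Proof.
rewrite /cutoff !negb_and => /or3P[n1N|lN|mN].
- by rewrite [iqpoch q (_ - Posz n1)]iqpoch_eq0 ?mulr0 ?mul0r //; lia.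
- rewrite [iqpoch q (_ - Posz (_ + _))]iqpoch_eq0 ?mulr0 //.
  suff : (N < sumn l)%N by lia.
  move: lN; elim: l => //= i l IH; rewrite negb_and => /orP[iN|/IH]; lia.
- by rewrite [iqpoch q (_ - Posz (_ + _))]iqpoch_eq0 ?mulr0 //; lia.
Qed.

(** Here [mu] takes n_r to the chain variable m, being the identity for AvDv and [half] for AD and
    BD, and D N is the bound on n_r matching m <= N. The weights are the cutoffs; the geometric
    bound on the terms gives absolute summability. *)
Lemma has_sum_nahm k (t : 'cV[nat]_k.+2 -> C) (q S : C) (mu D : nat -> nat) (c x : R) :
    q != 0 -> `|q| < 1 -> 0 <= c -> 0 <= x < 1 ->
    (forall n1 l m, size l = k ->
      `|t (vec k.+2 (n1 :: rcons l m))| <= (c * x ^+ (n1 + sumn l + m))%:C) ->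
    (forall N m, (mu m <= N)%N = (m < D N)%N) ->
    \sum_(n1 < N.+1) \sum_(l <- box k N) \sum_(m < D N)
      t (vec k.+2 (val n1 :: rcons l (val m))) * cutoff q N n1 l (mu m) @[N --> \oo] --> S ->
  has_sum t S.
Proof.
move=> q0 q1 c0 x01 tb muD tS.
have [d d0 cd] := cutoff_bounded q0 q1.
pose W N (v : 'cV[nat]_k.+2) := let L := entries v in
  cutoff q N (head 0%N L) (take k (behead L)) (mu (last 0%N L)).
have WE N n1 l m : size l = k ->
    W N (vec k.+2 (n1 :: rcons l m)) = cutoff q N n1 l (mu m).
  move=> lk; rewrite /W vecK /= ?size_rcons ?lk // last_rcons -cats1.
  by rewrite take_size_cat.
have uA N : uniq (vec_box k N (D N)) by exact: uniq_vec_box.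
have tsum s : uniq s -> \sum_(v <- s) complex.Re `|t v| <= c * (1 - x)^-1 ^+ k.+2.
  move=> us; apply: (@le_trans _ _ (\sum_(v <- s) c * x ^+ sumn (entries v))).
    apply: ler_sum => v _; have [n1 [l [m [lk ->]]]] := vecP v.
    rewrite -lecR realC_norm; apply: le_trans (tb _ _ _ lk) _.
    by rewrite vecK /= ?size_rcons ?lk // sumn_rcons addnA.
  by rewrite -big_distrr /= ler_wpM2l // sum_vec_geometric.
have Wd N v : `|W N v| <= d%:C by exact: cd.
have W1 v : W N v @[N --> \oo] --> (1 : C).
  have [n1 [l [m [lk ->]]]] := vecP v.
  rewrite (_ : (fun N => _) = (fun N => cutoff q N n1 l (mu m))); first exact: cvg_cutoff.
  by apply/funext => N; exact: WE.
have W0 N v : v \notin vec_box k N (D N) -> W N v = 0.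
  have [n1 [l [m [lk ->]]]] := vecP v.
  by rewrite mem_vec_box // WE // => h; rewrite cutoff_eq0 // muD.
apply: (has_sum_tannery uA d0 tsum Wd W1 W0).
rewrite (_ : (fun N => _) = (fun N => \sum_(n1 < N.+1) \sum_(l <- box k N) \sum_(m < D N)
      t (vec k.+2 (val n1 :: rcons l (val m))) * cutoff q N n1 l (mu m))); first exact: tS.
apply/funext => N; rewrite big_vec_box; apply: eq_bigr => n1 _.
rewrite big_seq [RHS]big_seq; apply: eq_bigr => l; rewrite mem_box => /andP[/eqP lk _].
by apply: eq_bigr => m _; rewrite WE.
Qed.


Lemma cvg_summand_sum (q y z p : C) s ws rho sigma (b0 : nat -> C) :
    q != 0 -> `|q| < 1 -> y != 0 -> (forall m, qpoch y q m != 0) ->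
    z != 0 -> p != 0 -> `|z| < 1 -> `|p / z| < 1 ->
    bailey_pair q rho sigma z p
      (foldr (step q) (fun m => b0 m / qpoch y q m) (s :: ws)) ->
  \sum_(n1 < N.+1) \sum_(l <- box (size ws) N) \sum_(m < N.+1)
    summand q y (s :: ws) b0 n1 l m * cutoff q N n1 l m @[N --> \oo] -->
    (qpoch_inf y q / qpoch_inf q q * qpochs_inf [:: z; p / z; p] p : C).
Proof.
move=> q0 q1 y0 yq z0 p0 z1 pz1 bp; have nq := nonroot_norm_lt1 q0 q1.
under eq_fun do rewrite summand_cutoff_sum //.
exact: cvg_bailey_pair bp.
Qed.

Lemma has_sum_nahm_single k (t : 'cV[nat]_k.+2 -> C) (q y z p a S : C) s ws rho sigma
    (b0 : nat -> C) (c x : R) :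
    q != 0 -> `|q| < 1 -> size ws = k -> y != 0 -> (forall m, qpoch y q m != 0) ->
    z != 0 -> p != 0 -> `|z| < 1 -> `|p / z| < 1 ->
    0 <= c -> 0 <= x < 1 ->
    (forall n1 l m, size l = k ->
      `|t (vec k.+2 (n1 :: rcons l m))| <= (c * x ^+ (n1 + sumn l + m))%:C) ->
    (forall n1 l m, size l = k ->
      t (vec k.+2 (n1 :: rcons l m)) = a * summand q y (s :: ws) b0 n1 l m) ->
    bailey_pair q rho sigma z p
      (foldr (step q) (fun m => b0 m / qpoch y q m) (s :: ws)) ->
    S = a * (qpoch_inf y q / qpoch_inf q q * qpochs_inf [:: z; p / z; p] p) ->
  has_sum t S.
Proof.
move=> q0 q1 sz y0 yq z0 p0 z1 pz1 c0 x01 tb tE bp ->.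
apply: (has_sum_nahm (mu := id) (D := fun N => N.+1) q0 q1 c0 x01 tb) => //.
have h := cvg_summand_sum q0 q1 y0 yq z0 p0 z1 pz1 bp; rewrite sz in h.
apply: (cvgn_congr _ (cvgn_scale (a := a) h)) => N.
exact: (@box_sumZ _ k N (fun n1 l m => t (vec k.+2 (n1 :: rcons l m)))
  (summand q y (s :: ws) b0) (cutoff q N) a tE).
Qed.

Lemma has_sum_nahm_parity k (t : 'cV[nat]_k.+2 -> C) (q a S : C)
    (y0 z0 p0 y1 z1 p1 : C) s0 ws0 rho0 sigma0 s1 ws1 rho1 sigma1
    (b0 b1 : nat -> C) (c x : R) :
    q != 0 -> `|q| < 1 -> size ws0 = k -> size ws1 = k ->
    [/\ y0 != 0, z0 != 0, p0 != 0, `|z0| < 1 & `|p0 / z0| < 1] ->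
    [/\ y1 != 0, z1 != 0, p1 != 0, `|z1| < 1 & `|p1 / z1| < 1] ->
    (forall m, qpoch y0 q m != 0) -> (forall m, qpoch y1 q m != 0) ->
    0 <= c -> 0 <= x < 1 ->
    (forall n1 l m, size l = k ->
      `|t (vec k.+2 (n1 :: rcons l m))| <= (c * x ^+ (n1 + sumn l + m))%:C) ->
    (forall n1 l m, size l = k ->
      t (vec k.+2 (n1 :: rcons l m.*2)) = summand q y0 (s0 :: ws0) b0 n1 l m) ->
    (forall n1 l m, size l = k ->
      t (vec k.+2 (n1 :: rcons l m.*2.+1)) = a * summand q y1 (s1 :: ws1) b1 n1 l m) ->
    bailey_pair q rho0 sigma0 z0 p0
      (foldr (step q) (fun m => b0 m / qpoch y0 q m) (s0 :: ws0)) ->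
    bailey_pair q rho1 sigma1 z1 p1
      (foldr (step q) (fun m => b1 m / qpoch y1 q m) (s1 :: ws1)) ->
    S = qpoch_inf y0 q / qpoch_inf q q * qpochs_inf [:: z0; p0 / z0; p0] p0 +
        a * (qpoch_inf y1 q / qpoch_inf q q * qpochs_inf [:: z1; p1 / z1; p1] p1) ->
  has_sum t S.
Proof.
move=> q0 q1 sz0 sz1 [y00 z00 p00 z0l pz0] [y10 z10 p10 z1l pz1] y0q y1q c0 x01 tb tE tO bp0 bp1 ->.
apply: (has_sum_nahm (mu := half) (D := fun N => N.+1.*2) q0 q1 c0 x01 tb).
  exact: half_leq_double.
have h0 := cvg_summand_sum q0 q1 y00 y0q z00 p00 z0l pz0 bp0.
have h1 := cvg_summand_sum q0 q1 y10 y1q z10 p10 z1l pz1 bp1.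
rewrite sz0 in h0; rewrite sz1 in h1.
apply: (cvgn_congr _ (cvgn_add_scale (a := a) h0 h1)) => N.
exact: (@parity_cutoff_sum _ k N (fun n1 l m => t (vec k.+2 (n1 :: rcons l m)))
  q y0 y1 a (s0 :: ws0) (s1 :: ws1) b0 b1 tE tO).
Qed.

End NahmLimits.

(** * The quadratic forms in terms of tail sums *)

Section QuadraticForms.
Variable F : numFieldType.

Lemma sum_interval a b K (c : F) :
  \sum_(s < K) (if (a <= s < b)%N then c else 0) = (minn b K - a)%N%:R * c.
Proof.
elim: K => [|K IH]; first by rewrite big_ord0 minn0 mul0r.
rewrite big_ord_recr /= IH; case: ifP => h.
  by rewrite -[X in _ + X]mul1r -mulrDl natr1; congr (_%:R * _); lia.
by rewrite [LHS]addr0; congr (_%:R * _); lia.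
Qed.

(** The number of s with s <= i and s <= j is min(i, j) + 1, so the min-matrix is a sum of squares
    of tail sums. *)
Lemma sum_minn_tail K (y : nat -> F) :
  \sum_(i < K) \sum_(j < K) (minn i j).+1%:R * y i * y j =
  \sum_(s < K) (\sum_(i < K | (s <= i)%N) y i) * (\sum_(i < K | (s <= i)%N) y i).
Proof.
have minE i j : (i < K)%N -> (minn i j).+1%:R * y i * y j =
    \sum_(s < K) (if (s <= i)%N then y i else 0) * (if (s <= j)%N then y j else 0).
  move=> iK; transitivity (\sum_(s < K) (if (0 <= s < (minn i j).+1)%N then y i * y j else 0)).
    by rewrite sum_interval mulrA; congr (_%:R * _ * _); lia.
  apply: eq_bigr => s _; rewrite /= ltnS leq_min.
  by case: leqP => _; case: leqP => _ /=; rewrite ?mulr0 ?mul0r.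
transitivity (\sum_(i < K) \sum_(j < K) \sum_(s < K)
    (if (s <= i)%N then y i else 0) * (if (s <= j)%N then y j else 0)).
  by apply: eq_bigr => i _; apply: eq_bigr => j _; rewrite minE.
under eq_bigr => i _ do rewrite exchange_big /=.
rewrite exchange_big /=; apply: eq_bigr => s _.
rewrite [X in _ = X * _]big_mkcond [X in _ = _ * X]big_mkcond big_distrl /=.
by apply: eq_bigr => i _; rewrite big_distrr.
Qed.

(** The truncated difference counts the s with j - 1 <= s <= i, so each coefficient spreads over the
    tail sums from level j - 1 on. *)
Lemma sum_linear_tail K j (y : nat -> F) : (0 < j)%N ->
  \sum_(i < K) (i.+2 - j)%N%:R * y i =
  \sum_(s < K) (if (j <= s.+1)%N then 1 else 0) * \sum_(i < K | (s <= i)%N) y i.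
Proof.
move=> j0.
transitivity (\sum_(i < K) \sum_(s < K) (if (j.-1 <= s < i.+1)%N then y i else 0)).
  apply: eq_bigr => i _; rewrite sum_interval; congr (_%:R * _).
  by have := ltn_ord i; lia.
rewrite exchange_big /=; apply: eq_bigr => s _.
rewrite (_ : (j <= s.+1)%N = (j.-1 <= s)%N); last by lia.
case: leqP => _ /=; last by rewrite mul0r big1.
by rewrite mul1r [RHS]big_mkcond.
Qed.

Lemma sum_tail_rcons k (l : seq nat) (e : F) s : size l = k -> (s <= k)%N ->
  \sum_(i < k.+1 | (s <= i)%N) (if (i == k :> nat) then e else (nth 0%N l i)%:R) =
  (sumn (drop s l))%:R + e.
Proof.
move=> lk sk; rewrite big_mkcond big_ord_recr /= eqxx sk; congr (_ + _).
rewrite sumnE (big_nth 0%N) size_drop lk natr_sum -[LHS]/(\sum_(i < k) _).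
transitivity (\sum_(0 <= i < k) (if (s <= i)%N then (nth 0%N l i)%:R else 0 : F)).
  rewrite big_mkord; apply: eq_bigr => i _.
  by rewrite (ltn_eqF (ltn_ord i)).
rewrite (big_cat_nat (n := s)) //= big_nat_cond big1 ?add0r => [|i]; last first.
  by case: leqP => // si /andP[/andP[_ h] _]; move: si; rewrite leqNgt h.
rewrite -{1}[s]add0n big_addn; apply: eq_big_nat => i _.
by rewrite leq_addl nth_drop addnC.
Qed.

End QuadraticForms.

Section Exponents.

Lemma quad_entries r f l :
  ((map_mx (fun n => n%:R : rat) (vec r l))^T *m mx_of_entries r f *m
    map_mx (fun n => n%:R) (vec r l)) 0 0 =
  \sum_(i < r) \sum_(j < r) (nth 0%N l i)%:R * f i.+1 j.+1 * (nth 0%N l j)%:R.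
Proof.
rewrite mxE exchange_big /=; apply: eq_bigr => j _; rewrite !mxE big_distrl /=.
by apply: eq_bigr => i _; rewrite !mxE.
Qed.

Lemma lin_entries r g l :
  ((map_mx (fun n => n%:R : rat) (vec r l))^T *m col_of_entries r g) 0 0 =
  \sum_(i < r) (nth 0%N l i)%:R * g i.+1.
Proof. by rewrite mxE; apply: eq_bigr => i _; rewrite !mxE. Qed.

Lemma quad_split k (X : nat -> rat) (f : nat -> nat -> rat) :
  \sum_(i < k.+1) \sum_(j < k.+1) X i * f i.+1 j.+1 * X j =
  X 0%N * f 1%N 1%N * X 0%N + \sum_(j < k) X 0%N * f 1%N j.+2 * X j.+1 +
  \sum_(i < k) (X i.+1 * f i.+2 1%N * X 0%N + \sum_(j < k) X i.+1 * f i.+2 j.+2 * X j.+1).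
Proof.
rewrite big_ord_recl [X in X + _]big_ord_recl; congr (_ + _).
by apply: eq_bigr => i _; rewrite big_ord_recl.
Qed.

Lemma lin_split k (X g : nat -> rat) :
  \sum_(i < k.+1) X i * g i.+1 = X 0%N * g 1%N + \sum_(i < k) X i.+1 * g i.+2.
Proof. by rewrite big_ord_recl. Qed.

(* e is the weighted last variable: m/2 for AD and BD, m for AvDv. In the tail sums
   S the form is diagonal except for n_1 and m. *)
Lemma nahm_exponent k (f : nat -> nat -> rat) (g : nat -> rat) j n1 l m
    (al ga de be ga' h e : rat) (S := fun s => (sumn (drop s l))%:R + e)
    (x := fun i => if i == k then m%:R else (nth 0%N l i)%:R : rat)
    (y := fun i => if i == k then e else (nth 0%N l i)%:R : rat) :
    size l = k -> (0 < j)%N -> f 1 1 = al ->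
    (forall i, (i <= k)%N -> f 1 i.+2 = (i == k)%:R /\ f i.+2 1 = (i == k)%:R) ->
    (forall i j, (i <= k)%N -> (j <= k)%N -> x i * f i.+2 j.+2 * x j =
      ga * ((minn i j).+1%:R * y i * y j) +
      (if (i == k) && (j == k) then de * m%:R * m%:R else 0)) ->
    g 1 = be ->
    (forall i, (i <= k)%N -> x i * g i.+2 =
      ga' * ((i.+2 - j)%N%:R * y i) + (if i == k then h * m%:R else 0)) ->
  2^-1 * ((map_mx (fun n => n%:R : rat) (vec k.+2 (n1 :: rcons l m)))^T *m
     mx_of_entries k.+2 f *m map_mx (fun n => n%:R) (vec k.+2 (n1 :: rcons l m))) 0 0 +
  ((map_mx (fun n => n%:R : rat) (vec k.+2 (n1 :: rcons l m)))^T *m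
     col_of_entries k.+2 g) 0 0 =
  2^-1 * al * n1%:R * n1%:R + n1%:R * m%:R + be * n1%:R +
  (2^-1 * ga * \sum_(s < k.+1) S s * S s +
   ga' * \sum_(s < k.+1) (if (j <= s.+1)%N then 1 else 0) * S s) +
  2^-1 * de * m%:R * m%:R + h * m%:R.
Proof.
move=> lk j0 f11 f1 fxy g1 gx.
have xE i : (i <= k)%N -> (nth 0%N (rcons l m) i)%:R = x i.
  by rewrite nth_rcons lk /x leq_eqVlt => /orP[/eqP->|ik]; rewrite ?ltnn ?eqxx ?ik ?(ltn_eqF ik).
have sumk (c : rat) : \sum_(i < k.+1) (if i == k :> nat then c else 0) = c.
  rewrite big_ord_recr /= eqxx big1 ?add0r // => i _.
  by rewrite (ltn_eqF (ltn_ord i)).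
have sumS s : (s < k.+1)%N -> \sum_(i < k.+1 | (s <= i)%N) y i = S s.
  by move=> sk; exact: sum_tail_rcons.
pose X i : rat := (nth 0%N (n1 :: rcons l m) i)%:R.
have XE i : (i <= k)%N -> X i.+1 = x i by exact: xE.
rewrite quad_entries lin_entries (quad_split _ X) (lin_split _ X) f11 g1.
have -> : \sum_(i < k.+1) X 0%N * f 1%N i.+2 * X i.+1 = n1%:R * m%:R.
  rewrite -[RHS]sumk; apply: eq_bigr => i _; have ik : (i <= k)%N by rewrite -ltnS.
  by rewrite (f1 _ ik).1 XE // /x; case: eqP => _; rewrite ?mulr1 // mulr0 mul0r.
have -> : \sum_(i < k.+1) (X i.+1 * f i.+2 1%N * X 0%N +
      \sum_(i' < k.+1) X i.+1 * f i.+2 i'.+2 * X i'.+1) =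
    n1%:R * m%:R + (ga * (\sum_(s < k.+1) S s * S s) + de * m%:R * m%:R).
  transitivity (\sum_(i < k.+1) ((if i == k :> nat then n1%:R * m%:R else 0) +
      (ga * (\sum_(i' < k.+1) (minn i i').+1%:R * y i * y i') +
       (if i == k :> nat then de * m%:R * m%:R else 0)))).
    apply: eq_bigr => i _; have ik : (i <= k)%N by rewrite -ltnS.
    rewrite (f1 _ ik).2 XE //; congr (_ + _).
      by rewrite /x; case: eqP => _; [rewrite mulr1 mulrC | rewrite mulr0 mul0r].
    rewrite big_distrr /= -[X in _ = _ + X](_ : \sum_(i' < k.+1)
      (if (i == k :> nat) && (i' == k :> nat) then de * m%:R * m%:R else 0) = _); last first.
      by case: eqP => _ /=; [exact: sumk | rewrite big1].
    rewrite -big_split /=; apply: eq_bigr => i' _; have ik' : (i' <= k)%N by rewrite -ltnS.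
    by rewrite XE // fxy.
  rewrite !big_split /= !sumk -big_distrr /= sum_minn_tail.
  by congr (_ + (_ * _ + _)); apply: eq_bigr => s _; rewrite sumS.
have -> : \sum_(i < k.+1) X i.+1 * g i.+2 =
    ga' * (\sum_(s < k.+1) (if (j <= s.+1)%N then 1 else 0) * S s) + h * m%:R.
  transitivity (\sum_(i < k.+1) (ga' * ((i.+2 - j)%N%:R * y i) +
      (if i == k :> nat then h * m%:R else 0))).
    by apply: eq_bigr => i _; rewrite XE ?gx // -ltnS.
  rewrite big_split /= sumk -big_distrr /= sum_linear_tail //.
  by congr (_ * _ + _); apply: eq_bigr => s _; rewrite sumS.
rewrite /X /=; move: (\sum_(s < k.+1) _) (\sum_(s < k.+1) _) (n1%:R) (m%:R) => *.
by field.
Qed.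

End Exponents.

(** * Powers of q *)

Section Qpow.
Variable R : realType.
Local Notation C := (R[i] : numFieldType).
Local Notation "x %:C" := (real_complex R x) : ring_scope.
Variable tau : R[i].

Lemma cexpD (z w : R[i]) : cexp (z + w) = cexp z * cexp w.
Proof.
case: z w => [a b] [c d]; rewrite /cexp /= expRD realCM mulrACA; congr (_ * _).
rewrite cosD sinD; congr (Complex _ _).
by rewrite addrC.
Qed.

Lemma qpowD x y : qpow tau (x + y) = qpow tau x * qpow tau y.
Proof.
have e : ratr (x + y) = ratr x + ratr y :> C by exact: rmorphD.
have mulD (a u v t : C) : a * (u + v) * t = a * u * t + a * v * t by rewrite mulrDr mulrDl.
by rewrite /qpow -cexpD e mulD.
Qed.

Lemma qpow0 : qpow tau 0 = 1.
Proof.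
rewrite /qpow rmorph0 mulr0 mul0r /cexp /= expR0 cos0 sin0.
by rewrite -[_%:C]/(1 : R[i]) mul1r.
Qed.

Lemma qpowMn x n : qpow tau (x * n%:R) = qpow tau x ^+ n.
Proof.
elim: n => [|n IH]; first by rewrite mulr0 qpow0.
by rewrite -natr1 mulrDr mulr1 qpowD IH exprSr.
Qed.

Lemma norm_cexp (z : R[i]) : `|cexp z| = (expR (complex.Re z))%:C.
Proof.
have n1 (x : R) : `|Complex (cos x) (sin x)| = 1 by rewrite normc_def /= cos2Dsin2 sqrtr1.
have n2 (x : R) : `|(expR x)%:C| = (expR x)%:C by rewrite normRC ger0_norm ?expR_ge0.
by rewrite /cexp normrM n1 n2 mulr1.
Qed.

Lemma norm_qpow x : `|qpow tau x| = (expR (- (2 * pi * complex.Im tau) * ratr x))%:C.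
Proof.
rewrite /qpow norm_cexp; congr (_%:C); congr expR.
rewrite (_ : ratr x = (ratr x : R)%:C :> R[i]); last by rewrite fmorph_rat.
by case: tau => a b /=; ring.
Qed.

Lemma qpow_neq0 x : qpow tau x != 0.
Proof. by rewrite -normr_gt0 norm_qpow ltcR expR_gt0. Qed.

Lemma ler_norm_qpow x y : 0 < complex.Im tau -> x <= y -> `|qpow tau y| <= `|qpow tau x|.
Proof.
move=> tau0 xy; rewrite !norm_qpow lecR ler_expR !mulNr lerN2 ler_wpM2l ?ler_rat //.
by rewrite !mulr_ge0 ?pi_ge0 // ltW.
Qed.

Lemma norm_qpow_lt1 x : 0 < complex.Im tau -> 0 < x -> `|qpow tau x| < 1.
Proof.
move=> tau0 x0; rewrite norm_qpow -(rmorph1 (real_complex R)) /= ltcR expR_lt1.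
rewrite mulNr oppr_lt0; apply: mulr_gt0; last by rewrite ltr0q.
by apply: mulr_gt0 => //; apply: mulr_gt0; rewrite ?pi_gt0.
Qed.

End Qpow.

Section NahmTerm.
Variable R : realType.
Local Notation C := (R[i] : numFieldType).
Local Notation "x %:C" := (real_complex R x) : ring_scope.

Lemma inv_prod_entries (K : numFieldType) k n1 l m (Q q : K) (F : 'I_k.+2 -> K) :
    size l = k ->
    (forall i : 'I_k.+2, F i = let b := if i == k.+1 :> nat then q else Q in
                               qpoch b b (nth 0%N (n1 :: rcons l m) i)) ->
  (\prod_i F i)^-1 =
  iqpoch Q (Posz n1) * (\prod_(i <- l) iqpoch Q (Posz i)) * iqpoch q (Posz m).
Proof.
move=> lk FE; rewrite big_ord_recl big_ord_recr /= !FE /= !invfM mulrA.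
rewrite add0n eqxx nth_rcons lk ltnn eqxx; congr (_ * _ * _).
rewrite -prodfV (big_nth 0%N) big_mkord lk; apply: eq_bigr => i _.
by rewrite FE /= /bump /= add0n !add1n eqSS (ltn_eqF (ltn_ord i)) nth_rcons lk ltn_ord.
Qed.

Lemma nahm_term_d_AD (tau : R[i]) k A b n1 l m E : size l = k ->
    2^-1 * ((map_mx (fun n => n%:R : rat) (vec k.+2 (n1 :: rcons l m)))^T *m A *m
      map_mx (fun n => n%:R) (vec k.+2 (n1 :: rcons l m))) 0 0 +
    ((map_mx (fun n => n%:R : rat) (vec k.+2 (n1 :: rcons l m)))^T *m b) 0 0 = E ->
  nahm_term tau A b (d_AD k.+2) (vec k.+2 (n1 :: rcons l m)) =
  qpow tau E * (iqpoch (qpow tau 2) (Posz n1) *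
    (\prod_(i <- l) iqpoch (qpow tau 2) (Posz i)) * iqpoch (qpow tau 1) (Posz m)).
Proof.
move=> lk <-; rewrite /nahm_term; congr (_ * _).
apply: inv_prod_entries => // i; rewrite !mxE eqSS.
by case: ifP.
Qed.

Lemma nahm_term_d_AvDv (tau : R[i]) k A b n1 l m E : size l = k ->
    2^-1 * ((map_mx (fun n => n%:R : rat) (vec k.+2 (n1 :: rcons l m)))^T *m A *m
      map_mx (fun n => n%:R) (vec k.+2 (n1 :: rcons l m))) 0 0 +
    ((map_mx (fun n => n%:R : rat) (vec k.+2 (n1 :: rcons l m)))^T *m b) 0 0 = E ->
  nahm_term tau A b (d_AvDv k.+2) (vec k.+2 (n1 :: rcons l m)) =
  qpow tau E * (iqpoch (qpow tau 1) (Posz n1) *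
    (\prod_(i <- l) iqpoch (qpow tau 1) (Posz i)) * iqpoch (qpow tau 2) (Posz m)).
Proof.
move=> lk <-; rewrite /nahm_term; congr (_ * _).
apply: inv_prod_entries => // i; rewrite !mxE eqSS.
by case: ifP.
Qed.

Lemma prod_iqpoch_bounded (q : C) : q != 0 -> `|q| < 1 ->
  exists2 b, 0 <= b & forall k l, size l = k ->
    `|\prod_(i <- l) iqpoch q (Posz i)| <= (b ^+ k)%:C.
Proof.
move=> q0 q1; have [b b0 qb] := iqpoch_bounded q0 q1.
exists b => [|k l <-]; first exact: ltW.
elim: l => [|i l IH] /=; first by rewrite big_nil normr1.
rewrite big_cons normrM exprS realCM.
exact: ler_pM (normr_ge0 _) (normr_ge0 _) (qb _) IH.
Qed.

(** An exponent growing at least linearly in the variables dominates the term by a geometric one.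
    The constant -1 absorbs the negative last entries of the vectors b for BD. *)
Lemma nahm_term_bound (tau : R[i]) (Q q : C) k : 0 < complex.Im tau ->
    Q != 0 -> `|Q| < 1 -> q != 0 -> `|q| < 1 ->
  exists2 c, 0 <= c & forall n1 l m E, size l = k ->
    (n1 + sumn l + m)%:R / 2 - 1 <= E ->
    `|qpow tau E * (iqpoch Q (Posz n1) * (\prod_(i <- l) iqpoch Q (Posz i)) *
       iqpoch q (Posz m))| <=
    (c * complex.Re `|qpow tau 2^-1| ^+ (n1 + sumn l + m))%:C.
Proof.
move=> tau0 Q0 Q1 q0 q1.
have [b b0 Qb] := iqpoch_bounded Q0 Q1; have [d d0 qd] := iqpoch_bounded q0 q1.
have [e e0 Qe] := prod_iqpoch_bounded Q0 Q1.
exists (complex.Re `|qpow tau (-1)| * (b * e ^+ k * d)).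
  rewrite !mulr_ge0 ?exprn_ge0 ?(ltW b0) ?(ltW d0) //.
  by rewrite -lecR realC_norm; exact: normr_ge0.
move=> n1 l m E lk lE.
rewrite [X in X%:C]mulrAC realCM (normrM (qpow tau E)).
have h1 : `|qpow tau E| <=
    (complex.Re `|qpow tau (-1)| * complex.Re `|qpow tau 2^-1| ^+ (n1 + sumn l + m))%:C.
  apply: le_trans (ler_norm_qpow tau0 lE) _.
  rewrite mulrC addrC qpowD qpowMn normrM normrX realCM realCX.
  by rewrite !realC_norm.
have h2 : `|iqpoch Q (Posz n1) * (\prod_(i <- l) iqpoch Q (Posz i)) * iqpoch q (Posz m)| <=
    (b * e ^+ k * d)%:C.
  rewrite !realCM (normrM (_ * _)) (normrM (iqpoch _ _)).
  apply: ler_pM (mulr_ge0 (normr_ge0 _) (normr_ge0 _)) (normr_ge0 _) _ (qd _).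
  exact: ler_pM (normr_ge0 _) (normr_ge0 _) (Qb _) (Qe _ _ lk).
exact: ler_pM (normr_ge0 _) (normr_ge0 _) h1 h2.
Qed.

End NahmTerm.

(** * Exponents and their lower bounds *)

Section Energies.

(* de = 0, 1/2 give AD and BD; (be, h) = (0, 0), (1, 0), (0, -1/2), (1, -1) give the
   four kinds of vectors b, with j = r when be = 0. *)
Definition AD_shift (de : rat) (r i j : nat) : rat :=
  if (i == r) && (j == r) then r%:R - 1 + de else AD_entry r i j.

Definition b_shift (be h : rat) (r j i : nat) : rat :=
  if i == 1%N then be else if i == r then r%:R - j%:R + h else 2 * (i - j)%N%:R.

Definition AD_energy k j (de be h : rat) n1 (l : seq nat) m : rat :=
  let S s := (sumn (drop s l))%:R + m%:R / 2 in
  n1%:R * n1%:R + n1%:R * m%:R + be * n1%:R +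
  2 * (\sum_(s < k.+1) S s * S s + \sum_(s < k.+1) (if (j <= s.+1)%N then 1 else 0) * S s) +
  2^-1 * de * m%:R * m%:R + h * m%:R.

Lemma AD_shift_exponent k n1 l m j de be h :
    size l = k -> (0 < j <= k.+2)%N ->
  2^-1 * ((map_mx (fun n => n%:R : rat) (vec k.+2 (n1 :: rcons l m)))^T *m
     mx_of_entries k.+2 (AD_shift de k.+2) *m
       map_mx (fun n => n%:R) (vec k.+2 (n1 :: rcons l m))) 0 0 +
  ((map_mx (fun n => n%:R : rat) (vec k.+2 (n1 :: rcons l m)))^T *m
     col_of_entries k.+2 (b_shift be h k.+2 j)) 0 0 =
  AD_energy k j de be h n1 l m.
Proof.
move=> lk /andP[j0 jk].
(* Halving the last variable m makes the last row and column follow the pattern 4 (min(i, j) - 1),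
   as 2 (i-1) m = 4 (i-1) (m/2) and (r-1) m^2 = 4 (r-1) (m/2)^2; only the addition [de] of BD stays
   outside. *)
rewrite (@nahm_exponent k _ _ j n1 l m 2 4 de be 2 h (m%:R / 2)) //.
- by rewrite /AD_energy; move: (\sum_(s < k.+1) _) (\sum_(s < k.+1) _) => *; field.
- move=> i ik; rewrite /AD_shift /AD_entry /= !eqSS !andbF /=.
  by case: ifP.
- move=> i i' ik ik'; rewrite /AD_shift /AD_entry /= !eqSS.
  case: (eqVneq i k) => [->|ni]; case: (eqVneq i' k) => [->|ni'] /=.
  + by rewrite minnn -!natr1; field.
  + by rewrite (_ : minn k i' = i') -?natr1; [field | lia].
  + by rewrite (_ : minn i k = i) -?natr1; [field | lia].
  + by rewrite !minnSS -!natr1; field.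
- move=> i ik; rewrite /b_shift /= !eqSS.
  case: (eqVneq i k) => [->|ni] /=; last by ring.
  by rewrite (natrB _ jk); field.
Qed.

Definition AvDv_energy k j (be : rat) n1 (l : seq nat) m : rat :=
  let S s := (sumn (drop s l))%:R + m%:R in
  2^-1 * n1%:R * n1%:R + n1%:R * m%:R + be * n1%:R +
  (\sum_(s < k.+1) S s * S s + \sum_(s < k.+1) (if (j <= s.+1)%N then 1 else 0) * S s).

Lemma AvDv_exponent k n1 l m j be g :
    size l = k -> (0 < j)%N -> g 1%N = be -> (forall i, g i.+2 = (i.+2 - j)%N%:R) ->
  2^-1 * ((map_mx (fun n => n%:R : rat) (vec k.+2 (n1 :: rcons l m)))^T *m
     AvDv k.+2 *m map_mx (fun n => n%:R) (vec k.+2 (n1 :: rcons l m))) 0 0 +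
  ((map_mx (fun n => n%:R : rat) (vec k.+2 (n1 :: rcons l m)))^T *m
     col_of_entries k.+2 g) 0 0 =
  AvDv_energy k j be n1 l m.
Proof.
move=> lk j0 g1 gS.
rewrite (@nahm_exponent k _ _ j n1 l m 1 2 0 be 1 0 m%:R) //.
- by rewrite /AvDv_energy; move: (\sum_(s < k.+1) _) (\sum_(s < k.+1) _) => *; field.
- by move=> i ik; rewrite /= !eqSS; case: ifP.
- move=> i i' ik ik'; rewrite /= minnSS minnSS -!natr1.
  by case: (i == k); case: (i' == k) => /=; field.
- by move=> i ik; rewrite gS; case: eqP => _; field.
Qed.

Lemma nth_nseq_cat i l a b s : (s < i + l)%N ->
  nth 0%N (nseq i a ++ nseq l b) s = if (i <= s)%N then b else a.
Proof.
move=> sil; rewrite nth_cat size_nseq !nth_nseq ltnNge.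
by case: (leqP i s) => //= h; case: ltnP => //; lia.
Qed.

(** For S = M + e with 2e = a, S^2 = M^2 + a M + e^2 and S^2 + S = M^2 + (a+1) M + e^2 + e. Hence e
    = 0 gives steps with s in {0, 1}, while e = 1/2, the case of odd n_r, gives s in {1, 2} and a
    constant. *)
Lemma wexp_nseq (a b i l m : nat) (n : seq nat) (e : rat)
    (S := fun s => (sumn (drop s n))%:R + m%:R + e) :
    2 * e = a%:R -> b = a.+1 ->
  \sum_(s < i + l) S s * S s + \sum_(s < i + l) (if (i < s.+1)%N then 1 else 0) * S s =
  (wexp (nseq i a ++ nseq l b) n m)%:R + e * e * (i + l)%:R + e * l%:R.
Proof.
move=> ea ->; rewrite /wexp size_cat !size_nseq natr_sum -addrA.
have -> : e * e * (i + l)%:R + e * l%:R =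
    \sum_(s < i + l) (e * e + (if (i <= s < i + l)%N then e else 0)).
  rewrite big_split /= sum_interval minnn addKn sumr_const card_ord mulr_natr.
  by rewrite [e * l%:R]mulrC.
rewrite -!big_split; apply: eq_bigr => s _ /=.
rewrite nth_nseq_cat // ltn_ord andbT ltnS /S natrD !natrM natrD.
case: leqP => _; last by rewrite -ea; ring.
by rewrite -natr1 -ea; ring.
Qed.

Lemma half_le_sqr (x : rat) n : x = n%:R / 2 -> x / 2 <= x * x.
Proof.
move=> ->; have : (n * 1 <= n * n)%N by rewrite leq_mul2l; case: n.
by rewrite -(ler_nat rat) !natrM; lra.
Qed.

(** In the applications S_0 collects all variables but n_1, with n_r possibly halved. Being a
    half-integer, it satisfies S_0^2 >= S_0 / 2, and the other terms are nonnegative. *)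
Lemma tail_sums_ge k n j (S : nat -> rat) : S 0%N = n%:R / 2 -> (forall s, 0 <= S s) ->
  n%:R / 4 <= \sum_(s < k.+1) S s * S s + \sum_(s < k.+1) (if (j <= s.+1)%N then 1 else 0) * S s.
Proof.
move=> S0 Sge; have := half_le_sqr S0.
have : 0 <= \sum_(s < k) S (bump 0 s) * S (bump 0 s).
  by apply: sumr_ge0 => s _; rewrite mulr_ge0.
have : 0 <= \sum_(s < k.+1) (if (j <= s.+1)%N then 1 else 0) * S s.
  by apply: sumr_ge0 => s _; case: ifP => _; rewrite ?mul1r ?mul0r.
by rewrite [X in _ <= X + _]big_ord_recl /= S0; lra.
Qed.

Lemma AD_energy_ge k j de be h n1 l m : 0 <= be ->
    (forall m, -1 <= 2^-1 * de * m%:R * m%:R + h * m%:R) ->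
  (n1 + sumn l + m)%:R / 2 - 1 <= AD_energy k j de be h n1 l m.
Proof.
move=> be0 deh; rewrite /AD_energy /=.
have := @tail_sums_ge k ((sumn l).*2 + m) j (fun s => (sumn (drop s l))%:R + m%:R / 2).
rewrite drop0 natrD -muln2 natrM mulrDl mulfK // => /(_ erefl).
have S0 s : 0 <= (sumn (drop s l))%:R + m%:R / 2 :> rat.
  by rewrite addr_ge0 ?ler0n // divr_ge0 // ler0n.
move=> /(_ S0); have := ler0n rat (sumn l).
have := @half_le_sqr n1%:R n1.*2; rewrite -muln2 natrM mulfK // => /(_ erefl).
have : 0 <= n1%:R * m%:R + be * n1%:R :> rat by rewrite addr_ge0 ?mulr_ge0 ?ler0n.
move: (deh m); rewrite !natrD.
move: (\sum_(s < k.+1) _) (\sum_(s < k.+1) _) => s1 s2.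
by lra.
Qed.

Lemma AD_energy_even k i l de be h n1 ll m : (i + l)%N = k.+1 ->
  AD_energy k i.+1 de be h n1 ll m.*2 =
  (1 + be) * n1%:R + 2 * ('C(n1, 2) + m * n1)%:R +
  2 * (wexp (nseq i 0%N ++ nseq l 1%N) ll m)%:R + (2 * de * m%:R * m%:R + 2 * h * m%:R).
Proof.
move=> il; have we := @wexp_nseq 0 1 i l m ll 0 (mulr0 _) erefl.
have -> : AD_energy k i.+1 de be h n1 ll m.*2 =
    n1%:R * n1%:R + n1%:R * m.*2%:R + be * n1%:R +
    2 * (wexp (nseq i 0%N ++ nseq l 1%N) ll m)%:R +
    2^-1 * de * m.*2%:R * m.*2%:R + h * m.*2%:R.
  move: we; rewrite !mul0r !addr0 /AD_energy /= il => <-.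
  by congr (_ + 2 * (_ + _) + _ + _); apply: eq_bigr => s _;
    rewrite -muln2 natrM mulfK // addr0.
rewrite -muln2 natrM -natrM -(bin2_sqr n1) !natrD !natrM.
by field.
Qed.

(** The constant is 2 (e^2 (k+1) + e l) at e = 1/2, plus de/2 + h, and becomes the power of q before
    the second product. Compared with even n_r, the product n_1 n_r contributes one more n_1, so y =
    - q^(1+be) turns into - q^(2+be). *)
Lemma AD_energy_odd k i l de be h n1 ll m : (i + l)%N = k.+1 ->
  AD_energy k i.+1 de be h n1 ll m.*2.+1 =
  k.+1%:R / 2 + l%:R + de / 2 + h + ((2 + be) * n1%:R + 2 * ('C(n1, 2) + m * n1)%:R +
  2 * (wexp (nseq i 1%N ++ nseq l 2%N) ll m)%:R +
  (2 * de * (m%:R * m%:R + m%:R) + 2 * h * m%:R)).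
Proof.
move=> il; have := @wexp_nseq 1 2 i l m ll 2^-1 (mulfV _) erefl.
rewrite il => /(_ isT) we.
have -> : AD_energy k i.+1 de be h n1 ll m.*2.+1 =
    n1%:R * n1%:R + n1%:R * m.*2.+1%:R + be * n1%:R +
    2 * ((wexp (nseq i 1%N ++ nseq l 2%N) ll m)%:R + 2^-1 * 2^-1 * k.+1%:R + 2^-1 * l%:R) +
    2^-1 * de * m.*2.+1%:R * m.*2.+1%:R + h * m.*2.+1%:R.
  rewrite -we /AD_energy /=.
  have hS s : (sumn (drop s ll))%:R + m.*2.+1%:R / 2 = (sumn (drop s ll))%:R + m%:R + 2^-1 :> rat.
    by rewrite -natr1 -muln2 natrM; field.
  by congr (_ + 2 * (_ + _) + _ + _); apply: eq_bigr => s _; rewrite hS.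
rewrite -[m.*2.+1%:R]natr1 -muln2 -[n1%:R * n1%:R]natrM -(bin2_sqr n1) !natrD !natrM.
by field.
Qed.

Lemma AvDv_energy_ge k j be n1 l m : 0 <= be ->
  (n1 + sumn l + m)%:R / 2 - 1 <= AvDv_energy k j be n1 l m.
Proof.
move=> be0; rewrite /AvDv_energy /=.
have := @tail_sums_ge k ((sumn l).*2 + m.*2) j (fun s => (sumn (drop s l))%:R + m%:R).
rewrite drop0 natrD -!muln2 !natrM mulrDl !mulfK // => /(_ erefl).
have S0 s : 0 <= (sumn (drop s l))%:R + m%:R :> rat by rewrite addr_ge0 ?ler0n.
move=> /(_ S0); have := ler0n rat (sumn l); have := ler0n rat m.
have : n1%:R <= n1%:R * n1%:R :> rat.
  by rewrite -natrM ler_nat; case: n1 => // n; rewrite leq_pmulr.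
have : 0 <= n1%:R * m%:R + be * n1%:R :> rat by rewrite addr_ge0 ?mulr_ge0 ?ler0n.
rewrite !natrD.
move: (\sum_(s < k.+1) _) (\sum_(s < k.+1) _) => s1 s2.
by lra.
Qed.

(** Half-integral powers of q enter through n_1^2/2 = n_1(n_1-1)/2 + n_1/2. *)
Lemma AvDv_energy_wexp k i l be n1 ll m : (i + l)%N = k.+1 ->
  AvDv_energy k i.+1 be n1 ll m =
  (2^-1 + be) * n1%:R + 1 * ('C(n1, 2) + m * n1)%:R +
  1 * (wexp (nseq i 0%N ++ nseq l 1%N) ll m)%:R + 0.
Proof.
move=> il; have we := @wexp_nseq 0 1 i l m ll 0 (mulr0 _) erefl.
have -> : AvDv_energy k i.+1 be n1 ll m =
    2^-1 * (n1%:R * n1%:R) + n1%:R * m%:R + be * n1%:R +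
    (wexp (nseq i 0%N ++ nseq l 1%N) ll m)%:R.
  move: we; rewrite !mul0r !addr0 /AvDv_energy /= il => <-.
  by rewrite mulrA; congr (_ + (_ + _)); apply: eq_bigr => s _; rewrite addr0.
rewrite -[n1%:R * n1%:R]natrM -(bin2_sqr n1) !natrD !natrM.
by field.
Qed.

End Energies.

(** * Nahm sums from given Bailey chains *)

Section NahmSums.
Variable R : realType.
Local Notation C := (R[i] : numFieldType).
Local Notation "x %:C" := (real_complex R x) : ring_scope.
Variable tau : R[i].

Lemma summand_qpow x c d E (y Q P F : C) ws (b : nat -> C) n1 l m :
    qpow tau c = Q -> y = - qpow tau x ->
    P = \prod_(i <- l) iqpoch Q (Posz i) -> b m = qpow tau d * F ->
    E = x * n1%:R + c * ('C(n1, 2) + m * n1)%:R + c * (wexp ws l m)%:R + d ->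
  qpow tau E * (iqpoch Q (Posz n1) * P * F) = summand Q y ws b n1 l m.
Proof.
have alg (K : numFieldType) (a q1 w i d' p f : K) :
    a * q1 * w * d' * (i * p * f) = a * q1 * i * (w * p * (d' * f)) by ring.
move=> <- -> -> bm ->; rewrite /summand opprK bm !qpowD !qpowMn.
exact: alg.
Qed.

Lemma summandZ (K : numFieldType) (q y c : K) ws b n1 l m :
  summand q y ws (fun m => c * b m) n1 l m = c * summand q y ws b n1 l m.
Proof. by rewrite /summand; ring. Qed.

Lemma nseq_cat_cons i l k (a b : nat) : (i + l)%N = k.+1 ->
  exists s ws, nseq i a ++ nseq l b = s :: ws /\ size ws = k.
Proof.
move=> il; have : size (nseq i a ++ nseq l b) = k.+1 by rewrite size_cat !size_nseq.
by case: (_ ++ _) => // s ws [sz]; exists s, ws.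
Qed.

Lemma qpoch_opp_sqr_neq0 (K : numFieldType) (q : K) n m :
  nonroot q -> qpoch (- q ^+ n.+1) (q ^+ 2) m != 0.
Proof.
move=> nq; rewrite /qpoch big_mkord; apply/prodf_neq0 => a _.
by rewrite mulNr opprK -exprM -exprD; exact: nonroot_addX.
Qed.

Lemma mulf_divl (K : numFieldType) (u v : K) : u != 0 -> u * v / u = v.
Proof. by move=> u0; rewrite mulrAC mulfV ?mul1r. Qed.

Hypothesis tau_gt0 : 0 < complex.Im tau.

Lemma norm_qpow_half : 0 <= complex.Re `|qpow tau 2^-1| < 1.
Proof. by apply: norm_lt1_Re; apply: norm_qpow_lt1. Qed.

(** Here i = j - 1 and l = r - j, and p is given as a product z * w so that w = p/z. The constant
    [ka] relates the odd beta to its seed: it will be 1 for be = 0, and 1 + q for be = 1, where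
    Euler's factor starts at - q^3 but the seed at - q. *)
Lemma has_sum_AD_shift k i l (de h : rat) be (z0 w0 z1 w1 ka S : C)
    rho0 sigma0 rho1 sigma1 (beta0 beta1 : nat -> C)
    (q := qpow tau 1) (y0 := - q ^+ be.+1) (y1 := - q ^+ be.+2) :
    (i + l)%N = k.+1 ->
    (forall m, -1 <= 2^-1 * de * m%:R * m%:R + h * m%:R) ->
    [/\ z0 != 0, w0 != 0, `|z0| < 1 & `|w0| < 1] ->
    [/\ z1 != 0, w1 != 0, `|z1| < 1 & `|w1| < 1] ->
    (forall m, beta0 m * qpoch y0 (q ^+ 2) m =
       qpow tau (2 * de * m%:R * m%:R + 2 * h * m%:R) * iqpoch q (Posz m.*2)) ->
    (forall m, ka * (beta1 m * qpoch y1 (q ^+ 2) m) =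
       qpow tau (2 * de * (m%:R * m%:R + m%:R) + 2 * h * m%:R) * iqpoch q (Posz m.*2.+1)) ->
    bailey_pair (q ^+ 2) rho0 sigma0 z0 (z0 * w0)
      (foldr (step (q ^+ 2)) beta0 (nseq i 0%N ++ nseq l 1%N)) ->
    bailey_pair (q ^+ 2) rho1 sigma1 z1 (z1 * w1)
      (foldr (step (q ^+ 2)) beta1 (nseq i 1%N ++ nseq l 2%N)) ->
    S = qpoch_inf y0 (q ^+ 2) / qpoch_inf (q ^+ 2) (q ^+ 2) *
          qpochs_inf [:: z0; w0; z0 * w0] (z0 * w0) +
        qpow tau (k.+1%:R / 2 + l%:R + de / 2 + h) *
          (ka * (qpoch_inf y1 (q ^+ 2) / qpoch_inf (q ^+ 2) (q ^+ 2) *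
           qpochs_inf [:: z1; w1; z1 * w1] (z1 * w1))) ->
  has_sum (nahm_term tau (mx_of_entries k.+2 (AD_shift de k.+2))
    (col_of_entries k.+2 (b_shift be%:R h k.+2 i.+1)) (d_AD k.+2)) S.
Proof.
move=> il deh [z00 w00 z0l w0l] [z10 w10 z1l w1l] b0E b1E bp0 bp1 SE.
have q0 : q != 0 := qpow_neq0 tau 1.
have q1 : `|q| < 1 := norm_qpow_lt1 tau_gt0 ltr01.
have nq := nonroot_norm_lt1 q0 q1.
have q2E : qpow tau 2 = q ^+ 2 by rewrite -qpowMn mul1r.
have q20 : q ^+ 2 != 0 by rewrite expf_neq0.
have q21 : `|q ^+ 2| < 1 by rewrite -q2E; exact: norm_qpow_lt1.
have yE b : - q ^+ b = - qpow tau b%:R by rewrite -qpowMn mul1r.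
have [c c0 bd] := nahm_term_bound k tau_gt0 q20 q21 q0 q1.
have jk : (0 < i.+1 <= k.+2)%N by rewrite /= ltnS -il leq_addr.
have termE n1 ll m (lk : size ll = k) := nahm_term_d_AD tau lk
  (AD_shift_exponent n1 m de be%:R h lk jk).
have [s0 [ws0 [ws0E sz0]]] := nseq_cat_cons 0 1 il.
have [s1 [ws1 [ws1E sz1]]] := nseq_cat_cons 1 2 il.
rewrite q2E in termE; rewrite ws0E in bp0; rewrite ws1E in bp1.
have nz0 : [/\ y0 != 0, z0 != 0, z0 * w0 != 0, `|z0| < 1 & `|z0 * w0 / z0| < 1].
  split; [by rewrite oppr_eq0 expf_neq0 | exact: z00 | exact: mulf_neq0 | exact: z0l |].
  by rewrite (mulf_divl _ z00).
have nz1 : [/\ y1 != 0, z1 != 0, z1 * w1 != 0, `|z1| < 1 & `|z1 * w1 / z1| < 1].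
  split; [by rewrite oppr_eq0 expf_neq0 | exact: z10 | exact: mulf_neq0 | exact: z1l |].
  by rewrite (mulf_divl _ z10).
have p0 m : qpoch y0 (q ^+ 2) m != 0 by exact: qpoch_opp_sqr_neq0.
have p1 m : qpoch y1 (q ^+ 2) m != 0 by exact: qpoch_opp_sqr_neq0.
have fK y beta : (forall m, qpoch y (q ^+ 2) m != 0) ->
    (fun m => beta m * qpoch y (q ^+ 2) m / qpoch y (q ^+ 2) m) = beta.
  by move=> yp; apply/funext => m; exact: mulfK.
apply: (@has_sum_nahm_parity R k _ (q ^+ 2)
  (qpow tau (k.+1%:R / 2 + l%:R + de / 2 + h) * ka) S y0 z0 (z0 * w0) y1 z1 (z1 * w1)
  s0 ws0 rho0 sigma0 s1 ws1 rho1 sigma1 (fun m => beta0 m * qpoch y0 (q ^+ 2) m)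
  (fun m => beta1 m * qpoch y1 (q ^+ 2) m) c (complex.Re `|qpow tau 2^-1|)
  q20 q21 sz0 sz1 nz0 nz1 p0 p1 c0 norm_qpow_half).
- move=> n1 ll m lk; rewrite (termE _ _ _ lk); apply: bd lk _.
  by apply: AD_energy_ge (ler0n _ _) _.
- move=> n1 ll m lk; rewrite (termE _ _ _ lk) -ws0E.
  apply: summand_qpow q2E (yE _) erefl (b0E m) _.
  by rewrite (AD_energy_even _ _ _ _ _ _ il) nat1r.
- move=> n1 ll m lk; rewrite (termE _ _ _ lk) (AD_energy_odd _ _ _ _ _ _ il) qpowD -mulrA -ws1E.
  rewrite -[RHS]mulrA -summandZ; congr (_ * _); apply: summand_qpow q2E (yE _) erefl (b1E m) _.
  by rewrite -natrD.
- by rewrite fK.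
- by rewrite fK.
- by rewrite (mulf_divl _ z00) (mulf_divl _ z10) SE; congr (_ + _); exact: mulrA.
Qed.

Lemma has_sum_AvDv k i l be g (z w ka S : C) rho sigma (beta : nat -> C)
    (q := qpow tau 1) (y := - qpow tau (2^-1 + be)) :
    (i + l)%N = k.+1 -> 0 <= be -> g 1%N = be -> (forall s, g s.+2 = (s.+2 - i.+1)%N%:R) ->
    [/\ z != 0, w != 0, `|z| < 1 & `|w| < 1] -> (forall m, qpoch y q m != 0) ->
    (forall m, ka * (beta m * qpoch y q m) = iqpoch (q ^+ 2) (Posz m)) ->
    bailey_pair q rho sigma z (z * w)
      (foldr (step q) beta (nseq i 0%N ++ nseq l 1%N)) ->
    S = ka * (qpoch_inf y q / qpoch_inf q q * qpochs_inf [:: z; w; z * w] (z * w)) ->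
  has_sum (nahm_term tau (AvDv k.+2) (col_of_entries k.+2 g) (d_AvDv k.+2)) S.
Proof.
move=> il be0 g1 gS [z0 w0 zl wl] py bE bp SE.
have q0 : q != 0 := qpow_neq0 tau 1.
have q1 : `|q| < 1 := norm_qpow_lt1 tau_gt0 ltr01.
have q2E : qpow tau 2 = q ^+ 2 by rewrite -qpowMn mul1r.
have q20 : q ^+ 2 != 0 by rewrite expf_neq0.
have q21 : `|q ^+ 2| < 1 by rewrite -q2E; exact: norm_qpow_lt1.
have [c c0 bd] := nahm_term_bound k tau_gt0 q0 q1 q20 q21.
have termE n1 ll m (lk : size ll = k) := nahm_term_d_AvDv tau lk
  (AvDv_exponent n1 m lk (ltn0Sn i) g1 gS).
have [s [ws [wsE sz]]] := nseq_cat_cons 0 1 il.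
rewrite q2E in termE; rewrite wsE in bp.
have y0 : y != 0 by rewrite oppr_eq0; exact: qpow_neq0.
have zw1 : `|z * w / z| < 1 by rewrite (mulf_divl _ z0).
have bE' m : ka * (beta m * qpoch y q m) = qpow tau 0 * iqpoch (q ^+ 2) (Posz m).
  by rewrite qpow0 mul1r; exact: bE.
pose t v := nahm_term tau (AvDv k.+2) (col_of_entries k.+2 g) (d_AvDv k.+2) v.
have tE n1 ll m : size ll = k -> t (vec k.+2 (n1 :: rcons ll m)) =
    ka * summand q y (s :: ws) (fun m => beta m * qpoch y q m) n1 ll m.
  move=> lk; rewrite -summandZ /t (termE _ _ _ lk) -wsE.
  apply: summand_qpow erefl erefl erefl (bE' m) _.
  exact: AvDv_energy_wexp il.
apply: (@has_sum_nahm_single R k _ q y z (z * w) ka S s ws rho sigma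
  (fun m => beta m * qpoch y q m) c (complex.Re `|qpow tau 2^-1|)
  q0 q1 sz y0 py z0 (mulf_neq0 z0 w0) zl zw1 c0 norm_qpow_half _ tE).
- move=> n1 ll m lk; rewrite /t (termE _ _ _ lk); apply: bd lk _.
  exact: AvDv_energy_ge.
- have -> : (fun m => beta m * qpoch y q m / qpoch y q m) = beta.
    by apply/funext => m; exact: mulfK.
  by [].
- by rewrite (mulf_divl _ z0).
Qed.

End NahmSums.

(** * Evaluation of the six families *)

Section Betas.
Variables (K : numFieldType) (q : K).
Hypothesis nq : nonroot q.

Lemma nonroot_opp : nonroot (- q).
Proof.
have [q0 q1] := nq; split=> [|n]; first by rewrite oppr_eq0.
rewrite exprNn -signr_odd; case: odd; last by rewrite mul1r.
by rewrite mulNr mul1r opprK nonroot_addX.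
Qed.

Lemma iqpoch_double m : (qpoch q (q ^+ 2) m * qpoch (q ^+ 2) (q ^+ 2) m)^-1 = iqpoch q (Posz m.*2).
Proof. by rewrite /iqpoch qpoch_double -expr2. Qed.

Lemma iqpoch_doubleS m :
  (qpoch q (q ^+ 2) m.+1 * qpoch (q ^+ 2) (q ^+ 2) m)^-1 = iqpoch q (Posz m.*2.+1).
Proof.
by rewrite /iqpoch !qpochS qpoch_double -!exprM mul2n -expr2 [LHS](congr1 _ (mulrAC _ _ _)).
Qed.

Lemma mul_inv_cancel (x u y : K) : x != 0 -> u = x * y -> u^-1 * x = y^-1.
Proof.
move=> x0 ->; have [->|y0] := eqVneq y 0; first by rewrite mulr0 invr0 mul0r.
by rewrite invfM mulrAC mulVf // mul1r.
Qed.

(** A seed's beta times Euler's (y)_m has to return the factor of n_r. Here half of (q^2; q^4)_m =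
    (q; q^2)_m (-q; q^2)_m cancels; in the next two lemmas it is half of (q^4; q^4)_m = (q^2; q^2)_m
    (-q^2; q^2)_m. *)
Lemma den2_even m :
  (den2 (q ^+ 2) m m)^-1 * qpoch (- q ^+ 1) (q ^+ 2) m = iqpoch q (Posz m.*2).
Proof.
rewrite -iqpoch_double; apply: mul_inv_cancel; first exact: qpoch_opp_sqr_neq0.
by rewrite /den2 qpoch_sqr expr1; ring.
Qed.

Lemma den1_odd m :
  (den1 (- q) m.+1 m)^-1 * qpoch (- q ^+ 2) (q ^+ 2) m = iqpoch q (Posz m.*2.+1).
Proof.
rewrite -iqpoch_doubleS; apply: mul_inv_cancel; first exact: qpoch_opp_sqr_neq0.
rewrite /den1 opprK sqrrN (_ : (- q) ^+ 4 = (q ^+ 2) ^+ 2); last by ring.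
by rewrite qpoch_sqr; ring.
Qed.

Lemma den1_even m :
  (den1 (- q) m m)^-1 * qpoch (- q ^+ 2) (q ^+ 2) m = iqpoch q (Posz m.*2).
Proof.
rewrite -iqpoch_double; apply: mul_inv_cancel; first exact: qpoch_opp_sqr_neq0.
rewrite /den1 opprK sqrrN (_ : (- q) ^+ 4 = (q ^+ 2) ^+ 2); last by ring.
by rewrite qpoch_sqr; ring.
Qed.

Lemma qpochSl (a p : K) n : qpoch a p n.+1 = (1 - a) * qpoch (a * p) p n.
Proof.
elim: n => [|n IH]; first by rewrite qpochS !qpoch0 expr0 !mulr1 mul1r.
by rewrite qpochS IH !qpochS exprS; ring.
Qed.

Lemma den2_odd m : (1 + q) * ((den2 (q ^+ 2) m.+1 m)^-1 * qpoch (- q ^+ 3) (q ^+ 2) m) =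
  iqpoch q (Posz m.*2.+1).
Proof.
rewrite -iqpoch_doubleS mulrCA; apply: mul_inv_cancel.
  by rewrite mulf_neq0 ?qpoch_opp_sqr_neq0 // -[q]expr1 nonroot_addX.
rewrite /den2 qpoch_sqr (qpochSl (- q)).
rewrite (_ : - q * q ^+ 2 = - q ^+ 3); last by ring.
by ring.
Qed.

(** The variable q plays the part of q^(1/2): Euler's factor cancels the first half of [den1], and
    the other half is the factor (q^2; q^2)_(n_r) of AvDv. *)
Lemma den1_single m :
  1 * ((den1 q m m)^-1 * qpoch (- q) (q ^+ 2) m) = iqpoch (q ^+ 4) (Posz m).
Proof.
rewrite mul1r; apply: mul_inv_cancel; first by rewrite -[q in - q]expr1 qpoch_opp_sqr_neq0.
by [].
Qed.

Lemma den1_singleS m :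
  (1 + q) * ((den1 q m.+1 m)^-1 * qpoch (- q ^+ 3) (q ^+ 2) m) = iqpoch (q ^+ 4) (Posz m).
Proof.
rewrite mulrCA; apply: mul_inv_cancel.
  by rewrite mulf_neq0 ?qpoch_opp_sqr_neq0 // -[q]expr1 nonroot_addX.
rewrite /den1 qpochSl (_ : - q * q ^+ 2 = - q ^+ 3); last by ring.
by ring.
Qed.

Lemma qpoch_infS (a p : K) : cvg_qpochs K -> `|p| < 1 ->
  qpoch_inf a p = (1 - a) * qpoch_inf (a * p) p.
Proof.
move=> qcvg p1; have := qcvg a p p1; rewrite -cvg_shiftS /= => h.
apply: (cvgn_unique h); under eq_fun do rewrite qpochSl.
by apply: cvgn_scale; exact: qcvg.
Qed.

Lemma eq_bailey_pair Q rho s (z z' p p' : K) b :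
  bailey_pair Q rho s z p b -> z' = z -> p' = p -> bailey_pair Q rho s z' p' b.
Proof. by move=> h -> ->. Qed.

Lemma nonroot_sqr : nonroot (q ^+ 2).
Proof. exact: nonroot_X. Qed.

Lemma exprN3 (x : K) : (- x) ^+ 3 = - x ^+ 3.
Proof. by ring. Qed.

Lemma bailey_c k :
  bailey_pair (q ^+ 2) 2 0 (q ^+ (8 * k + 12)) (q ^+ (8 * k + 12 + (8 * k + 16)))
    (foldr (step (q ^+ 2)) (fun m => (den2 (q ^+ 2) m m)^-1) (nseq k.+1 0%N ++ nseq 0 1%N)).
Proof.
rewrite cats0; apply: eq_bailey_pair (bailey_chain k.+1 nonroot_sqr _ (seed_c nonroot_sqr)) _ _ => //.
  by rewrite -!exprM -exprD; congr (_ ^+ _); lia.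
by rewrite -!exprM -exprD; congr (_ ^+ _); lia.
Qed.

Lemma bailey_e k :
  bailey_pair (q ^+ 2) 2 0 (q ^+ (8 * k + 8)) (q ^+ (8 * k + 8 + (8 * k + 12)))
    (foldr (step (q ^+ 2)) (fun m => (q ^+ 2) ^+ 'C(m, 2) / den2 (q ^+ 2) m m)
      (nseq k.+1 0%N ++ nseq 0 1%N)).
Proof.
rewrite cats0; apply: eq_bailey_pair (bailey_chain k.+1 nonroot_sqr _ (seed_e nonroot_sqr)) _ _ => //.
  by rewrite mul1r -!exprM; congr (_ ^+ _); lia.
by rewrite -!exprM -exprD; congr (_ ^+ _); lia.
Qed.

(** Taking T = -q, whose square is still the base q^2, turns the odd power p into a negative one:
    this is the origin of bases such as - q^(4r-1) in the theorem. *)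
Lemma bailey_b k :
  bailey_pair (q ^+ 2) 1 1 (q ^+ (4 * k + 6)) (- q ^+ (4 * k + 6 + 1))
    (foldr (step (q ^+ 2)) (fun m => (den1 (- q) m.+1 m)^-1) (nseq k.+1 1%N ++ nseq 0 2%N)).
Proof.
have := seed_b nonroot_opp; rewrite sqrrN => h.
rewrite cats0; apply: eq_bailey_pair (bailey_chain k.+1 nonroot_sqr _ h) _ _ => //.
  by rewrite -!exprM -exprD; congr (_ ^+ _); lia.
by rewrite exprN3 mulNr -!exprM -exprD; congr (- _ ^+ _); lia.
Qed.

Lemma bailey_f k :
  bailey_pair (q ^+ 2) 1 1 (q ^+ (4 * k + 4)) (- q ^+ (4 * k + 4 + 1))
    (foldr (step (q ^+ 2)) (fun m => q ^+ (m * m) / den1 (- q) m.+1 m)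
      (nseq k.+1 1%N ++ nseq 0 2%N)).
Proof.
have := seed_f nonroot_opp; rewrite sqrrN opprK => h.
rewrite cats0; apply: eq_bailey_pair (bailey_chain k.+1 nonroot_sqr _ h) _ _ => //.
  by rewrite mul1r -!exprM; congr (_ ^+ _); lia.
by rewrite mulNr -!exprM -exprS; congr (- _ ^+ _); lia.
Qed.

Lemma bailey_a i l :
  bailey_pair (q ^+ 2) 1 0 (- q ^+ (4 * l + 2 * i + 1)) (- q ^+ (4 * l + 2 * i + 1 + (2 * i + 2)))
    (foldr (step (q ^+ 2)) (fun m => (den1 (- q) m m)^-1) (nseq i 0%N ++ nseq l 1%N)).
Proof.
have [q0 _] := nq; have := seed_a nonroot_opp; rewrite sqrrN => h.
apply: eq_bailey_pair (bailey_chain_shift l i nonroot_sqr _ _ h) _ _.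
- by rewrite oppr_eq0.
- by rewrite exprN3 mulNr -!exprM -exprS.
- by rewrite mulNr -!exprM -exprS; congr (- _ ^+ _); lia.
by rewrite exprN3 mulNr -!exprM -exprD; congr (- _ ^+ _); lia.
Qed.

(** The truncated subtraction of 1 reflects the seed parameter z = T^-1, and is genuine because the
    chain has at least one step. *)
Lemma bailey_g i l : (0 < i + l)%N ->
  bailey_pair (q ^+ 2) 1 0 (- q ^+ (4 * l + 2 * i - 1)) (- q ^+ (4 * l + 2 * i - 1 + (2 * i + 2)))
    (foldr (step (q ^+ 2)) (fun m => q ^+ (m * m) / (q ^+ m * q ^+ m) / den1 (- q) m m)
      (nseq i 0%N ++ nseq l 1%N)).
Proof.
move=> il; have [q0 _] := nq; have h := seed_g nonroot_opp; rewrite sqrrN opprK in h.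
have qq m : (- q) ^+ m * (- q) ^+ m = q ^+ m * q ^+ m by rewrite -!exprMn mulrNN.
have {}h : bailey_pair (q ^+ 2) 1 1 (- q^-1) (- q)
    (fun m => q ^+ (m * m) / (q ^+ m * q ^+ m) / den1 (- q) m m).
  rewrite -invrN (_ : (fun _ => _) = fun m =>
    q ^+ (m * m) / ((- q) ^+ m * (- q) ^+ m) / den1 (- q) m m) //.
  by apply/funext => m; rewrite qq.
apply: eq_bailey_pair (bailey_chain_shift l i nonroot_sqr _ _ h) _ _.
- by rewrite oppr_eq0 invr_eq0.
- by rewrite mulNr expr1 expr2 mulKf.
- rewrite mulNr -!exprM; congr (- _); apply: (mulfI q0).
  by rewrite mulVKf // -exprS; congr (_ ^+ _); lia.
by rewrite mulNr -!exprM -exprS; congr (- _ ^+ _); lia.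
Qed.

(** In base q^2 the seed contributes q^8 to z, each step with s = 2 contributes 2 (4 + 4) = 16 to
    the exponent, and each step with s = 1 contributes 2 (4 + 2) = 12. *)
Lemma bailey_d i l :
  bailey_pair (q ^+ 2) 2 1 (q ^+ (16 * l + 12 * i + 8))
    (q ^+ (16 * l + 12 * i + 8 + (4 * i + 4)))
    (foldr (step (q ^+ 2)) (fun m => (den2 (q ^+ 2) m.+1 m)^-1) (nseq i 1%N ++ nseq l 2%N)).
Proof.
have [q0 _] := nq.
apply: eq_bailey_pair (bailey_chain_shift l i nonroot_sqr _ _ (seed_d nonroot_sqr)) _ _.
- by rewrite !expf_neq0.
- by rewrite -exprD.
- by rewrite -!exprM -exprD; congr (_ ^+ _); lia.
by rewrite -!exprM -exprD; congr (_ ^+ _); lia.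
Qed.

Lemma bailey_h i l :
  bailey_pair (q ^+ 2) 2 1 (q ^+ (16 * l + 12 * i)) (q ^+ (16 * l + 12 * i + (4 * i + 4)))
    (foldr (step (q ^+ 2)) (fun m => (q ^+ 2) ^+ 'C(m, 2) / den2 (q ^+ 2) m.+1 m)
      (nseq i 1%N ++ nseq l 2%N)).
Proof.
apply: eq_bailey_pair (bailey_chain_shift l i nonroot_sqr _ _ (seed_h nonroot_sqr)) _ _.
- exact: oner_neq0.
- by rewrite mul1r.
- by rewrite mul1r -!exprM; congr (_ ^+ _); lia.
by rewrite -!exprM -exprD; congr (_ ^+ _); lia.
Qed.

Lemma bailey_single_a i l :
  bailey_pair (q ^+ 2) 1 0 (q ^+ (4 * l + 2 * i + 1)) (q ^+ (4 * l + 2 * i + 1 + (2 * i + 2)))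
    (foldr (step (q ^+ 2)) (fun m => (den1 q m m)^-1) (nseq i 0%N ++ nseq l 1%N)).
Proof.
have [q0 _] := nq.
apply: eq_bailey_pair (bailey_chain_shift l i nonroot_sqr _ _ (seed_a nq)) _ _ => //.
  by rewrite -!exprM -exprS; congr (_ ^+ _); lia.
by rewrite -!exprM -exprD; congr (_ ^+ _); lia.
Qed.

Lemma bailey_single_b k :
  bailey_pair (q ^+ 2) 1 1 (q ^+ (4 * k + 6)) (q ^+ (4 * k + 6 + 1))
    (foldr (step (q ^+ 2)) (fun m => (den1 q m.+1 m)^-1) (nseq 0 0%N ++ nseq k.+1 1%N)).
Proof.
apply: eq_bailey_pair (bailey_chain k.+1 nonroot_sqr _ (seed_b nq)) _ _ => //.
  by rewrite -!exprM -exprD; congr (_ ^+ _); lia.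
by rewrite -!exprM -exprD; congr (_ ^+ _); lia.
Qed.

Lemma qpochs_inf_swap (a b c p : K) : qpochs_inf [:: a; b; c] p = qpochs_inf [:: b; a; c] p.
Proof. by rewrite /qpochs_inf !big_cons big_nil mulrCA. Qed.

Lemma evaluation_even_odd (A B x : K) : cvg_qpochs K -> `|q| < 1 ->
    qpoch_inf (q ^+ 2) (q ^+ 2) != 0 ->
  A / qpochs_inf [:: q; q ^+ 3; q ^+ 4] (q ^+ 4) +
    x * (B / qpochs_inf [:: q ^+ 2; q ^+ 2; q ^+ 4] (q ^+ 4)) =
  qpoch_inf (- q ^+ 1) (q ^+ 2) / qpoch_inf (q ^+ 2) (q ^+ 2) * A +
    x * (1 * (qpoch_inf (- q ^+ 2) (q ^+ 2) / qpoch_inf (q ^+ 2) (q ^+ 2) * B)).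
Proof.
move=> qcvg q1 q2; rewrite mul1r expr1 qpoch_inf_ratio1 // qpoch_inf_ratio2 //.
by rewrite [A / _]mulrC [B / _]mulrC.
Qed.

Lemma evaluation_odd_even (A B x : K) : cvg_qpochs K -> `|q| < 1 ->
    qpoch_inf (q ^+ 2) (q ^+ 2) != 0 ->
  A / qpochs_inf [:: q ^+ 2; q ^+ 2; q ^+ 4] (q ^+ 4) +
    x * (B / qpochs_inf [:: q; q ^+ 3; q ^+ 4] (q ^+ 4)) =
  qpoch_inf (- q ^+ 2) (q ^+ 2) / qpoch_inf (q ^+ 2) (q ^+ 2) * A +
    x * ((1 + q) * (qpoch_inf (- q ^+ 3) (q ^+ 2) / qpoch_inf (q ^+ 2) (q ^+ 2) * B)).
Proof.
move=> qcvg q1 q2; have q21 : `|q ^+ 2| < 1 by rewrite normrX exprn_ilt1.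
have e : (1 + q) * qpoch_inf (- q ^+ 3) (q ^+ 2) = qpoch_inf (- q) (q ^+ 2).
  by rewrite (qpoch_infS (- q) qcvg q21) opprK mulNr -exprS.
rewrite (mulrA (1 + q)) (mulrA (1 + q)) e qpoch_inf_ratio1 // qpoch_inf_ratio2 //.
by rewrite [A / _]mulrC [B / _]mulrC.
Qed.

Lemma evaluation_single (A : K) : cvg_qpochs K -> `|q| < 1 ->
    qpoch_inf (q ^+ 2) (q ^+ 2) != 0 ->
  A / qpochs_inf [:: q; q ^+ 3; q ^+ 4] (q ^+ 4) =
  1 * (qpoch_inf (- q) (q ^+ 2) / qpoch_inf (q ^+ 2) (q ^+ 2) * A).
Proof. by move=> qcvg q1 q2; rewrite mul1r qpoch_inf_ratio1 // mulrC. Qed.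

Lemma evaluation_singleS (A : K) : cvg_qpochs K -> `|q| < 1 ->
    qpoch_inf (q ^+ 2) (q ^+ 2) != 0 ->
  A / qpochs_inf [:: q; q ^+ 3; q ^+ 4] (q ^+ 4) =
  (1 + q) * (qpoch_inf (- q ^+ 3) (q ^+ 2) / qpoch_inf (q ^+ 2) (q ^+ 2) * A).
Proof.
move=> qcvg q1 q2; have q21 : `|q ^+ 2| < 1 by rewrite normrX exprn_ilt1.
have e : (1 + q) * qpoch_inf (- q ^+ 3) (q ^+ 2) = qpoch_inf (- q) (q ^+ 2).
  by rewrite (qpoch_infS (- q) qcvg q21) opprK mulNr -exprS.
by rewrite (mulrA (1 + q)) (mulrA (1 + q)) e qpoch_inf_ratio1 // mulrC.
Qed.

Lemma eq_qpochs_inf3 (a a' b b' c c' : K) : a = a' -> b = b' -> c = c' ->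
  qpochs_inf [:: a; b; c] c = qpochs_inf [:: a'; b'; c'] c'.
Proof. by move=> -> -> ->. Qed.

Lemma eq_ratio (a a' b b' : K) : a = a' -> b = b' -> a / b = a' / b'.
Proof. by move=> -> ->. Qed.

Lemma eq_sum_ratios (a a' b b' c c' d d' x x' : K) :
  a = a' -> b = b' -> x = x' -> c = c' -> d = d' ->
  a / b + x * (c / d) = a' / b' + x' * (c' / d').
Proof. by move=> -> -> -> -> ->. Qed.

End Betas.

(** * The six sums at q = exp(2 pi i tau) *)

Section Evaluations.
Variable R : realType.
Local Notation C := (R[i] : numFieldType).
Variable tau : R[i].
Hypothesis tau_gt0 : 0 < complex.Im tau.
Local Notation q := (qpow tau 1).

Lemma qpow1_props : [/\ q != 0, `|q| < 1 & nonroot q].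
Proof.
have q0 : q != 0 := qpow_neq0 tau 1.
have q1 : `|q| < 1 := norm_qpow_lt1 tau_gt0 ltr01.
by split=> //; exact: nonroot_norm_lt1.
Qed.

Lemma addnS_gt0 m n : (0 < m + n.+1)%N.
Proof. by rewrite addnS. Qed.

Lemma expr_neq0_lt1 (x : C) n : x != 0 -> `|x| < 1 -> (0 < n)%N -> x ^+ n != 0 /\ `|x ^+ n| < 1.
Proof.
move=> x0 x1 n0; rewrite expf_neq0 //; split=> //.
by rewrite normrX exprn_ilt1 // -lt0n.
Qed.

Lemma qpoch_sqr_inf_neq0 (x : C) : x != 0 -> `|x| < 1 -> qpoch_inf (x ^+ 2) (x ^+ 2) != 0.
Proof.
move=> x0 x1; apply: qpoch_inf_neq0; first by rewrite expf_neq0.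
by rewrite normrX exprn_ilt1.
Qed.

(** With j = r no linear term occurs in the tail sums, so l = 0 and s never drops. In the odd half z
    and p gain equal powers of q, and p/z = - q remains that of the seed. *)
Lemma has_sum_AD0 k (de h : rat) a b c rho0 sigma0 rho1 sigma1 (beta0 beta1 : nat -> C) :
    (0 < a)%N -> (0 < b)%N -> (0 < c)%N ->
    (forall m, -1 <= 2^-1 * de * m%:R * m%:R + h * m%:R) ->
    (forall m, beta0 m =
      qpow tau (2 * de * m%:R * m%:R + 2 * h * m%:R) / den2 (q ^+ 2) m m) ->
    (forall m, beta1 m =
      qpow tau (2 * de * (m%:R * m%:R + m%:R) + 2 * h * m%:R) / den1 (- q) m.+1 m) ->
    bailey_pair (q ^+ 2) rho0 sigma0 (q ^+ a) (q ^+ (a + b))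
      (foldr (step (q ^+ 2)) beta0 (nseq k.+1 0%N ++ nseq 0 1%N)) ->
    bailey_pair (q ^+ 2) rho1 sigma1 (q ^+ c) (- q ^+ (c + 1))
      (foldr (step (q ^+ 2)) beta1 (nseq k.+1 1%N ++ nseq 0 2%N)) ->
  has_sum (nahm_term tau (mx_of_entries k.+2 (AD_shift de k.+2))
    (col_of_entries k.+2 (b_shift 0 h k.+2 k.+2)) (d_AD k.+2))
   (qpochs_inf [:: q ^+ a; q ^+ b; q ^+ (a + b)] (q ^+ (a + b))
     / qpochs_inf [:: q; q ^+ 3; q ^+ 4] (q ^+ 4) +
    qpow tau (k.+1%:R / 2 + de / 2 + h) *
     (qpochs_inf [:: - q; q ^+ c; - q ^+ (c + 1)] (- q ^+ (c + 1))
      / qpochs_inf [:: q ^+ 2; q ^+ 2; q ^+ 4] (q ^+ 4))).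
Proof.
move=> a0 b0 c0 deh b0E b1E bp0 bp1; have [q0 q1 nq] := qpow1_props.
have q2 := qpoch_sqr_inf_neq0 q0 q1; have qcvg := @cvg_qpoch R.
have nz n := @expr_neq0_lt1 _ n q0 q1.
have nzN : - q != 0 /\ `|- q| < 1 by rewrite oppr_eq0 normrN.
have zw : q ^+ c * - q = - q ^+ (c + 1) by rewrite mulrN -exprSr addn1.
apply: (@has_sum_AD_shift R tau tau_gt0 k k.+1 0 de h 0 (q ^+ a) (q ^+ b) (q ^+ c) (- q) 1
  _ rho0 sigma0 rho1 sigma1 beta0 beta1) => //.
- exact: addn0.
- by have [? ?] := nz a a0; have [? ?] := nz b b0.
- by have [? ?] := nz c c0; have [? ?] := nzN.
- by move=> m; rewrite b0E -[LHS]mulrA (den2_even nq).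
- by move=> m; rewrite b1E mul1r -[LHS]mulrA (den1_odd nq).
- by rewrite -exprD.
- by rewrite zw.
rewrite zw -exprD addr0 [qpochs_inf [:: q ^+ c; _; _] _]qpochs_inf_swap.
exact: evaluation_even_odd.
Qed.

Lemma has_sum_AD1 k i l (de h : rat) a b c d rho0 sigma0 rho1 sigma1 (beta0 beta1 : nat -> C) :
    (i + l)%N = k.+1 -> (0 < a)%N -> (0 < b)%N -> (0 < c)%N -> (0 < d)%N ->
    (forall m, -1 <= 2^-1 * de * m%:R * m%:R + h * m%:R) ->
    (forall m, beta0 m =
      qpow tau (2 * de * m%:R * m%:R + 2 * h * m%:R) / den1 (- q) m m) ->
    (forall m, beta1 m =
      qpow tau (2 * de * (m%:R * m%:R + m%:R) + 2 * h * m%:R) / den2 (q ^+ 2) m.+1 m) ->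
    bailey_pair (q ^+ 2) rho0 sigma0 (- q ^+ a) (- q ^+ (a + b))
      (foldr (step (q ^+ 2)) beta0 (nseq i 0%N ++ nseq l 1%N)) ->
    bailey_pair (q ^+ 2) rho1 sigma1 (q ^+ c) (q ^+ (c + d))
      (foldr (step (q ^+ 2)) beta1 (nseq i 1%N ++ nseq l 2%N)) ->
  has_sum (nahm_term tau (mx_of_entries k.+2 (AD_shift de k.+2))
    (col_of_entries k.+2 (b_shift 1 h k.+2 i.+1)) (d_AD k.+2))
   (qpochs_inf [:: q ^+ b; - q ^+ a; - q ^+ (a + b)] (- q ^+ (a + b))
     / qpochs_inf [:: q ^+ 2; q ^+ 2; q ^+ 4] (q ^+ 4) +
    qpow tau (k.+1%:R / 2 + l%:R + de / 2 + h) *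
     (qpochs_inf [:: q ^+ d; q ^+ c; q ^+ (c + d)] (q ^+ (c + d))
      / qpochs_inf [:: q; q ^+ 3; q ^+ 4] (q ^+ 4))).
Proof.
move=> il a0 b0 c0 d0 deh b0E b1E bp0 bp1; have [q0 q1 nq] := qpow1_props.
have q2 := qpoch_sqr_inf_neq0 q0 q1; have qcvg := @cvg_qpoch R.
have nz n := @expr_neq0_lt1 _ n q0 q1.
have nzN : - q ^+ a != 0 /\ `|- q ^+ a| < 1 by rewrite oppr_eq0 normrN; exact: nz.
have zw : - q ^+ a * q ^+ b = - q ^+ (a + b) by rewrite mulNr -exprD.
apply: (@has_sum_AD_shift R tau tau_gt0 k i l de h 1 (- q ^+ a) (q ^+ b) (q ^+ c) (q ^+ d) (1 + q)
  _ rho0 sigma0 rho1 sigma1 beta0 beta1 il deh) => //.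
- by have [? ?] := nz b b0; have [? ?] := nzN.
- by have [? ?] := nz c c0; have [? ?] := nz d d0.
- by move=> m; rewrite b0E -[LHS]mulrA (den1_even nq).
- by move=> m; rewrite b1E -[X in _ * X]mulrA [LHS]mulrCA (den2_odd nq).
- by rewrite zw.
- by rewrite -exprD.
rewrite zw -exprD qpochs_inf_swap [qpochs_inf [:: q ^+ d; _; _] _]qpochs_inf_swap.
exact: evaluation_odd_even.
Qed.

Lemma has_sum_AvDv_b k i l : (i + l)%N = k.+1 -> let t := qpow tau 2^-1 in
  has_sum (nahm_term tau (AvDv k.+2) (b_AvDv k.+2 i.+1) (d_AvDv k.+2))
    (qpochs_inf [:: t ^+ (2 * i + 2); t ^+ (4 * l + 2 * i + 1);
       t ^+ (4 * l + 2 * i + 1 + (2 * i + 2))] (t ^+ (4 * l + 2 * i + 1 + (2 * i + 2)))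
     / qpochs_inf [:: t; t ^+ 3; t ^+ 4] (t ^+ 4)).
Proof.
move=> il t; have t0 : t != 0 := qpow_neq0 tau 2^-1.
have t1 : `|t| < 1 by apply: norm_qpow_lt1.
have nt := nonroot_norm_lt1 t0 t1; have t2 := qpoch_sqr_inf_neq0 t0 t1.
have qcvg := @cvg_qpoch R; have tq : qpow tau 1 = t ^+ 2 by rewrite -qpowMn mulVf.
have nz n := @expr_neq0_lt1 _ n t0 t1.
have y0 : - qpow tau (2^-1 + 0) = - t by rewrite addr0.
apply: (@has_sum_AvDv R tau tau_gt0 k i l 0 _ (t ^+ (4 * l + 2 * i + 1)) (t ^+ (2 * i + 2)) 1
  _ 1 0 (fun m => (den1 t m m)^-1) il) => //.
- have [? ?] := nz (4 * l + 2 * i + 1)%N (addnS_gt0 _ _).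
  by have [? ?] := nz (2 * i + 2)%N (addnS_gt0 _ _).
- by move=> m; rewrite y0 tq; exact: qpoch_opp_neq0.
- by move=> m; rewrite y0 tq (den1_single nt) -exprM.
- by rewrite tq -exprD; exact: bailey_single_a.
rewrite y0 tq -exprD qpochs_inf_swap.
exact: evaluation_single.
Qed.

(** This vector is b_1 with the first entry raised from 0 to 1. Hence i = 0, and y moves from -
    q^(1/2) to - q^(3/2), which calls for the seed with m = L + 1 in [den1]. *)
Lemma has_sum_AvDv_b0 k : let t := qpow tau 2^-1 in
  has_sum (nahm_term tau (AvDv k.+2) (b0_AvDv k.+2) (d_AvDv k.+2))
    (qpochs_inf [:: t; t ^+ (4 * k + 6); t ^+ (4 * k + 6 + 1)] (t ^+ (4 * k + 6 + 1))
     / qpochs_inf [:: t; t ^+ 3; t ^+ 4] (t ^+ 4)).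
Proof.
move=> t; have t0 : t != 0 := qpow_neq0 tau 2^-1.
have t1 : `|t| < 1 by apply: norm_qpow_lt1.
have nt := nonroot_norm_lt1 t0 t1; have t2 := qpoch_sqr_inf_neq0 t0 t1.
have qcvg := @cvg_qpoch R; have tq : qpow tau 1 = t ^+ 2 by rewrite -qpowMn mulVf.
have nz n := @expr_neq0_lt1 _ n t0 t1.
have y0 : - qpow tau (2^-1 + 1) = - t ^+ 3 by rewrite qpowD tq exprS.
have zw : t ^+ (4 * k + 6) * t = t ^+ (4 * k + 6 + 1) by rewrite -exprSr addn1.
apply: (@has_sum_AvDv R tau tau_gt0 k 0 k.+1 1 _ (t ^+ (4 * k + 6)) t (1 + t)
  _ 1 1 (fun m => (den1 t m.+1 m)^-1)) => //.
- by move=> s /=; rewrite subn1 -natr1 addrK.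
- by have [? ?] := nz (4 * k + 6)%N (addnS_gt0 _ _).
- by move=> m; rewrite y0 tq; exact: qpoch_opp_sqr_neq0.
- by move=> m; rewrite y0 tq (den1_singleS nt) -exprM.
- by rewrite tq zw; exact: bailey_single_b.
rewrite y0 tq zw qpochs_inf_swap.
exact: evaluation_singleS.
Qed.

Lemma AD_shiftE k : AD k.+2 = mx_of_entries k.+2 (AD_shift 0 k.+2).
Proof.
apply/matrixP => i j; rewrite !mxE /AD_shift.
by case: ifP => // /andP[/eqP-> /eqP->]; rewrite /AD_entry eqxx addr0.
Qed.

Lemma BD_shiftE k : BD k.+2 = mx_of_entries k.+2 (AD_shift 2^-1 k.+2).
Proof.
apply/matrixP => i j; rewrite !mxE /AD_shift.
by case: ifP => // _; field.
Qed.

Lemma col0_shiftE k : 0 = col_of_entries k.+2 (b_shift 0 0 k.+2 k.+2).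
Proof.
apply/colP => i; rewrite !mxE /b_shift; case: ifP => // _; case: ifP => [_|/eqP h].
  by rewrite subrr addr0.
have /eqP -> : (i.+1 - k.+2)%N == 0%N by rewrite subn_eq0 ltn_ord.
by rewrite mulr0.
Qed.

Lemma b0_BD_shiftE k : b0_BD k.+2 = col_of_entries k.+2 (b_shift 0 (- 2^-1) k.+2 k.+2).
Proof.
apply/colP => i; rewrite !mxE /b_shift.
have [-> //|] := eqVneq i.+1 1%N; case: ifP => [_ _|_ _]; first by rewrite subrr add0r.
have /eqP -> : (i.+1 - k.+2)%N == 0%N by rewrite subn_eq0 ltn_ord.
by rewrite mulr0.
Qed.

Lemma b_AD_shiftE k j : b_AD k.+2 j = col_of_entries k.+2 (b_shift 1 0 k.+2 j).
Proof. by apply/colP => i; rewrite !mxE /b_shift addr0. Qed.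

Lemma b_BD_shiftE k j : b_BD k.+2 j = col_of_entries k.+2 (b_shift 1 (- 1) k.+2 j).
Proof. by apply/colP => i; rewrite !mxE. Qed.

Lemma eq_has_sum (I : choiceType) (f : I -> C) (l l' : C) : has_sum f l' -> l = l' -> has_sum f l.
Proof. by move=> ? ->. Qed.

Lemma qpow_nat x n : x = n%:R -> qpow tau x = q ^+ n.
Proof. by move=> ->; rewrite -qpowMn mul1r. Qed.

Lemma qpow_half x n : x = 2^-1 * n%:R -> qpow tau x = qpow tau 2^-1 ^+ n.
Proof. by move=> ->; rewrite qpowMn. Qed.

Lemma qpowN x : qpow tau (- x) = (qpow tau x)^-1.
Proof.
apply: (mulfI (qpow_neq0 tau x)); rewrite -qpowD subrr qpow0 mulfV //.
exact: qpow_neq0.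
Qed.

Lemma sqr_bin2 m : m%:R * m%:R = 2 * ('C(m, 2))%:R + m%:R :> rat.
Proof. by rewrite -natrM -(bin2_sqr m) natrD natrM mulrC. Qed.

Lemma has_sum_AD_0 k :
  has_sum (nahm_term tau (AD k.+2) 0 (d_AD k.+2))
   (qpochs_inf [:: q ^+ (8 * k + 12); q ^+ (8 * k + 16); q ^+ (8 * k + 12 + (8 * k + 16))]
      (q ^+ (8 * k + 12 + (8 * k + 16)))
     / qpochs_inf [:: q; q ^+ 3; q ^+ 4] (q ^+ 4) +
    qpow tau (k.+1%:R / 2 + 0 / 2 + 0) *
     (qpochs_inf [:: - q; q ^+ (4 * k + 6); - q ^+ (4 * k + 6 + 1)] (- q ^+ (4 * k + 6 + 1))
      / qpochs_inf [:: q ^+ 2; q ^+ 2; q ^+ 4] (q ^+ 4))).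
Proof.
have [_ _ nq] := qpow1_props; rewrite AD_shiftE (col0_shiftE k).
apply: has_sum_AD0 (bailey_c nq k) (bailey_b nq k); try exact: addnS_gt0.
- by move=> m; lra.
- by move=> m; rewrite !mulr0 !mul0r addr0 qpow0 mul1r.
by move=> m; rewrite !mulr0 !mul0r addr0 qpow0 mul1r.
Qed.

Lemma has_sum_AD_b k i l : (i + l)%N = k.+1 ->
  has_sum (nahm_term tau (AD k.+2) (b_AD k.+2 i.+1) (d_AD k.+2))
   (qpochs_inf [:: q ^+ (2 * i + 2); - q ^+ (4 * l + 2 * i + 1);
        - q ^+ (4 * l + 2 * i + 1 + (2 * i + 2))] (- q ^+ (4 * l + 2 * i + 1 + (2 * i + 2)))
     / qpochs_inf [:: q ^+ 2; q ^+ 2; q ^+ 4] (q ^+ 4) +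
    qpow tau (k.+1%:R / 2 + l%:R + 0 / 2 + 0) *
     (qpochs_inf [:: q ^+ (4 * i + 4); q ^+ (16 * l + 12 * i + 8);
        q ^+ (16 * l + 12 * i + 8 + (4 * i + 4))] (q ^+ (16 * l + 12 * i + 8 + (4 * i + 4)))
      / qpochs_inf [:: q; q ^+ 3; q ^+ 4] (q ^+ 4))).
Proof.
move=> il; have [_ _ nq] := qpow1_props; rewrite AD_shiftE b_AD_shiftE.
apply: has_sum_AD1 il _ _ _ _ _ _ _ (bailey_a nq i l) (bailey_d nq i l); try exact: addnS_gt0.
- by move=> m; lra.
- by move=> m; rewrite !mulr0 !mul0r addr0 qpow0 mul1r.
by move=> m; rewrite !mulr0 !mul0r addr0 qpow0 mul1r.
Qed.

Lemma has_sum_BD_0 k :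
  has_sum (nahm_term tau (BD k.+2) (b0_BD k.+2) (d_AD k.+2))
   (qpochs_inf [:: q ^+ (8 * k + 8); q ^+ (8 * k + 12); q ^+ (8 * k + 8 + (8 * k + 12))]
      (q ^+ (8 * k + 8 + (8 * k + 12)))
     / qpochs_inf [:: q; q ^+ 3; q ^+ 4] (q ^+ 4) +
    qpow tau (k.+1%:R / 2 + 2^-1 / 2 + - 2^-1) *
     (qpochs_inf [:: - q; q ^+ (4 * k + 4); - q ^+ (4 * k + 4 + 1)] (- q ^+ (4 * k + 4 + 1))
      / qpochs_inf [:: q ^+ 2; q ^+ 2; q ^+ 4] (q ^+ 4))).
Proof.
have [_ _ nq] := qpow1_props; rewrite BD_shiftE b0_BD_shiftE.
apply: has_sum_AD0 (bailey_e nq k) (bailey_f nq k); try exact: addnS_gt0.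
(* The last variable contributes m^2/4 - m/2 = ((m - 1)^2 - 1)/4. *)
- by move=> m; have := sqr_ge0 (m%:R - 1 : rat); rewrite expr2; lra.
- move=> m; congr (_ / _); rewrite -exprM; apply/esym/qpow_nat.
  by rewrite natrM -[_ * m%:R * _]mulrA sqr_bin2; field.
move=> m; congr (_ / _); apply/esym/qpow_nat.
by rewrite natrM; field.
Qed.

Lemma has_sum_BD_b k i l : (i + l)%N = k.+1 ->
  has_sum (nahm_term tau (BD k.+2) (b_BD k.+2 i.+1) (d_AD k.+2))
   (qpochs_inf [:: q ^+ (2 * i + 2); - q ^+ (4 * l + 2 * i - 1);
        - q ^+ (4 * l + 2 * i - 1 + (2 * i + 2))] (- q ^+ (4 * l + 2 * i - 1 + (2 * i + 2)))
     / qpochs_inf [:: q ^+ 2; q ^+ 2; q ^+ 4] (q ^+ 4) +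
    qpow tau (k.+1%:R / 2 + l%:R + 2^-1 / 2 + - 1) *
     (qpochs_inf [:: q ^+ (4 * i + 4); q ^+ (16 * l + 12 * i);
        q ^+ (16 * l + 12 * i + (4 * i + 4))] (q ^+ (16 * l + 12 * i + (4 * i + 4)))
      / qpochs_inf [:: q; q ^+ 3; q ^+ 4] (q ^+ 4))).
Proof.
move=> il; have [_ _ nq] := qpow1_props; rewrite BD_shiftE b_BD_shiftE.
have il0 : (0 < i + l)%N by rewrite il.
apply: has_sum_AD1 il _ _ _ _ _ _ _ (bailey_g nq il0) (bailey_h nq i l); try exact: addnS_gt0.
- by clear -il0; lia.
- by clear -il0; lia.
(* Here m^2/4 - m = (m - 2)^2/4 - 1, so the lower bound -1 is attained at m = 2. *)
- by move=> m; have := sqr_ge0 (m%:R - 2 : rat); rewrite expr2; lra.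
- move=> m; congr (_ / _); rewrite -exprD -qpowMn mul1r -qpowMn mul1r -qpowN -qpowD.
  by congr (qpow tau _); rewrite natrM natrD; field.
move=> m; congr (_ / _); rewrite -exprM; apply/esym/qpow_nat.
by rewrite natrM mulrDr mulrA -[_ * m%:R * _]mulrA sqr_bin2; field.
Qed.

End Evaluations.

(** The i = j - 1 outer levels carry no linear term and the l = r - j inner ones carry one. Using i
    and l as parameters replaces the differences r - j and j - 1 by sums. *)
Lemma split_index k j : (1 <= j <= k.+2)%N -> exists i l, [/\ j = i.+1, (i + l)%N = k.+1,
  k.+2%:R = i%:R + l%:R + 1 :> rat & j%:R = i%:R + 1 :> rat].
Proof.
case: j => // i /andP[_ ik]; have e : (i + (k.+1 - i))%N = k.+1 by exact: subnKC.
by exists i, (k.+1 - i)%N; split; rewrite // -?natrD ?e natr1.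
Qed.

Theorem theorem1p5 (R : realType) (tau : R[i]) (tau_gt0 : 0 < complex.Im tau)
    (r : nat) (r_ge2 : (2 <= r)%N) :
  let q : rat -> R[i] := qpow tau in
  let r' : rat := r%:R in
  has_sum (nahm_term tau (AD r) 0 (d_AD r))
    (qpochs_inf [:: q (8 * r' - 4); q (8 * r'); q (16 * r' - 4)]
                (q (16 * r' - 4))
     / qpochs_inf [:: q 1; q 3; q 4] (q 4)
     + q ((r' - 1) / 2)
       * (qpochs_inf [:: - q 1; q (4 * r' - 2); - q (4 * r' - 1)]
                     (- q (4 * r' - 1))
          / qpochs_inf [:: q 2; q 2; q 4] (q 4)))
  /\
  (forall j : nat, (1 <= j <= r)%N ->
   let j' : rat := j%:R in
   has_sum (nahm_term tau (AD r) (b_AD r j) (d_AD r))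
    (qpochs_inf [:: q (2 * j'); - q (4 * r' - 2 * j' - 1); - q (4 * r' - 1)]
                (- q (4 * r' - 1))
     / qpochs_inf [:: q 2; q 2; q 4] (q 4)
     + q ((3 * r' - 2 * j' - 1) / 2)
       * (qpochs_inf [:: q (4 * j'); q (16 * r' - 4 * j' - 4);
                         q (16 * r' - 4)]
                     (q (16 * r' - 4))
          / qpochs_inf [:: q 1; q 3; q 4] (q 4))))
  /\
  has_sum (nahm_term tau (BD r) (b0_BD r) (d_AD r))
    (qpochs_inf [:: q (8 * r' - 8); q (8 * r' - 4); q (16 * r' - 12)]
                (q (16 * r' - 12))
     / qpochs_inf [:: q 1; q 3; q 4] (q 4)
     + q ((2 * r' - 3) / 4)
       * (qpochs_inf [:: - q 1; q (4 * r' - 4); - q (4 * r' - 3)]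
                     (- q (4 * r' - 3))
          / qpochs_inf [:: q 2; q 2; q 4] (q 4)))
  /\
  (forall j : nat, (1 <= j <= r)%N ->
   let j' : rat := j%:R in
   has_sum (nahm_term tau (BD r) (b_BD r j) (d_AD r))
    (qpochs_inf [:: q (2 * j'); - q (4 * r' - 3 - 2 * j'); - q (4 * r' - 3)]
                (- q (4 * r' - 3))
     / qpochs_inf [:: q 2; q 2; q 4] (q 4)
     + q ((6 * r' - 4 * j' - 5) / 4)
       * (qpochs_inf [:: q (4 * j'); q (16 * r' - 4 * j' - 12);
                         q (16 * r' - 12)]
                     (q (16 * r' - 12))
          / qpochs_inf [:: q 1; q 3; q 4] (q 4))))
  /\
  has_sum (nahm_term tau (AvDv r) (b0_AvDv r) (d_AvDv r))
    (qpochs_inf [:: q (1 / 2); q (2 * r' - 1); q (2 * r' - 1 / 2)]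
                (q (2 * r' - 1 / 2))
     / qpochs_inf [:: q (1 / 2); q (3 / 2); q 2] (q 2))
  /\
  (forall j : nat, (1 <= j <= r)%N ->
   let j' : rat := j%:R in
   has_sum (nahm_term tau (AvDv r) (b_AvDv r j) (d_AvDv r))
    (qpochs_inf [:: q j'; q (2 * r' - j' - 1 / 2); q (2 * r' - 1 / 2)]
                (q (2 * r' - 1 / 2))
     / qpochs_inf [:: q (1 / 2); q (3 / 2); q 2] (q 2))).
Proof.
case: r r_ge2 => [|[|k]] // _ q r'; have rE : r' = k%:R + 2 by rewrite /r' -natr1 -natr1; ring.
have e1 n x : x = n%:R -> q x = qpow tau 1 ^+ n by exact: qpow_nat.
have eN n x : x = n%:R -> - q x = - qpow tau 1 ^+ n by move=> h; rewrite (e1 _ _ h).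
have eh n x : x = 2^-1 * n%:R -> q x = qpow tau 2^-1 ^+ n by exact: qpow_half.
have odd_den : qpochs_inf [:: q 1; q 3; q 4] (q 4) =
    qpochs_inf [:: qpow tau 1; qpow tau 1 ^+ 3; qpow tau 1 ^+ 4] (qpow tau 1 ^+ 4).
  by apply: eq_qpochs_inf3; [exact: erefl | exact: e1 | exact: e1].
have even_den : qpochs_inf [:: q 2; q 2; q 4] (q 4) =
    qpochs_inf [:: qpow tau 1 ^+ 2; qpow tau 1 ^+ 2; qpow tau 1 ^+ 4] (qpow tau 1 ^+ 4).
  by apply: eq_qpochs_inf3; exact: e1.
have half_den : qpochs_inf [:: q (1 / 2); q (3 / 2); q 2] (q 2) = qpochs_inf
    [:: qpow tau 2^-1; qpow tau 2^-1 ^+ 3; qpow tau 2^-1 ^+ 4] (qpow tau 2^-1 ^+ 4).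
  apply: eq_qpochs_inf3; [by congr (qpow tau _); exact: mul1r | apply: eh | apply: eh];
    by field.
split; [|split; [|split; [|split; [|split]]]].
- apply: eq_has_sum (has_sum_AD_0 tau_gt0 k) _; apply: eq_sum_ratios odd_den _ _ even_den.
  + by apply: eq_qpochs_inf3; apply: e1; rewrite rE; ring.
  + by congr (qpow tau _); rewrite rE -natr1; field.
  apply: eq_qpochs_inf3; [exact: erefl | apply: e1 | apply: eN];
    by rewrite rE; ring.
- move=> j /split_index[i [l [-> il kE jE]]] j'; rewrite /j' jE.
  have r'E : r' = i%:R + l%:R + 1 := kE.
  have {}kE : k.+1%:R = i%:R + l%:R :> rat by rewrite -il natrD.
  apply: eq_has_sum (has_sum_AD_b tau_gt0 il) _; apply: eq_sum_ratios even_den _ _ odd_den.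
  + apply: eq_qpochs_inf3; [apply: e1 | apply: eN | apply: eN];
      by rewrite ?r'E; ring.
  + by congr (qpow tau _); rewrite r'E kE; field.
  by apply: eq_qpochs_inf3; apply: e1; rewrite ?r'E; ring.
- apply: eq_has_sum (has_sum_BD_0 tau_gt0 k) _; apply: eq_sum_ratios odd_den _ _ even_den.
  + by apply: eq_qpochs_inf3; apply: e1; rewrite rE; ring.
  + by congr (qpow tau _); rewrite rE -natr1; field.
  apply: eq_qpochs_inf3; [exact: erefl | apply: e1 | apply: eN];
    by rewrite rE; ring.
- move=> j /split_index[i [l [-> il kE jE]]] j'; rewrite /j' jE.
  have r'E : r' = i%:R + l%:R + 1 := kE.
  have {}kE : k.+1%:R = i%:R + l%:R :> rat by rewrite -il natrD.
  (* Makes the truncated subtraction in the exponent 4l + 2i - 1 a true one before it is cast to the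
     rationals. *)
  have il1 : (1 <= 4 * l + 2 * i)%N by clear -il; lia.
  apply: eq_has_sum (has_sum_BD_b tau_gt0 il) _; apply: eq_sum_ratios even_den _ _ odd_den.
  + apply: eq_qpochs_inf3; [apply: e1 | apply: eN | apply: eN]; first by ring.
      by rewrite r'E (natrB _ il1); ring.
    by rewrite r'E natrD (natrB _ il1); ring.
  + by congr (qpow tau _); rewrite r'E kE; field.
  by apply: eq_qpochs_inf3; apply: e1; rewrite ?r'E; ring.
- apply: eq_has_sum (has_sum_AvDv_b0 tau_gt0 k) _; apply: eq_ratio _ half_den.
  apply: eq_qpochs_inf3; first by congr (qpow tau _); exact: mul1r.
    by apply: eh; rewrite rE; field.
  by apply: eh; rewrite rE; field.
- move=> j /split_index[i [l [-> il kE jE]]] j'; rewrite /j' jE.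
  have r'E : r' = i%:R + l%:R + 1 := kE.
  apply: eq_has_sum (has_sum_AvDv_b tau_gt0 il) _; apply: eq_ratio _ half_den.
  by apply: eq_qpochs_inf3; apply: eh; rewrite ?r'E; field.
Qed.
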